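(* Let $k$ be a commutative ring and let $\mathcal{O}$ be a cofibrant operad in $C(k)$, i.e. a cofibrant object of $\mathrm{Op}(k)$. Then $\mathcal{O}$ is an $H_1$-operad: for every $\mathcal{O}$-algebra $A$ and every $d\in\mathbb{Z}$ the natural map $A\to A\sqcup F(\mathcal{O},W_d)$ is a quasi-isomorphism. In particular, the category $\mathrm{Alg}(\mathcal{O})$ of algebras over a cofibrant operad $\mathcal{O}$ admits a closed model category structure whose weak equivalences are the quasi-isomorphisms and whose fibrations are the surjective maps.
   Context: $k$ is an arbitrary commutative ring and $C(k)$ is the category of (unbounded, cohomologically graded) complexes of $k$-modules. $\mathrm{Op}(k)$ is the category of (symmetric) operads in $C(k)$. It carries a closed model category structure in which weak equivalences are the componentwise quasi-isomorphisms and fibrations are the componentwise surjective maps. Cofibrations in $\mathrm{Op}(k)$ are the retracts of standard cofibrations. A map $\mathcal{O}\to\mathcal{O}'$ is a standard cofibration if $\mathcal{O}'=\varinjlim_{s\in\mathbb{N}}\mathcal{O}_s$ with $\mathcal{O}_0=\mathcal{O}$, where each $\mathcal{O}_{s+1}$ is obtained from $\mathcal{O}_s$ by adding a set of free (homogeneous) generators $g_i$ with prescribed values $d(g_i)\in\mathcal{O}_s$ of the differential. An operad is cofibrant if the map from the initial operad to it is a cofibration. For $\mathcal{O}\in\mathrm{Op}(k)$, $\mathrm{Alg}(\mathcal{O})$ is the category of $\mathcal{O}$-algebras in $C(k)$, $\sqcup$ denotes the coproduct in $\mathrm{Alg}(\mathcal{O})$, and for $X\in C(k)$, $F(\mathcal{O},X)$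 is the free $\mathcal{O}$-algebra generated by $X$. For $d\in\mathbb{Z}$, $W_d\in C(k)$ is the contractible complex $0\to k\xrightarrow{=}k\to 0$ concentrated in degrees $d,d+1$. An operad $\mathcal{O}$ is called an $H_1$-operad if for every $A\in\mathrm{Alg}(\mathcal{O})$ and every $d\in\mathbb{Z}$ the natural map $A\to A\sqcup F(\mathcal{O},W_d)$ is a quasi-isomorphism. *)

(* Defs.v *)
From HB Require Import structures.
From mathcomp Require Import all_boot all_order all_fingroup all_algebra.
From mathcomp Require Import boolp.

Set Implicit Arguments.
Unset Strict Implicit.
Unset Printing Implicit Defensive.

Import GRing.Theory.
Local Open Scope ring_scope.

Record category := Category {
  ob :> Type;
  hom : ob -> ob -> Type;
  idc : forall A, hom A A;
  comp : forall A B C, hom B C -> hom A B -> hom A C;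
  comp1c : forall A B (f : hom A B), comp (idc B) f = f;
  compc1 : forall A B (f : hom A B), comp f (idc A) = f;
  compA : forall A B C D (h : hom C D) (g : hom B C) (f : hom A B),
    comp h (comp g f) = comp (comp h g) f }.

Arguments hom {c}.
Arguments idc {c}.
Arguments comp {c A B C}.

Notation "g \oc f" := (comp g f) (at level 50, left associativity).

Definition is_initial (C : category) (I : C) : Prop :=
  forall A : C, exists! f : hom I A, True.

Definition is_iso (C : category) (A B : C) (f : hom A B) : Prop :=
  exists g : hom B A, g \oc f = idc A /\ f \oc g = idc B.

Definition is_coproduct (C : category) (A B S : C)
    (i : hom A S) (j : hom B S) : Prop :=
  forall (T : C) (f : hom A T) (g : hom B T),
    exists! h : hom S T, h \oc i = f /\ h \oc j = g.

(* [c] exhibits [L] as the colimit of [S 0 -> S 1 -> S 2 -> ...] *)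
Definition is_seq_colimit (C : category) (S : nat -> C)
    (s : forall n, hom (S n) (S n.+1)) (L : C) (c : forall n, hom (S n) L) : Prop :=
  (forall n, c n.+1 \oc s n = c n) /\
  (forall (T : C) (t : forall n, hom (S n) T),
     (forall n, t n.+1 \oc s n = t n) ->
     exists! h : hom L T, forall n, h \oc c n = t n).

Definition is_retract (C : category) (A B X Y : C)
    (f : hom A B) (g : hom X Y) : Prop :=
  exists (i : hom A X) (r : hom X A) (j : hom B Y) (s : hom Y B),
    [/\ r \oc i = idc A, s \oc j = idc B, g \oc i = j \oc f & f \oc r = s \oc g].

Definition has_lifting (C : category) (A B X Y : C)
    (i : hom A B) (p : hom X Y) : Prop :=
  forall (u : hom A X) (v : hom B Y), p \oc u = v \oc i ->
    exists h : hom B X, h \oc i = u /\ p \oc h = v.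

Record functor (J C : category) := Functor {
  fob :> J -> C;
  fmap : forall a b, hom a b -> hom (fob a) (fob b);
  fmap1 : forall a, fmap (idc a) = idc (fob a);
  fmapM : forall a b c (g : hom b c) (f : hom a b),
    fmap (g \oc f) = fmap g \oc fmap f }.

Definition is_cone (J C : category) (F : functor J C) (L : C)
    (l : forall a, hom L (F a)) : Prop :=
  forall a b (f : hom a b), fmap F f \oc l a = l b.

Definition is_cocone (J C : category) (F : functor J C) (L : C)
    (l : forall a, hom (F a) L) : Prop :=
  forall a b (f : hom a b), l b \oc fmap F f = l a.

Definition has_limit (J C : category) (F : functor J C) : Prop :=
  exists (L : C) (l : forall a, hom L (F a)), is_cone l /\
    forall (T : C) (t : forall a, hom T (F a)), is_cone t ->
      exists! h : hom T L, forall a, l a \oc h = t a.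

Definition has_colimit (J C : category) (F : functor J C) : Prop :=
  exists (L : C) (l : forall a, hom (F a) L), is_cocone l /\
    forall (T : C) (t : forall a, hom (F a) T), is_cocone t ->
      exists! h : hom L T, forall a, h \oc l a = t a.

Definition finite_type (T : Type) : Prop :=
  exists (n : nat) (f : 'I_n -> T), forall x, exists i, f i = x.

Definition finite_category (J : category) : Prop :=
  finite_type J /\ forall a b : J, finite_type (hom a b).

Definition hom_class (C : category) := forall A B : C, hom A B -> Prop.

Definition retract_closed (C : category) (K : hom_class C) : Prop :=
  forall (A B X Y : C) (f : hom A B) (g : hom X Y), is_retract f g -> K _ _ g -> K _ _ f.

(* Quillen's axioms CM1-CM5: finite limits and colimits, two out of three,
   retracts, lifting, (not necessarily functorial) factorization. *)
Record closed_model_structure (C : category) (W Fib Cof : hom_class C) : Prop := {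
  cm_limits : forall (J : category) (F : functor J C),
    finite_category J -> has_limit F;
  cm_colimits : forall (J : category) (F : functor J C),
    finite_category J -> has_colimit F;
  cm_two_of_three : forall (X Y Z : C) (f : hom X Y) (g : hom Y Z),
    [/\ W _ _ f -> W _ _ g -> W _ _ (g \oc f),
        W _ _ f -> W _ _ (g \oc f) -> W _ _ g
      & W _ _ g -> W _ _ (g \oc f) -> W _ _ f];
  cm_retracts : [/\ retract_closed W, retract_closed Fib & retract_closed Cof];
  cm_lifting : forall (A B X Y : C) (i : hom A B) (p : hom X Y),
    Cof _ _ i -> Fib _ _ p -> W _ _ i \/ W _ _ p -> has_lifting i p;
  cm_factor_triv_fib : forall (X Y : C) (f : hom X Y),
    exists (Z : C) (i : hom X Z) (p : hom Z Y),
      [/\ f = p \oc i, Cof _ _ i, Fib _ _ p & W _ _ p];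
  cm_factor_triv_cof : forall (X Y : C) (f : hom X Y),
    exists (Z : C) (i : hom X Z) (p : hom Z Y),
      [/\ f = p \oc i, Cof _ _ i, W _ _ i & Fib _ _ p] }.

Record complex (k : comPzRingType) := Complex {
  cx_mod :> int -> lmodType k;
  cx_d : forall p, {linear cx_mod p -> cx_mod (p + 1)};
  cx_dd : forall p (x : cx_mod p), cx_d (p + 1) (cx_d p x) = 0 }.

Arguments cx_d {k c} p.

Section Complexes.
Variable k : comPzRingType.

Definition is_chain_map (X Y : complex k) (f : forall p, X p -> Y p) : Prop :=
  (forall p, linear (f p)) /\
  (forall p (x : X p), f (p + 1) (cx_d p x) = cx_d p (f p x)).

(* Bijectivity of the induced maps on cohomology; [p + 1] ranges over all
   degrees, and the coboundaries in that degree come from degree [p]. *)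
Definition quasi_iso (X Y : complex k) (f : forall p, X p -> Y p) : Prop :=
  forall p : int,
    (forall x : X (p + 1), cx_d _ x = 0 ->
       (exists y : Y p, f _ x = cx_d p y) -> exists w : X p, x = cx_d p w) /\
    (forall y : Y (p + 1), cx_d _ y = 0 ->
       exists x : X (p + 1), cx_d _ x = 0 /\ exists w : Y p, y - f _ x = cx_d p w).

Definition ksign (p : int) : k := (-1) ^+ `|p|%N.

Definition helt (X : complex k) := {p : int & X p}.

Definition hel (X : complex k) (p : int) (x : X p) : helt X :=
  existT (fun q => X q : Type) p x.

Definition hel_d (X : complex k) (u : helt X) : helt X := hel (cx_d _ (tagged u)).

Definition hel_map (X Y : complex k) (f : forall p, X p -> Y p) (u : helt X) : helt Y :=
  hel (f _ (tagged u)).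

(* The complex 0 -> k = k -> 0 in degrees d and d + 1: the module in degree p is
   k^1 if p is d or d + 1, and k^0 otherwise. *)
Definition disk_mod (d p : int) : lmodType k :=
  'rV[k]_((p == d) + (p == d + 1)%R).

Definition disk_d (d p : int) : {linear disk_mod d p -> disk_mod d (p + 1)} :=
  mulmxr (const_mx (p == d)%:R).

Lemma disk_dd d p (x : disk_mod d p) : disk_d d (p + 1) (disk_d d p x) = 0.
Proof.
rewrite /disk_d /mulmxr /= -mulmxA [X in _ *m X](_ : _ = 0) ?mulmx0 //.
apply/matrixP => i j; rewrite !mxE big1 // => l _; rewrite !mxE.
case: (p =P d) => [->|_]; last by rewrite mul0r.
by rewrite -subr_eq0 addrAC subrr add0r mulr0.
Qed.

Definition disk (d : int) : complex k := Complex (@disk_dd d).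

End Complexes.

Arguments ksign {k} p.

(* When an operation with n inputs is inserted at input [i] of another operation,
   input [a != i] of the outer one becomes input [outer_pos i n a] of the
   composite and input [b] of the inner one becomes input [i + b]. *)
Definition outer_pos (i n a : nat) : nat := if (a < i)%N then a else (a + n).-1.

(* [u] is the permutation of the inputs of a composite at input [i] induced by [s]
   on the outer and [t] on the inner inputs, [s i] becoming the input of insertion.
   The positions [outer_pos i n a] (a != i) and [i + b] partition ['I_r] when
   r + 1 = m + n, so there is exactly one such [u]. *)
Definition graft_perm (m n r : nat) (i : 'I_m) (s : 'S_m) (t : 'S_n) (u : 'S_r) : Prop :=
  (forall (a : 'I_m) (c : 'I_r), a != i -> c = outer_pos i n a :> nat ->
     u c = outer_pos (s i) n (s a) :> nat) /\
  (forall (b : 'I_n) (c : 'I_r), c = (i + b)%N :> nat -> u c = (s i + t b)%N :> nat).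

(* Symmetric operads in C(k) presented by partial compositions
   [x o_i y : O m ^p (x) O n ^q -> O (m + n - 1) ^(p + q)].  Arities and degrees
   of composites are only required to be provably the expected ones.
   [op_sym s x] is [x] with its input [j] renamed [s j]; as [(s * t) j = t (s j)]
   in ['S_n], this is a right action. *)
Record operad (k : comPzRingType) := Operad {
  op :> nat -> complex k;
  op_sym : forall n p, 'S_n -> op n p -> op n p;
  op_id : op 1%N 0;
  op_comp : forall m n r (p q t : int), r.+1 = (m + n)%N -> p + q = t ->
    'I_m -> op m p -> op n q -> op r t;

  op_sym_lin : forall n p (s : 'S_n), linear (@op_sym n p s);
  op_sym_d : forall n p (s : 'S_n) (x : op n p),
    op_sym s (cx_d p x) = cx_d p (op_sym s x);
  op_sym1 : forall n p (x : op n p), op_sym 1%g x = x;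
  op_symM : forall n p (s t : 'S_n) (x : op n p),
    op_sym (s * t)%g x = op_sym t (op_sym s x);

  op_id_d : cx_d 0 op_id = 0;

  op_comp_linl : forall m n r (p q t : int) (er : r.+1 = (m + n)%N) (et : p + q = t)
    (i : 'I_m) (y : op n q), linear (fun x : op m p => op_comp er et i x y);
  op_comp_linr : forall m n r (p q t : int) (er : r.+1 = (m + n)%N) (et : p + q = t)
    (i : 'I_m) (x : op m p), linear (fun y : op n q => op_comp er et i x y);
  op_comp_d : forall m n r (p q t : int) (er : r.+1 = (m + n)%N) (et : p + q = t)
    (el : (p + 1) + q = t + 1) (e2 : p + (q + 1) = t + 1)
    (i : 'I_m) (x : op m p) (y : op n q),
    cx_d t (op_comp er et i x y) =
      op_comp er el i (cx_d p x) y + ksign p *: op_comp er e2 i x (cx_d q y);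

  op_comp1x : forall n (q : int) (er : n.+1 = (1 + n)%N) (et : 0 + q = q) (x : op n q),
    op_comp er et ord0 op_id x = x;
  op_compx1 : forall m (p : int) (er : m.+1 = (m + 1)%N) (et : p + 0 = p)
    (i : 'I_m) (x : op m p), op_comp er et i x op_id = x;

  (* (x o_i y) o_(i+j) z = x o_i (y o_j z) *)
  op_comp_seq : forall l m n a b r (p q s t u v : int)
    (ea : a.+1 = (l + m)%N) (er : r.+1 = (a + n)%N)
    (eb : b.+1 = (m + n)%N) (er' : r.+1 = (l + b)%N)
    (et : p + q = t) (ev : t + s = v) (eu : q + s = u) (ev' : p + u = v)
    (i : 'I_l) (j : 'I_m) (ij : 'I_a) (x : op l p) (y : op m q) (z : op n s),
    ij = (i + j)%N :> nat ->
    op_comp er ev ij (op_comp ea et i x y) z =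
      op_comp er' ev' i x (op_comp eb eu j y z);

  (* (x o_i y) o_(j+m-1) z = (-1)^(|y||z|) (x o_j z) o_i y for i < j *)
  op_comp_par : forall l m n a b r (p q s t u v : int)
    (ea : a.+1 = (l + m)%N) (er : r.+1 = (a + n)%N)
    (eb : b.+1 = (l + n)%N) (er' : r.+1 = (b + m)%N)
    (et : p + q = t) (ev : t + s = v) (eu : p + s = u) (ev' : u + q = v)
    (i j : 'I_l) (i' : 'I_b) (j' : 'I_a) (x : op l p) (y : op m q) (z : op n s),
    (i < j)%N -> i' = i :> nat -> j'.+1 = (j + m)%N :> nat ->
    op_comp er ev j' (op_comp ea et i x y) z =
      ksign (q * s) *: op_comp er' ev' i' (op_comp eb eu j x z) y;

  op_comp_sym : forall m n r (p q t : int) (er : r.+1 = (m + n)%N) (et : p + q = t)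
    (i : 'I_m) (s : 'S_m) (w : 'S_n) (u : 'S_r) (x : op m p) (y : op n q),
    graft_perm i s w u ->
    op_comp er et (s i) (op_sym s x) (op_sym w y) =
      op_sym u (op_comp er et i x y) }.

Arguments op_sym {k o n p}.
Arguments op_id {k o}.
Arguments op_comp {k o m n r p q t}.

Section OperadCategory.
Variable k : comPzRingType.

Definition is_operad_hom (O P : operad k) (f : forall n p, O n p -> P n p) : Prop :=
  [/\ forall n, is_chain_map (f n),
      forall n p (s : 'S_n) (x : O n p), f n p (op_sym s x) = op_sym s (f n p x),
      f 1%N 0 op_id = op_id
    & forall m n r (p q t : int) (er : r.+1 = (m + n)%N) (et : p + q = t)
        (i : 'I_m) (x : O m p) (y : O n q),
        f r t (op_comp er et i x y) = op_comp er et i (f m p x) (f n q y)].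

Record operad_hom (O P : operad k) := OperadHom {
  operad_hom_fun :> forall n p, O n p -> P n p;
  operad_homP : is_operad_hom operad_hom_fun }.

Lemma operad_hom_id_proof (O : operad k) : is_operad_hom (fun n p (x : O n p) => x).
Proof. by []. Qed.

Lemma operad_hom_comp_proof (O P Q : operad k) (g : operad_hom P Q) (f : operad_hom O P) :
  is_operad_hom (fun n p (x : O n p) => g n p (f n p x)).
Proof.
case: g f => g [gc gs g1 gm] [f [fc fs f1 fm]]; split=> /=.
- move=> n; split=> [p a x y|p x]; first by rewrite (fc n).1 (gc n).1.
  by rewrite (fc n).2 (gc n).2.
- by move=> n p s x; rewrite fs gs.
- by rewrite f1 g1.
- by move=> *; rewrite fm gm.
Qed.

Definition operad_hom_id (O : operad k) := OperadHom (@operad_hom_id_proof O).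

Definition operad_hom_comp (O P Q : operad k) (g : operad_hom P Q) (f : operad_hom O P) :=
  OperadHom (operad_hom_comp_proof g f).

Lemma operad_hom_eq (O P : operad k) (f g : operad_hom O P) :
  operad_hom_fun f = operad_hom_fun g -> f = g.
Proof.
by case: f g => f fP [g gP] /= fg; case: g / fg gP => gP; congr OperadHom.
Qed.

Definition Op : category.
Proof.
apply: (@Category (operad k) operad_hom operad_hom_id operad_hom_comp) => *;
  exact: operad_hom_eq.
Defined.

End OperadCategory.

Section Cofibrations.
Variable k : comPzRingType.

(* [P] is obtained from [O] by adding free generators [g i], of arity [ar i] and
   degree [dg i], with prescribed differentials [z i]. *)
Definition is_free_extension (O P : Op k) (f : hom O P) : Prop :=
  exists (I : Type) (ar : I -> nat) (dg : I -> int)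
         (z : forall i, (O : operad k) (ar i) (dg i + 1))
         (g : forall i, (P : operad k) (ar i) (dg i)),
    [/\ forall i, cx_d _ (z i) = 0,
        forall i, cx_d _ (g i) = operad_hom_fun f (z i)
      & forall (Q : Op k) (h : hom O Q)
          (y : forall i, (Q : operad k) (ar i) (dg i)),
          (forall i, cx_d _ (y i) = operad_hom_fun h (z i)) ->
          exists! u : hom P Q,
            u \oc f = h /\ forall i, operad_hom_fun u (g i) = y i].

Definition standard_cofibration (O O' : Op k) (f : hom O O') : Prop :=
  exists (S : nat -> Op k) (s : forall n, hom (S n) (S n.+1))
         (c : forall n, hom (S n) O') (e : hom O (S 0%N)),
    [/\ is_iso e, forall n, is_free_extension (s n), is_seq_colimit s c
      & f = c 0%N \oc e].

Definition operad_cofibration (O O' : Op k) (f : hom O O') : Prop :=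
  exists (P P' : Op k) (g : hom P P'), standard_cofibration g /\ is_retract f g.

Definition cofibrant_operad (O : Op k) : Prop :=
  exists (I : Op k) (f : hom I O), is_initial I /\ operad_cofibration f.

End Cofibrations.

Section Algebras.
Variable k : comPzRingType.

Definition upd (n : nat) (T : Type) (a : 'I_n -> T) (i : 'I_n) (u : T) : 'I_n -> T :=
  fun j => if j == i then u else a j.

(* The Koszul sign of the rearrangement of [a 0, a 1, ...] into
   [a (s 0), a (s 1), ...]. *)
Definition koszul (X : complex k) (n : nat) (s : 'S_n) (a : 'I_n -> helt X) : k :=
  \prod_(i < n) \prod_(j < n | (i < j)%N && (s j < s i)%N)
    ksign (tag (a (s i)) * tag (a (s j))).

(* Algebras [A] given by multilinear maps [O n ^p x A^(q_1) x ... x A^(q_n) -> A^r],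
   [r = p + q_1 + ... + q_n], the arguments being tuples of homogeneous elements;
   the signs are those of the endomorphism operad of [A]. *)
Record algebra (O : operad k) := Algebra {
  alg :> complex k;
  act : forall n (p r : int) (x : O n p) (a : 'I_n -> helt alg),
    p + \sum_(i < n) tag (a i) = r -> alg r;

  act_linl : forall n (p r : int) (a : 'I_n -> helt alg) (e : p + \sum_(i < n) tag (a i) = r),
    linear (fun x : O n p => act x e);
  act_linr : forall n (p q r : int) (x : O n p) (a : 'I_n -> helt alg) (i : 'I_n)
    (c : k) (u v : alg q)
    (e : p + \sum_(j < n) tag (upd a i (hel (c *: u + v)) j) = r)
    (eu : p + \sum_(j < n) tag (upd a i (hel u) j) = r)
    (ev : p + \sum_(j < n) tag (upd a i (hel v) j) = r),
    act x e = c *: act x eu + act x ev;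

  act_d : forall n (p r : int) (x : O n p) (a : 'I_n -> helt alg)
    (e : p + \sum_(i < n) tag (a i) = r)
    (ex : p + 1 + \sum_(i < n) tag (a i) = r + 1)
    (ea : forall i, p + \sum_(j < n) tag (upd a i (hel_d (a i)) j) = r + 1),
    cx_d r (act x e) = act (cx_d p x) ex +
      \sum_(i < n) ksign (p + \sum_(j < n | (j < i)%N) tag (a j)) *: act x (ea i);

  act_sym : forall n (p r : int) (s : 'S_n) (x : O n p) (a : 'I_n -> helt alg)
    (e : p + \sum_(i < n) tag (a i) = r)
    (es : p + \sum_(i < n) tag (a (s i)) = r),
    act (op_sym s x) e = koszul s a *: act x (a := fun i => a (s i)) es;

  act_id : forall (q : int) (u : alg q) (e : 0 + \sum_(i < 1) tag (hel u) = q),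
    act op_id (a := fun=> hel u) e = u;

  (* (x o_i y)(a) = (-1)^(|y|(|a_0| + ... + |a_(i-1)|))
                      x(a_0, ..., a_(i-1), y(a_i, ..., a_(i+n-1)), a_(i+n), ...) *)
  act_comp : forall m n r (p q t w v : int) (er : r.+1 = (m + n)%N) (et : p + q = t)
    (i : 'I_m) (x : O m p) (y : O n q)
    (a : 'I_r -> helt alg) (b : 'I_n -> helt alg) (c : 'I_m -> helt alg)
    (ea : t + \sum_(j < r) tag (a j) = w)
    (eb : q + \sum_(j < n) tag (b j) = v)
    (ec : p + \sum_(j < m) tag (c j) = w),
    (forall (l : 'I_n) (j : 'I_r), j = (i + l)%N :> nat -> b l = a j) ->
    (forall (l : 'I_m) (j : 'I_r), l != i -> j = outer_pos i n l :> nat -> c l = a j) ->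
    c i = hel (act y eb) ->
    act (op_comp er et i x y) ea =
      ksign (q * \sum_(j < r | (j < i)%N) tag (a j)) *: act x ec }.

Variable O : operad k.

Definition is_alg_hom (A B : algebra O) (f : forall p, A p -> B p) : Prop :=
  is_chain_map f /\
  (forall n (p r : int) (x : O n p) (a : 'I_n -> helt A)
     (e : p + \sum_(i < n) tag (a i) = r)
     (e' : p + \sum_(i < n) tag (hel_map f (a i)) = r),
     f r (act x e) = act x (a := fun i => hel_map f (a i)) e').

Record alg_hom (A B : algebra O) := AlgHom {
  alg_hom_fun :> forall p, A p -> B p;
  alg_homP : is_alg_hom alg_hom_fun }.

Lemma alg_hom_id_proof (A : algebra O) : is_alg_hom (fun p (x : A p) => x).
Proof.
split=> // n p r x a e.
suff H (b : 'I_n -> helt A) (e' : p + \sum_(i < n) tag (b i) = r) :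
    b = a -> act x e = act x e'.
  by move=> e'; apply: H; apply: funext => i; rewrite /hel_map /hel; case: (a i).
by move=> ba; case: a / ba e => e; congr act.
Qed.

Lemma alg_hom_comp_proof (A B C : algebra O) (g : alg_hom B C) (f : alg_hom A B) :
  is_alg_hom (fun p (x : A p) => g p (f p x)).
Proof.
case: g f => g [gc ga] [f [fc fa]]; split=> /=.
  split=> [p a x y|p x]; first by rewrite fc.1 gc.1.
  by rewrite fc.2 gc.2.
move=> n p r x a e e'.
by rewrite (fa n p r x a e e) (ga n p r x (fun i => hel_map f (a i)) e e').
Qed.

Definition alg_hom_id (A : algebra O) := AlgHom (@alg_hom_id_proof A).

Definition alg_hom_comp (A B C : algebra O) (g : alg_hom B C) (f : alg_hom A B) :=
  AlgHom (alg_hom_comp_proof g f).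

Lemma alg_hom_eq (A B : algebra O) (f g : alg_hom A B) :
  alg_hom_fun f = alg_hom_fun g -> f = g.
Proof.
by case: f g => f fP [g gP] /= fg; case: g / fg gP => gP; congr AlgHom.
Qed.

Definition Alg : category.
Proof.
apply: (@Category (algebra O) alg_hom alg_hom_id alg_hom_comp) => *;
  exact: alg_hom_eq.
Defined.

Definition alg_quasi_iso : hom_class Alg :=
  fun A B f => quasi_iso (alg_hom_fun f).

Definition alg_surjective : hom_class Alg :=
  fun A B f => forall p (y : (B : algebra O) p), exists x, alg_hom_fun f x = y.

(* [eta] exhibits [F] as the free algebra F(O, X) generated by the complex [X]. *)
Definition is_free_algebra (X : complex k) (F : Alg)
    (eta : forall p, X p -> (F : algebra O) p) : Prop :=
  is_chain_map eta /\
  forall (B : Alg) (g : forall p, X p -> (B : algebra O) p), is_chain_map g ->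
    exists! h : hom F B, forall p x, alg_hom_fun h (eta p x) = g p x.

(* F(O, W_d) and the coproduct are given by their universal properties, hence
   only up to isomorphism: the first part says that they exist, the second one is
   the condition on the natural map. *)
Definition H1_operad : Prop :=
  forall (A : Alg) (d : int),
    (exists (F : Alg) (eta : forall p, disk k d p -> (F : algebra O) p)
            (S : Alg) (i : hom A S) (j : hom F S),
       is_free_algebra eta /\ is_coproduct i j) /\
    (forall (F : Alg) (eta : forall p, disk k d p -> (F : algebra O) p)
            (S : Alg) (i : hom A S) (j : hom F S),
       is_free_algebra eta -> is_coproduct i j -> alg_quasi_iso i).

End Algebras.

(* Main.v *)
(* Every morphism [f : A -> S] of algebras over a cofibrant operad [O] factors as a
   quasi-isomorphism followed by a surjection. Take the complex [M = A (+) K] with [K]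
   contractible and mapping onto [S], and the operad [D] of the pairs [(x, g)] of an operation
   [x] of [O] and a multilinear operation [g] on [M] compatible with [x] along [A -> M -> S].
   The projection [D -> O] is onto, and its kernel is acyclic because [A -> M] is a
   deformation retract; as [O] is cofibrant, it has a section, that is, [M] is an [O]-algebra
   and [A -> M -> S] are morphisms.

   Hence, by the retract argument, a morphism with the left lifting property against all
   surjections is a quasi-isomorphism. Adjoining [W_d], or any set of contractible cells,
   gives such a morphism. This yields the [H_1] property and one of the two factorizations;
   the other one, into a cofibration and a trivial fibration, is obtained in one step by
   freely adjoining, for every cocycle lying over some [d y], a primitive lying over [y].
   Colimits, free algebras and these cell attachments are all initial models, built as terms
   modulo equality in all models. *)
From HB Require Import structures.
From mathcomp Require Import all_boot all_order all_fingroup all_algebra.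
From mathcomp Require Import boolp.
From mathcomp Require Import ring zify.
Require Import Defs.

Set Implicit Arguments.
Unset Strict Implicit.
Unset Printing Implicit Defensive.

Import GRing.Theory.
Local Open Scope ring_scope.

(** * Signs, products and submodules *)

(** Surjectivity of [D -> O] and acyclicity of its kernel are conditions on each arity and degree
    separately. Hence neither the extension of an operation to [M] nor the homotopy that contracts
    the kernel has to commute with the symmetric groups; the lifting supplies the equivariance,
    because the generators of a cofibrant operad are free. No averaging occurs, so [k] may be any
    commutative ring. What does need care over such a [k] is that a surjection of modules may fail
    to split, while the value of a multilinear operation can be corrected multilinearly only through
    a linear section. This dictates [K]: it contains a copy of [S], so that [M -> S] is split in
    each degree, although not by a chain map. The underlying complex of the coproduct of [A] and
    [F(O, W_d)] is never computed; only its universal property enters. *)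

Section Signs.
Variable k : comPzRingType.
Notation ksign := (@ksign k).

Lemma ksign0 : ksign 0 = 1. Proof. by []. Qed.

Lemma ksignS p : ksign (p + 1) = - ksign p.
Proof.
rewrite /Defs.ksign; case: p => [n|n].
  by rewrite -PoszD /= addn1 exprS mulN1r.
rewrite NegzE.
have -> : - n.+1%:Z + 1 = - n%:Z by lia.
by rewrite !abszN !absz_nat exprS mulN1r opprK.
Qed.

Lemma ksignD p q : ksign (p + q) = ksign p * ksign q.
Proof.
elim/int_ind: q => [|n IH|n IH]; first by rewrite addr0 mulr1.
  by rewrite -[n.+1]addn1 PoszD addrA !ksignS IH mulrN.
have IH' := ksignS (p - n.+1%:Z); have IHn := ksignS (- n.+1%:Z).
move: IH' IHn.
have -> : p - n.+1%:Z + 1 = p - n%:Z by lia.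
have -> : - n.+1%:Z + 1 = - n%:Z by lia.
by rewrite IH => + e; rewrite e mulrN => /eqP; rewrite eqr_opp => /eqP ->.
Qed.

Lemma ksign_sqr p : ksign p * ksign p = 1.
Proof. by rewrite /Defs.ksign -exprMn mulrNN mulr1 expr1n. Qed.

Lemma ksignN p : ksign (- p) = ksign p.
Proof. by rewrite /Defs.ksign abszN. Qed.

Lemma ksign_even p : ksign (p * 2) = 1.
Proof. by rewrite mulrDr mulr1 ksignD ksign_sqr. Qed.

Lemma ksign_eq p q r : p = q + r * 2 -> ksign p = ksign q.
Proof. by move=> ->; rewrite ksignD ksign_even mulr1. Qed.

Lemma ksign_sum (I : Type) (r : seq I) (P : pred I) (F : I -> int) :
  ksign (\sum_(i <- r | P i) F i) = \prod_(i <- r | P i) ksign (F i).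
Proof. by apply: (big_morph _ ksignD); rewrite ksign0. Qed.

End Signs.

Section DependentProducts.
Variables (k : comPzRingType) (I : Type) (V : I -> lmodType k).

(** One module structure serves the product of all degrees of a complex, the multilinear operations
    on it, and products of algebras. Equality and choice on it are classical. *)
Definition pi_mod : Type := forall i, V i.
HB.instance Definition _ := gen_eqMixin pi_mod.
HB.instance Definition _ := gen_choiceMixin pi_mod.

Fact pi_addA : associative (fun x y : pi_mod => (fun i => x i + y i) : pi_mod).
Proof. by move=> x y z; apply: functional_extensionality_dep => i; rewrite addrA. Qed.
Fact pi_addC : commutative (fun x y : pi_mod => (fun i => x i + y i) : pi_mod).
Proof. by move=> x y; apply: functional_extensionality_dep => i; rewrite addrC. Qed.
Fact pi_add0 :
  left_id ((fun i => 0) : pi_mod) (fun x y : pi_mod => (fun i => x i + y i) : pi_mod).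
Proof. by move=> x; apply: functional_extensionality_dep => i; rewrite add0r. Qed.
Fact pi_addN : left_inverse ((fun i => 0) : pi_mod) (fun x : pi_mod => (fun i => - x i) : pi_mod)
  (fun x y : pi_mod => (fun i => x i + y i) : pi_mod).
Proof. by move=> x; apply: functional_extensionality_dep => i; rewrite addNr. Qed.
HB.instance Definition _ := GRing.isZmodule.Build pi_mod pi_addA pi_addC pi_add0 pi_addN.

Definition pi_scale (c : k) (x : pi_mod) : pi_mod := fun i => c *: x i.
Fact pi_scaleA a b x : pi_scale a (pi_scale b x) = pi_scale (a * b) x.
Proof. by apply: functional_extensionality_dep => i; rewrite /pi_scale scalerA. Qed.
Fact pi_scale1 : left_id 1 pi_scale.
Proof. by move=> x; apply: functional_extensionality_dep => i; rewrite /pi_scale scale1r. Qed.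
Fact pi_scaleDr : right_distributive pi_scale +%R.
Proof. by move=> a x y; apply: functional_extensionality_dep => i; rewrite /pi_scale scalerDr. Qed.
Fact pi_scaleDl x : {morph (pi_scale^~ x) : a b / a + b}.
Proof. by move=> a b; apply: functional_extensionality_dep => i; rewrite /pi_scale scalerDl. Qed.
HB.instance Definition _ :=
  GRing.Zmodule_isLmodule.Build k pi_mod pi_scaleA pi_scale1 pi_scaleDr pi_scaleDl.

Lemma pi0E i : (0 : pi_mod) i = 0. Proof. by []. Qed.
Lemma piDE (x y : pi_mod) i : (x + y) i = x i + y i. Proof. by []. Qed.
Lemma piNE (x : pi_mod) i : (- x) i = - x i. Proof. by []. Qed.
Lemma piZE c (x : pi_mod) i : (c *: x) i = c *: x i. Proof. by []. Qed.
Lemma piE (x y : pi_mod) : (forall i, x i = y i) -> x = y.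
Proof. by move=> e; apply: functional_extensionality_dep. Qed.
Lemma pi_sumE (J : Type) (r : seq J) (P : pred J) (F : J -> pi_mod) i :
  (\sum_(j <- r | P j) F j) i = \sum_(j <- r | P j) F j i.
Proof. by elim/big_rec2: _ => // j y1 y2 _ <-. Qed.
End DependentProducts.

Section Submodules.
Variables (k : comPzRingType) (V : lmodType k).

(** Membership is a proposition; classical reflection turns it into the boolean predicate that the
    subtype machinery for modules expects. The instances are the pairs that form the operad [D] and
    the subalgebras of products. *)
Record submod := Submod {
  submod_pred :> V -> Prop;
  submod_closed_lin : submod_pred 0 /\
    forall (c : k) x y, submod_pred x -> submod_pred y -> submod_pred (c *: x + y) }.

Variable S : submod.
Definition submod_bool : {pred V} := fun x => `[<S x>].
Fact submod_bool_closed : GRing.submod_closed submod_bool.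
Proof.
have [S0 SD] := submod_closed_lin S.
split; first exact/asboolP.
by move=> c x y /asboolP Sx /asboolP Sy; apply/asboolP/SD.
Qed.
HB.instance Definition _ :=
  GRing.isSubmodClosed.Build k V submod_bool submod_bool_closed.

Record smod := Smod { smod_val : V; smod_valP : smod_val \in submod_bool }.
HB.instance Definition _ := [isSub for smod_val].
HB.instance Definition _ := [Choice of smod by <:].
HB.instance Definition _ := [SubChoice_isSubLmodule of smod by <:].

Definition to_smod x (Sx : S x) : smod := Smod (introT (asboolP _) Sx).
Lemma smodP (x : smod) : S (smod_val x).
Proof. exact: elimT (asboolP _) (smod_valP x). Qed.
Lemma smod_inj (x y : smod) : smod_val x = smod_val y -> x = y.
Proof. exact: val_inj. Qed.
Lemma smod_lin : linear smod_val. Proof. by move=> c x y; rewrite -(linearP (val : smod -> V)). Qed.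
End Submodules.

(** * Homogeneous elements and tuples *)

Section TotalSpace.
Variables (k : comPzRingType) (X : complex k).

Definition cx_cast (p q : int) (e : p = q) (x : X p) : X q :=
  eq_rect p (fun r => X r : Type) x q e.

Lemma cx_cast_id p (e : p = p) (x : X p) : cx_cast e x = x.
Proof. by rewrite (Prop_irrelevance e erefl). Qed.

Lemma cx_cast_lin p q (e : p = q) : linear (cx_cast e).
Proof. by case: q / e. Qed.

Lemma hel_eta (u : helt X) : hel (tagged u) = u.
Proof. by case: u. Qed.

Definition total := pi_mod (fun r => X r).

(** Degree [r] receives the differential from [r - 1], and [r - 1 + 1] is [r] only up to a proof.
    The cast is confined to this place; [total_dE] removes it in degrees written as [p + 1]. *)
Definition total_d (v : total) : total :=
  fun r => cx_cast (subrK 1 r) (cx_d (r - 1) (v (r - 1))).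

Lemma total_dE (v : total) p : total_d v (p + 1) = cx_d p (v p).
Proof.
rewrite /total_d; have : p + 1 - 1 = p by rewrite addrK.
move: (subrK 1 (p + 1)); move: (p + 1 - 1) => q e qp.
by case: _ / qp e => e; rewrite cx_cast_id.
Qed.

Lemma totalE (u v : total) : (forall p, u (p + 1) = v (p + 1)) -> u = v.
Proof.
move=> e; apply: piE => r; have <- : r - 1 + 1 = r by rewrite subrK.
exact: e.
Qed.

Lemma total_d_lin : linear total_d.
Proof. by move=> c u v; apply: totalE => p; rewrite piDE piZE !total_dE piDE piZE linearP. Qed.
HB.instance Definition _ := GRing.isLinear.Build k total total _ total_d total_d_lin.

Lemma total_dd v : total_d (total_d v) = 0.
Proof.
apply: piE => r; have [p ->] : exists p, r = p + 1 + 1.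
  by exists (r - 1 - 1); rewrite !subrK.
by rewrite !total_dE cx_dd.
Qed.

Definition single (p : int) (x : X p) : total :=
  fun r => if p =P r is ReflectT e then cx_cast e x else 0.

Lemma single_id p (x : X p) : single x p = x.
Proof. by rewrite /single; case: eqP => // e; rewrite cx_cast_id. Qed.

Lemma single0 p q (x : X p) : p <> q -> single x q = 0.
Proof. by rewrite /single; case: eqP. Qed.

Lemma single_lin p : linear (@single p).
Proof.
move=> c x y; apply: piE => r; rewrite piDE piZE /single.
by case: eqP => e; rewrite ?cx_cast_lin // scaler0 addr0.
Qed.
HB.instance Definition _ p := GRing.isLinear.Build k (X p) total _ (@single p) (@single_lin p).

Lemma total_d_single p (x : X p) : total_d (single x) = single (cx_d p x).
Proof.
apply: totalE => q; rewrite total_dE.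
case: (p =P q) => [<-|ne]; first by rewrite !single_id.
rewrite !single0 ?linear0 // => /(congr1 (fun z => z - 1)).
by rewrite !addrK.
Qed.

Lemma single_tot (v : total) p : (forall r, r <> p -> v r = 0) -> v = single (v p).
Proof.
move=> v0; apply: piE => r; case: (p =P r) => [<-|ne]; first by rewrite single_id.
by rewrite single0 // v0 //; exact: nesym.
Qed.

Lemma hel_total (v : total) p q : p = q -> hel (v p) = hel (v q).
Proof. by move=> ->. Qed.

End TotalSpace.

Section BigSplice.
Variables (R : Type) (idx : R) (op : Monoid.com_law idx).

(* The inputs of a composite at input [i]: the inner ones form an interval. *)
Lemma big_splice m n r i (F : nat -> R) : r.+1 = (m + n)%N -> (i < m)%N ->
  \big[op/idx]_(j < r) F j =
  \big[op/idx]_(l < m) (if l == i :> nat then \big[op/idx]_(b < n) F (i + b)%N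
                        else F (outer_pos i n l)).
Proof.
move=> er im.
rewrite -(big_mkord xpredT F).
rewrite -(big_mkord xpredT (fun l => if l == i then \big[op/idx]_(b < n) F (i + b)%N
                        else F (outer_pos i n l))).
rewrite (big_cat_nat (n := i)) //=; last by lia.
rewrite [RHS](big_cat_nat (n := i)) //=; last by lia.
congr (op _ _).
  apply: eq_big_nat => l li; rewrite ifN; last by lia.
  by rewrite /outer_pos ifT //; lia.
rewrite (big_cat_nat (n := (i + n)%N)) //=; [|lia|lia].
rewrite [RHS](big_cat_nat (n := i.+1)) //=.
congr (op _ _).
  rewrite big_nat1 eqxx -(big_mkord xpredT (fun b => F (i + b)%N)).
  by rewrite -{1}[i]add0n big_addn addKn; apply: eq_bigr => b _; rewrite addnC.
case: n er => [|n] er.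
  rewrite addn0; have -> : r = m.-1 by lia.
  rewrite -[in RHS](addn1 i) -[m in RHS](subnK (m := 1)); last by lia.
  rewrite big_addn addnK subn1; apply: eq_big_nat => l li.
  by rewrite ifN ?/outer_pos ?ifN; [congr F|..]; lia.
rewrite (_ : (i + n.+1)%N = (i.+1 + n)%N); last by lia.
rewrite big_addn (_ : (r - n)%N = m); last by lia.
apply: eq_big_nat => l li.
by rewrite ifN ?/outer_pos ?ifN; [congr F|..]; lia.
Qed.

End BigSplice.

Section Tuples.
Variables (k : comPzRingType) (X : complex k).
Implicit Types (a : nat -> helt X) (u : helt X).

Definition psum a n : int := \sum_(j < n) tag (a j).
Definition set_at a i u : nat -> helt X := fun j => if j == i then u else a j.
Definition shift i a : nat -> helt X := fun j => a (i + j)%N.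
(** These are the arguments seen by the outer operation of a composite when the inner one, of arity
    [n] and inserted at input [i], returns [u]. *)
Definition splice i n u a : nat -> helt X :=
  fun l => if l == i then u else a (outer_pos i n l).

Lemma psumS a n : psum a n.+1 = psum a n + tag (a n).
Proof. exact: big_ord_recr. Qed.

Lemma eq_psum a b n : (forall j, (j < n)%N -> tag (a j) = tag (b j)) -> psum a n = psum b n.
Proof. by move=> e; apply: eq_bigr => j _; apply: e. Qed.

Lemma psum_set a i u n :
  psum (set_at a i u) n = psum a n + (if (i < n)%N then tag u - tag (a i) else 0).
Proof.
elim: n => [|n IH]; first by rewrite /psum !big_ord0 addr0.
rewrite !psumS IH /set_at ltnS; case: (ltngtP i n) => [h|h|h].
- by ring.
- by ring.
- by subst i; ring.
Qed.

Lemma psum_shift i n a : psum a (i + n) = psum a i + psum (shift i a) n.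
Proof.
elim: n => [|n IH]; first by rewrite addn0 /psum big_ord0 addr0.
by rewrite addnS !psumS IH addrA.
Qed.

Lemma psum_splice m n r i q a u : r.+1 = (m + n)%N -> (i < m)%N ->
  tag u = q + psum (shift i a) n -> psum (splice i n u a) m = q + psum a r.
Proof.
move=> er im eu; rewrite /psum (big_splice _ (fun j => tag (a j)) er im) /=.
rewrite (bigD1 (Ordinal im)) //= [in RHS](bigD1 (Ordinal im)) //= eqxx.
rewrite {1}/splice eqxx eu addrA; congr (_ + _).
by apply: eq_bigr => l; rewrite -val_eqE /= /splice => /negPf ->.
Qed.

Lemma psum_splice_le n i l a u : (l <= i)%N -> psum (splice i n u a) l = psum a l.
Proof.
move=> li; apply: eq_psum => j jl; rewrite /splice ifN; last by lia.
by rewrite /outer_pos ifT //; lia.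
Qed.

(** A prefix of length [l > i] is itself the argument list of a composite with outer arity [l], so
    [psum_splice] applies to it. *)
Lemma psum_splice_gt n i l q a u : (i < l)%N ->
  tag u = q + psum (shift i a) n -> psum (splice i n u a) l = q + psum a (l + n).-1.
Proof. by move=> il eu; apply: psum_splice eu => //; lia. Qed.

Lemma set_at_set a i u u' : set_at (set_at a i u) i u' = set_at a i u'.
Proof. by apply: funext => j; rewrite /set_at; case: eqP. Qed.

Lemma set_atC a i j u u' : i <> j ->
  set_at (set_at a i u) j u' = set_at (set_at a j u') i u.
Proof. by move=> ij; apply: funext => l; rewrite /set_at; do 2 case: eqP => //; congruence. Qed.

Lemma splice_set n i u u' a : set_at (splice i n u a) i u' = splice i n u' a.
Proof. by apply: funext => l; rewrite /set_at /splice; case: eqP. Qed.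

Lemma outer_pos_inj i n l l' : l <> i -> l' <> i ->
  outer_pos i n l = outer_pos i n l' -> l = l'.
Proof. by rewrite /outer_pos; case: (ltnP l i); case: (ltnP l' i); lia. Qed.

Lemma outer_pos_inner i n l b : l <> i -> (b < n)%N -> outer_pos i n l <> (i + b)%N.
Proof. by rewrite /outer_pos; case: (ltnP l i); lia. Qed.

Lemma splice_set_outer n i l u u' a : l <> i ->
  splice i n u (set_at a (outer_pos i n l) u') = set_at (splice i n u a) l u'.
Proof.
move=> li; apply: funext => j; rewrite /set_at /splice.
case: (j =P i) => [->|ji]; first by rewrite ifN //; apply/eqP; exact: nesym.
case: (j =P l) => [->|jl]; first by rewrite eqxx.
by rewrite ifN //; apply/eqP => /(outer_pos_inj ji li).
Qed.

Lemma splice_set_inner n i b u u' a : (b < n)%N ->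
  splice i n u (set_at a (i + b)%N u') = splice i n u a.
Proof.
move=> bn; apply: funext => j; rewrite /set_at /splice; case: (j =P i) => // ji.
by rewrite ifN //; apply/eqP/outer_pos_inner.
Qed.

Lemma shift_set_inner i b u a : shift i (set_at a (i + b)%N u) = set_at (shift i a) b u.
Proof. by apply: funext => j; rewrite /shift /set_at eqn_add2l. Qed.

Lemma shift_set_outer i n l u a b : l <> i -> (b < n)%N ->
  shift i (set_at a (outer_pos i n l) u) b = shift i a b.
Proof.
by move=> li bn; rewrite /shift /set_at ifN //; apply/eqP/nesym/outer_pos_inner.
Qed.

End Tuples.

(** * Koszul signs *)

Section BigPairs.
Variables (R : Type) (idx : R) (op : Monoid.com_law idx).

(** Grouping by unordered pairs of indices is how signs cancel, both in the multiplicativity of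
    Koszul signs and in the square of the differential of an operation. *)
Lemma big_pairs n (Q : 'I_n -> 'I_n -> R) : (forall i, Q i i = idx) ->
  \big[op/idx]_(i < n) \big[op/idx]_(j < n) Q i j =
  \big[op/idx]_(i < n) \big[op/idx]_(j < n)
    (if (i < j)%N then op (Q i j) (Q j i) else idx).
Proof.
move=> Q0.
transitivity (op (\big[op/idx]_(i < n) \big[op/idx]_(j < n) (if (i < j)%N then Q i j else idx))
   (\big[op/idx]_(i < n) \big[op/idx]_(j < n) (if (j < i)%N then Q i j else idx))).
  rewrite -big_split; apply: eq_bigr => i _; rewrite -big_split.
  apply: eq_bigr => j _ /=; case: (ltngtP i j) => ij; rewrite ?Monoid.mulm1 ?Monoid.mul1m //.
  by rewrite (val_inj ij).
rewrite [X in op _ X]exchange_big -big_split; apply: eq_bigr => i _.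
rewrite -big_split; apply: eq_bigr => j _ /=.
by case: ifP; rewrite ?Monoid.mulm1.
Qed.

End BigPairs.

Section PermutationSigns.
Variable k : comPzRingType.
Notation ksign := (@ksign k).

(* Tuples are indexed by [nat], so permutations are extended by the identity. *)
Definition perm_nat n (s : 'S_n) (j : nat) : nat :=
  if insub j is Some i then s i else j.

Lemma perm_natE n (s : 'S_n) (i : 'I_n) : perm_nat s i = s i.
Proof. by rewrite /perm_nat valK. Qed.

Lemma perm_nat_val n (s : 'S_n) (i : 'I_n) j : j = i :> nat -> perm_nat s j = s i.
Proof. by move=> ->; exact: perm_natE. Qed.

Definition kz n (s : 'S_n) (t : nat -> int) : k :=
  \prod_(i < n) \prod_(j < n)
    (if (i < j)%N && (s j < s i)%N then ksign (t (s i) * t (s j)) else 1).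

Lemma koszulE (X : complex k) n (s : 'S_n) (a : nat -> helt X) :
  koszul s (fun i : 'I_n => a i) = kz s (fun j => tag (a j)).
Proof. by apply: eq_bigr => i _; rewrite big_mkcond. Qed.

Lemma eq_kz n (s : 'S_n) (t t' : nat -> int) : (forall i : 'I_n, t i = t' i) -> kz s t = kz s t'.
Proof. by move=> e; apply: eq_bigr => i _; apply: eq_bigr => j _; rewrite !e. Qed.

Lemma kz1 n t : kz (1%g : 'S_n) t = 1.
Proof.
rewrite /kz big1 // => i _; rewrite big1 // => j _.
by rewrite !perm1; case: ifP => // /andP[]; lia.
Qed.

(** A pair is inverted by the product exactly when one, but not both, of [s] and then [w] inverts
    it; a pair inverted by both contributes the square of a sign. *)
Lemma kzM n (s w : 'S_n) t :
  kz (s * w)%g t = kz w t * kz s (fun j => t (perm_nat w j)).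
Proof.
pose f (i j : 'I_n) := ksign (t (w (s i)) * t (w (s j))).
have -> : kz w t = \prod_(i < n) \prod_(j < n)
    (if (s i < s j)%N && (w (s j) < w (s i))%N then f i j else 1).
  rewrite [LHS](reindex_inj (@perm_inj _ s)); apply: eq_bigr => i _.
  by rewrite (reindex_inj (@perm_inj _ s)).
rewrite big_pairs; last by move=> i; rewrite ltnn.
rewrite -big_split; apply: eq_bigr => i _; rewrite -big_split; apply: eq_bigr => j _ /=.
rewrite !permM !perm_natE -/(f i j).
have fC : f j i = f i j by rewrite /f mulrC.
have ff : f i j * f i j = 1 by exact: ksign_sqr.
rewrite fC; case: (ltnP i j) => ij //=; last by rewrite mulr1.
have ne (z : 'S_n) : (z i < z j)%N = ~~ (z j < z i)%N.
  by rewrite ltn_neqAle -leqNgt andb_idl // => _; rewrite val_eqE (inj_eq perm_inj) -val_eqE /=; lia.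
have := ne w; have := ne s; have := ne (s * w)%g; rewrite !permM => -> -> _.
by case: (s j < s i)%N; case: (w (s j) < w (s i))%N; rewrite /= ?mulr1 ?mul1r.
Qed.

(** The extra degree [c] on the entry [s i] acts like a symbol of degree [c] standing in front of
    it. The two sides move this symbol to the front before and after the permutation, and an entry
    passed both times contributes a square. With [c = 1] this makes differentials equivariant; with
    [c] the degree of an inner operation it makes composites equivariant. *)
Lemma kz_add n (s : 'S_n) (i : 'I_n) (c : int) t :
  kz s (fun l => t l + (if l == s i :> nat then c else 0)) * ksign (c * \sum_(l < s i) t l) =
  kz s t * ksign (c * \sum_(j < i) t (perm_nat s j)).
Proof.
have -> : \sum_(l < s i) t l = \sum_(j < n) (if (s j < s i)%N then t (s j) else 0).
  rewrite (big_ord_widen n t); last by rewrite ltnW.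
  by rewrite big_mkcond [LHS](reindex_inj (@perm_inj _ s)).
have -> : \sum_(j < i) t (perm_nat s j) = \sum_(j < n) (if (j < i)%N then t (s j) else 0).
  rewrite (big_ord_widen n (fun j => t (perm_nat s j))); last by rewrite ltnW.
  by rewrite big_mkcond; apply: eq_bigr => j _; rewrite perm_natE.
rewrite !mulr_sumr !ksign_sum.
(* Only inversions that involve [i] feel the change of degree; they come in two kinds, according to
   whether [i] is the smaller or the larger index. *)
have -> : kz s (fun l => t l + (if l == s i :> nat then c else 0)) = kz s t *
   \prod_(j < n) (if (i < j)%N && (s j < s i)%N || (j < i)%N && (s i < s j)%N
                  then ksign (c * t (s j)) else 1).
  have -> : \prod_(j < n) (if (i < j)%N && (s j < s i)%N || (j < i)%N && (s i < s j)%N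
                  then ksign (c * t (s j)) else 1) =
    \prod_(l < n) \prod_(j < n) ((if (l == i) && (i < j)%N && (s j < s i)%N then ksign (c * t (s j)) else 1) *
       (if (j == i) && (l < i)%N && (s i < s l)%N then ksign (c * t (s l)) else 1)).
    under [RHS]eq_bigr => l _ do rewrite big_split.
    rewrite big_split /= [X in X * _](bigD1 i) //= [X in _ * X * _]big1 ?mulr1; last first.
      by move=> l /negPf li; rewrite big1 // => j _; rewrite li.
    rewrite [X in _ * X]exchange_big /= [X in _ * X](bigD1 i) //= [X in _ * (_ * X)]big1 ?mulr1; last first.
      by move=> l /negPf li; rewrite big1 // => j _; rewrite li.
    rewrite -big_split; apply: eq_bigr => j _; rewrite eqxx /=.
    by case: (ltngtP i j) => ij; rewrite ?mul1r ?mulr1 ?orbF.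
  rewrite -big_split; apply: eq_bigr => l _; rewrite -big_split; apply: eq_bigr => j _ /=.
  rewrite !val_eqE !(inj_eq perm_inj) -!val_eqE /=.
  case: ifP => [/andP[lj slj]|/negbT nl]; last first.
    rewrite !ifN ?mulr1 //; apply/negP.
      by move=> /andP[/andP[/eqP/val_inj e h1] h2]; subst; rewrite h1 h2 in nl.
    by move=> /andP[/andP[/eqP/val_inj e h1] h2]; subst; rewrite h1 h2 in nl.
  case: (l =P i :> nat) => [/val_inj ei|nei].
    subst l; have ji : (val j == val i) = false by apply/eqP => e; rewrite e ltnn in lj.
    rewrite ?ji lj slj /=.
    by rewrite addr0 mulr1 -ksignD; congr (Defs.ksign _); ring.
  case: (j =P i :> nat) => [/val_inj ej|nej] /=; last by rewrite !mulr1 !addr0.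
  by subst j; rewrite lj slj /= addr0 mul1r -ksignD mulrDr [t (s l) * c]mulrC.
rewrite -!mulrA; congr (_ * _); rewrite -big_split; apply: eq_bigr => j _ /=.
have ne : j != i -> (s i < s j)%N = ~~ (s j < s i)%N.
  move=> ji; rewrite -leqNgt ltn_neqAle; case: eqP => // /val_inj/perm_inj e.
  by rewrite e eqxx in ji.
case: (ltngtP j i) => [ji|ji|ji] /=; last by rewrite (val_inj ji) ltnn mul1r.
  rewrite ne; last by rewrite -val_eqE /= neq_ltn ji.
  by case: (s j < s i)%N; rewrite /= ?mulr0 ?ksign0 ?mulr1 ?mul1r.
by case: (s j < s i)%N; rewrite /= ?mulr0 ?ksign0 ?mulr1 ?mul1r ?ksign_sqr.
Qed.

Section Graft.
Variables (m n r : nat) (i : 'I_m) (s : 'S_m) (w : 'S_n) (u : 'S_r).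
Hypotheses (er : r.+1 = (m + n)%N) (gu : graft_perm i s w u).

Lemma graft_outer (l : 'I_m) : l != i ->
  perm_nat u (outer_pos i n l) = outer_pos (s i) n (s l).
Proof.
move=> li; have lr : (outer_pos i n l < r)%N.
  move: li (ltn_ord l) (ltn_ord i); rewrite -val_eqE /= /outer_pos.
  by case: (ltnP l i); lia.
by rewrite -(gu.1 l (Ordinal lr) li erefl) -perm_natE.
Qed.

Lemma graft_inner (b : 'I_n) : perm_nat u (i + b) = (s i + w b)%N.
Proof.
have br : (i + b < r)%N by have := ltn_ord b; have := ltn_ord i; lia.
by rewrite -(gu.2 b (Ordinal br) erefl) -perm_natE.
Qed.

Lemma outer_pos_lt (l l' h : nat) : l <> h -> l' <> h ->
  (outer_pos h n l < outer_pos h n l')%N = (l < l')%N.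
Proof. by rewrite /outer_pos; case: (ltnP l h); case: (ltnP l' h); lia. Qed.

Lemma inner_outer_lt (l h b : nat) : l <> h -> (b < n)%N ->
  (h + b < outer_pos h n l)%N = (h < l)%N.
Proof. by rewrite /outer_pos; case: (ltnP l h); lia. Qed.

Lemma outer_inner_lt (l h b : nat) : l <> h -> (b < n)%N ->
  (outer_pos h n l < h + b)%N = (l < h)%N.
Proof. by rewrite /outer_pos; case: (ltnP l h); lia. Qed.

(** Sort the inversions of [u] by the number of positions in the inserted block. Two positions give
    the sign of [w]; none gives inversions of [s] away from [i]; one gives, after summation over the
    block, the inversions of [s] that involve [i], the block counting as a single entry of its total
    degree. *)
Lemma kz_graft (t : nat -> int) :
  kz u t = kz w (fun l => t (s i + l)%N) *
    kz s (fun l => if l == s i then \sum_(b < n) t (s i + b)%N else t (outer_pos (s i) n l)).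
Proof.
pose p := perm_nat u.
pose E j j' := if (j < j')%N && (p j' < p j)%N then ksign (t (p j) * t (p j')) else 1.
have -> : kz u t = \prod_(j < r) \prod_(j' < r) E j j'.
  by apply: eq_bigr => j _; apply: eq_bigr => j' _; rewrite /E /p !perm_natE.
rewrite (big_splice _ (fun j => \prod_(j' < r) E j j') er (ltn_ord i)) /=.
rewrite (bigD1 i) //= eqxx.
rewrite [in RHS]/kz [in RHS](bigD1 i) //= [in RHS]mulrA.
have sne l : l != i -> s l <> s i :> nat.
  by move=> li /val_inj/perm_inj e; rewrite e eqxx in li.
have ine (l : 'I_m) : l != i -> l <> i :> nat.
  by move=> li /val_inj e; rewrite e eqxx in li.
congr (_ * _).
  under eq_bigr => b _ do rewrite (big_splice _ (E (i + b)%N) er (ltn_ord i)) (bigD1 i) //= eqxx.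
  rewrite big_split /=; congr (_ * _).
    apply: eq_bigr => b _; apply: eq_bigr => b' _.
    by rewrite /E /p !graft_inner !ltn_add2l.
  rewrite [RHS](bigD1 i) //= ltnn mul1r exchange_big /=; apply: eq_bigr => l li.
  have [/eqP/negPf sl il] := (sne l li, ine l li).
  have /eqP/negPf il' := il; rewrite il'.
  rewrite eqxx sl mulr_suml.
  under eq_bigr => b _.
    rewrite /E /p graft_inner (graft_outer li).
    rewrite inner_outer_lt //.
    rewrite outer_inner_lt //; last by apply/eqP; rewrite sl.
    over.
  case: ifP => _; last by rewrite big1.
  rewrite ksign_sum [RHS](reindex_inj (@perm_inj _ w)); apply: eq_bigr => b _.
  by rewrite mulrC.
apply: eq_bigr => l li.
have [/eqP/negPf sl il] := (sne l li, ine l li).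
have /eqP/negPf il' := il; rewrite il'.
rewrite (big_splice _ (E (outer_pos i n l)) er (ltn_ord i)).
rewrite (bigD1 i) //= [RHS](bigD1 i) //= eqxx sl eqxx; congr (_ * _).
  under eq_bigr => b _.
    rewrite /E /p graft_inner (graft_outer li).
    rewrite outer_inner_lt //.
    rewrite inner_outer_lt //; last by apply/eqP; rewrite sl.
    over.
  case: ifP => _; last by rewrite big1.
  by rewrite mulr_sumr ksign_sum [RHS](reindex_inj (@perm_inj _ w)); apply: eq_bigr.
apply: eq_bigr => l' li'.
have [sl' il2] := (sne l' li', ine l' li').
have /eqP/negPf il2' := il2; rewrite il2'.
have /eqP/negPf sl2' := sl'; rewrite sl2'.
by rewrite /E /p !graft_outer // !outer_pos_lt //; apply/eqP; rewrite sl.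
Qed.

End Graft.

End PermutationSigns.

(** * The endomorphism operad of a complex *)

Section LinearMaps.
Variables (k : comPzRingType) (U W : lmodType k).

(** The operads and algebras carry linearity as a proposition; bundling it gives access to the
    rewriting lemmas for linear maps. *)
Lemma linear_pack (f : U -> W) : linear f -> exists g : {linear U -> W}, f = g.
Proof. by move=> fl; exists (HB.pack_for {linear U -> W} f (GRing.isLinear.Build k U W _ f fl)). Qed.

Lemma linear_addr (f g : U -> W) : linear f -> linear g -> linear (fun x => f x + g x).
Proof. by move=> fl gl c x y; rewrite fl gl scalerDr addrACA. Qed.
End LinearMaps.

Section RawOperations.
Variables (k : comPzRingType) (X : complex k).
Notation ksign := (@ksign k).
Implicit Types (a b : nat -> helt X) (u : helt X).

(* An operation of arity [n] and degree [p] reads the first [n] entries of a sequence of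
   homogeneous elements; its value lives in the product of all degrees, where it is
   concentrated in degree [p + psum a n]. This keeps casts between degrees out of the
   operad laws. *)
Definition opfun := pi_mod (fun _ : nat -> helt X => total X).

Record is_op n (p : int) (f : opfun) : Prop := IsOp {
  op_ext : forall a b, (forall j, (j < n)%N -> a j = b j) -> f a = f b;
  op_lin : forall a i q, (i < n)%N -> linear (fun x : X q => f (set_at a i (hel x)));
  op_deg : forall a r, r <> p + psum a n -> f a r = 0 }.

Lemma op_set0 n p (f : opfun) a i q : is_op n p f -> (i < n)%N ->
  f (set_at a i (hel (0 : X q))) = 0.
Proof. by move=> fP /(op_lin fP a (q := q)) /linear_pack[g e]; rewrite (congr1 (@^~ 0) e) linear0. Qed.

Definition raw_d n (p : int) (f : opfun) : opfun := fun a =>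
  total_d (f a) -
  \sum_(i < n) ksign (p + psum a i) *: f (set_at a i (hel_d (a i))).

Definition raw_sym n (s : 'S_n) (f : opfun) : opfun := fun a =>
  kz k s (fun j => tag (a j)) *: f (fun j => a (perm_nat s j)).

Definition raw_id : opfun := fun a => single (tagged (a 0%N)).

(** This turns the value of [g] back into a homogeneous element, by reading the only component that
    can be non-zero for an operation of degree [q]. *)
Definition inner_val n (q : int) (g : opfun) (i : nat) a : helt X :=
  hel (g (shift i a) (q + psum (shift i a) n)).

Definition raw_comp n (q : int) (i : nat) (f g : opfun) : opfun := fun a =>
  ksign (q * psum a i) *: f (splice i n (inner_val n q g i a) a).

Lemma linear_subr (U W : lmodType k) (f g : U -> W) :
  linear f -> linear g -> linear (fun x => f x - g x).
Proof. by move=> fl gl c x y; rewrite fl gl scalerBr opprD addrACA. Qed.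

Lemma linear_comp (U W T : lmodType k) (f : U -> W) (g : W -> T) :
  linear f -> linear g -> linear (fun x => g (f x)).
Proof. by move=> fl gl e x y; rewrite fl gl. Qed.

Lemma psum_set_hel a i p (x : X p) n :
  psum (set_at a i (hel x)) n = psum a n + (if (i < n)%N then p - tag (a i) else 0).
Proof. exact: psum_set. Qed.

Lemma raw_d_op n p f : is_op n p f -> is_op n (p + 1) (raw_d n p f).
Proof.
move=> fP; split.
- move=> a b ab; rewrite /raw_d (op_ext fP ab); congr (_ - _); apply: eq_bigr => i _.
  rewrite (@eq_psum _ _ a b i) => [|j ji]; last by rewrite ab //; apply: ltn_trans ji _.
  by congr (_ *: _); apply: (op_ext fP) => j jn; rewrite /set_at !ab.
- move=> a i q ni; rewrite /raw_d; apply: linear_subr.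
    by apply: linear_comp (op_lin fP a ni) _; exact: linearP.
  move=> c x y; rewrite scaler_sumr -big_split; apply: eq_bigr => j _ /=.
  rewrite !psum_set_hel scalerA mulrC -scalerA -scalerDr; congr (_ *: _).
  case: (val j =P i) => [->|ji].
    rewrite !set_at_set /set_at eqxx /hel_d /= linearP; exact: (op_lin fP).
  have sj z : set_at a i (hel z) j = a j by rewrite /set_at; move/eqP/negPf: ji => ->.
  rewrite !sj !(@set_atC _ _ a i j); try exact: nesym; exact: (op_lin fP).
- move=> a r; have [q ->] : exists q, r = q + 1 by exists (r - 1); rewrite subrK.
  move=> ne; rewrite /raw_d piDE piNE total_dE (op_deg fP) ?linear0; last first.
    by move=> e; apply: ne; rewrite e; ring.
  rewrite pi_sumE big1 ?subr0 // => i _; rewrite piZE (op_deg fP) ?scaler0 //.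
  by move=> e; apply: ne; rewrite e psum_set ltn_ord /=; ring.
Qed.

(** The terms with one differential outside and one inside occur twice with opposite signs. Among
    those with two differentials inside, the diagonal ones vanish by [cx_dd], and [(i, j)] cancels
    [(j, i)], because a differential on the earlier argument shifts the sign of the later one. *)
Lemma raw_dd n p f : is_op n p f -> raw_d n (p + 1) (raw_d n p f) = 0.
Proof.
move=> fP; apply: piE => a; rewrite /raw_d linearB /= total_dd sub0r linear_sum /=.
rewrite -opprD -big_split /=.
pose G (i j : 'I_n) := ksign (p + 1 + psum a i) *: (ksign (p + psum (set_at a i (hel_d (a i))) j) *:
  f (set_at (set_at a i (hel_d (a i))) j (hel_d (set_at a i (hel_d (a i)) j)))).
under eq_bigr => i _.
  rewrite linearZ /= scalerBr addrA -scalerDl.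
  rewrite -{1}addrA [1 + _]addrC addrA ksignS subrr scale0r sub0r scaler_sumr.
  rewrite (_ : \sum_(j < n) _ = \sum_(j < n) G i j) //.
  over.
rewrite sumrN opprK big_pairs => [|i].
  rewrite big1 // => i _; rewrite big1 // => j _; case: ifP => // ij; rewrite /G.
  rewrite !psum_set ij ltnNge ltnW //= addr0.
  have -> : set_at a i (hel_d (a i)) j = a j by rewrite /set_at ifN // gtn_eqF.
  have -> : set_at a j (hel_d (a j)) i = a i by rewrite /set_at ifN // ltn_eqF.
  rewrite (@set_atC _ _ a i j); last by move=> e; rewrite e ltnn in ij.
  rewrite !scalerA -scalerDl -!ksignD.
  set x := p + 1 + _ + _; set y := p + 1 + _ + _.
  have -> : y = x - 1 by rewrite /x /y /hel_d /=; ring.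
  by rewrite -{1}[x](subrK 1) ksignS addNr scale0r.
rewrite /G set_at_set /set_at eqxx /hel_d /= cx_dd.
by rewrite (op_set0 _ _ fP) ?scaler0.
Qed.

Lemma perm_natK n (s : 'S_n) j : perm_nat s^-1 (perm_nat s j) = j.
Proof.
rewrite {2}/perm_nat; case: insubP => [i jn <-|nj]; first by rewrite perm_natE permK.
by rewrite /perm_nat insubN.
Qed.

Lemma perm_natVK n (s : 'S_n) j : perm_nat s (perm_nat s^-1 j) = j.
Proof. by have := perm_natK s^-1 j; rewrite invgK. Qed.

Lemma perm_nat_lt n (s : 'S_n) j : (j < n)%N -> (perm_nat s j < n)%N.
Proof. by move=> jn; rewrite (perm_natE s (Ordinal jn)). Qed.

Lemma psum_perm n (s : 'S_n) a : psum (fun j => a (perm_nat s j)) n = psum a n.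
Proof.
rewrite /psum [RHS](reindex_inj (@perm_inj _ s)); apply: eq_bigr => j _.
by rewrite perm_natE.
Qed.

Lemma set_at_perm n (s : 'S_n) a i u :
  (fun j => set_at a i u (perm_nat s j)) =
  set_at (fun j => a (perm_nat s j)) (perm_nat s^-1 i) u.
Proof.
apply: funext => j; rewrite /set_at; congr (if _ then _ else _).
by apply/eqP/eqP => [<-|->]; rewrite ?perm_natK ?perm_natVK.
Qed.

Lemma raw_sym_op n p (s : 'S_n) f : is_op n p f -> is_op n p (raw_sym s f).
Proof.
move=> fP; split.
- move=> a b ab; rewrite /raw_sym; congr (_ *: _).
    by apply: eq_kz => i; rewrite ab.
  by apply: (op_ext fP) => j jn; rewrite ab // perm_nat_lt.
- move=> a i q ni; rewrite /raw_sym => c x y.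
  have ek (z : X q) : kz k s (fun j => tag (set_at a i (hel z) j)) =
              kz k s (fun j => if j == i then q else tag (a j)).
    by apply: eq_kz => j; rewrite /set_at; case: (_ == _).
  rewrite !ek !set_at_perm (op_lin fP) ?perm_nat_lt //.
  by rewrite scalerDr !scalerA mulrC.
- by move=> a r ne; rewrite /raw_sym piZE (op_deg fP) ?scaler0 // psum_perm.
Qed.

Lemma raw_sym_d n p (s : 'S_n) f : is_op n p f ->
  raw_sym s (raw_d n p f) = raw_d n p (raw_sym s f).
Proof.
move=> fP; apply: piE => a; rewrite /raw_d /raw_sym [total_d (_ *: _)]linearZ /= scalerBr; congr (_ - _).
rewrite scaler_sumr [RHS](reindex_inj (@perm_inj _ s)); apply: eq_bigr => i _ /=.
have si : perm_nat s^-1 (s i) = i by rewrite -[X in perm_nat _ X]perm_natE perm_natK.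
rewrite !scalerA set_at_perm si perm_natE; congr (_ *: _).
rewrite (@eq_kz k _ s (fun j => tag (set_at a (s i) (hel_d (a (s i))) j))
   (fun l => tag (a l) + (if l == s i :> nat then 1 else 0))); last first.
  by move=> j; rewrite /set_at; case: eqP => [->|_] //=; rewrite addr0.
rewrite !ksignD mulrCA -[RHS]mulrA; congr (_ * _).
have := kz_add k s i 1 (fun j => tag (a j)).
by rewrite !mul1r mulrC => <-.
Qed.

Lemma raw_symM n (s w : 'S_n) p f : is_op n p f ->
  raw_sym (s * w)%g f = raw_sym w (raw_sym s f).
Proof.
move=> fP; apply: piE => a; rewrite /raw_sym scalerA kzM; congr (_ *: _).
apply: (op_ext fP) => j jn.
have e (z : 'S_n) : perm_nat z j = z (Ordinal jn) by exact: perm_nat_val.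
by rewrite !e permM perm_natE.
Qed.

Lemma raw_sym1 n p f : is_op n p f -> raw_sym (1%g : 'S_n) f = f.
Proof.
move=> fP; apply: piE => a; rewrite /raw_sym kz1 scale1r.
by apply: (op_ext fP) => j jn; rewrite (perm_nat_val _ (i := Ordinal jn)) // perm1.
Qed.

Lemma raw_id_op : is_op 1 0 raw_id.
Proof.
split.
- by move=> a b ab; rewrite /raw_id ab.
- move=> a i q; rewrite ltnS leqn0 => /eqP -> c x y.
  by rewrite /raw_id /set_at eqxx /hel /= linearP.
- move=> a r ne; rewrite /raw_id single0 // => e; apply: ne.
  by rewrite add0r psumS /psum big_ord0 add0r.
Qed.

Lemma raw_id_d : raw_d 1 0 raw_id = 0.
Proof.
apply: piE => a; rewrite /raw_d big_ord1 /psum big_ord0 addr0 scale1r.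
by rewrite /raw_id total_d_single /set_at eqxx /hel_d /= subrr.
Qed.

Lemma eq_inner_val n p q (g : opfun) i a b : is_op n p g ->
  (forall j, (j < n)%N -> a (i + j)%N = b (i + j)%N) ->
  inner_val n q g i a = inner_val n q g i b.
Proof.
move=> gP ab; rewrite /inner_val (op_ext gP (b := shift i b)) //.
by apply: hel_total; congr (_ + _); apply: eq_psum => j jn; rewrite /shift ab.
Qed.

Lemma op_splice_lin m n p (f : opfun) i q a : is_op m p f -> (i < m)%N ->
  linear (fun x : X q => f (splice i n (hel x) a)).
Proof.
move=> fP im c x y; have := op_lin fP (splice i n (hel x) a) (q := q) im c x y.
by rewrite !splice_set.
Qed.

Lemma input_cases m n r i j : r.+1 = (m + n)%N -> (i < m)%N -> (j < r)%N ->
  (exists2 b, (b < n)%N & j = (i + b)%N) \/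
  (exists l, [/\ (l < m)%N, l <> i & j = outer_pos i n l]).
Proof.
move=> er im jr; case: (ltnP j i) => ji.
  by right; exists j; rewrite /outer_pos ji; split=> //; lia.
case: (ltnP j (i + n)) => jn; first by left; exists (j - i)%N; lia.
right; exists (j.+1 - n)%N; rewrite /outer_pos ifN; last by lia.
by split; lia.
Qed.

Lemma raw_comp_op m n r p q i f g : r.+1 = (m + n)%N -> (i < m)%N ->
  is_op m p f -> is_op n q g -> is_op r (p + q) (raw_comp n q i f g).
Proof.
move=> er im fP gP; split.
- move=> a b ab; rewrite /raw_comp; congr (ksign (q * _) *: _).
    by apply: eq_psum => j ji; rewrite ab //; lia.
  rewrite (eq_inner_val _ gP (b := b)) => [|j jn]; last by rewrite ab //; lia.
  apply: (op_ext fP) => l lm; rewrite /splice; case: eqP => // li.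
  by rewrite ab // /outer_pos; case: (ltnP l i); lia.
- move=> a j q' jr; case: (input_cases er im jr) => [[b bn ->]|[l [lm li ->]]].
    rewrite /raw_comp => c x y; rewrite !splice_set_inner //.
    rewrite !psum_set_hel !ifN; [|lia..].
    rewrite /inner_val !shift_set_inner !psum_set_hel bn.
    rewrite (op_lin gP) // piDE piZE (op_splice_lin _ _ fP) //.
    by rewrite scalerDr !scalerA mulrC.
  rewrite /raw_comp => c x y; rewrite !splice_set_outer // !psum_set_hel.
  have ei z : inner_val n q g i (set_at a (outer_pos i n l) (hel (z : X q'))) = inner_val n q g i a.
    by apply: (eq_inner_val _ gP) => h hn; exact: (shift_set_outer _ _ li hn).
  by rewrite !ei (op_lin fP) // scalerDr !scalerA mulrC.
- move=> a s ne; rewrite /raw_comp piZE (op_deg fP) ?scaler0 // (psum_splice (q := q) er im) //.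
  by rewrite addrA.
Qed.

Lemma raw_comp_d m n r p q i f g : r.+1 = (m + n)%N -> (i < m)%N ->
  is_op m p f -> is_op n q g ->
  raw_d r (p + q) (raw_comp n q i f g) =
  raw_comp n q i (raw_d m p f) g + ksign p *: raw_comp n (q + 1) i f (raw_d n q g).
Proof.
move=> er im fP gP; apply: piE => a; rewrite piDE piZE.
set N := psum a i; set sh := shift i a; set P := psum sh n; set y := g sh.
pose S u := splice i n u a.
have slin (t : int) : linear (fun x : X t => f (S (hel x))) by exact: op_splice_lin fP im.
have -> : raw_comp n (q + 1) i f (raw_d n q g) a = ksign ((q + 1) * N) *:
   (f (S (hel (cx_d _ (y (q + P))))) -
    \sum_(b < n) ksign (q + psum sh b) *: f (S (hel (g (set_at sh b (hel_d (sh b))) (q + P + 1))))).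
  rewrite /raw_comp -/N; congr (_ *: _).
  rewrite /inner_val -/sh -/P (hel_total _ (q := q + P + 1)); last by ring.
  rewrite /raw_d piDE piNE total_dE pi_sumE -/y.
  have [h hE] := linear_pack (slin (q + P + 1)).
  have hE' x : f (splice i n (hel x) a) = h x := congr1 (@^~ x) hE.
  rewrite hE' linearB linear_sum /= /S hE'; congr (_ - _); apply: eq_bigr => b _.
  by rewrite piZE linearZ hE'.
have -> : raw_comp n q i (raw_d m p f) g a = ksign (q * N) *: (total_d (f (S (hel (y (q + P))))) -
   \sum_(l < m) ksign (p + psum (S (hel (y (q + P)))) l) *:
       f (set_at (S (hel (y (q + P)))) l (hel_d (S (hel (y (q + P))) l)))) by [].
set Y := hel (y (q + P)).
rewrite {1}/raw_d {1}/raw_comp -/N linearZ scalerBr /= -!addrA; congr (_ + _).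
(* The inputs of the composite split into those of [g], collected at position [i], and the remaining
   inputs of [f]; the former match [raw_d n q g], the latter [raw_d m p f]. *)
rewrite (big_splice _ (fun j => ksign (p + q + psum a j) *:
   raw_comp n q i f g (set_at a j (hel_d (a j)))) er im).
have Sgt l : (i < l)%N -> psum (S Y) l = q + psum a (l + n).-1.
  by move=> il; rewrite (psum_splice_gt (q := q) il).
have Sle l : (l <= i)%N -> psum (S Y) l = psum a l by move=> li; rewrite psum_splice_le.
have tY : tag Y = q + P by [].
rewrite (bigD1 (Ordinal im)) //= eqxx [in RHS](bigD1 (Ordinal im)) //=.
rewrite scalerDr !opprD -addrA [LHS]addrC [RHS]addrCA; congr (_ + _).
  congr (- _); rewrite scaler_sumr; apply: eq_bigr => l; rewrite -val_eqE /= => li.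
  have /eqP li' := li; rewrite (negPf li) scalerA.
  have Sl : S Y l = a (outer_pos i n l) by rewrite /S /splice (negPf li).
  rewrite Sl /raw_comp scalerA splice_set_outer //.
  have -> : inner_val n q g i (set_at a (outer_pos i n l) (hel_d (a (outer_pos i n l)))) = Y.
    by apply: (eq_inner_val _ gP) => h hn; exact: (shift_set_outer _ _ li' hn).
  congr (_ *: _); rewrite psum_set /hel_d /= -!ksignD /outer_pos.
  case: (ltngtP l i) li' => // il _.
    by rewrite il Sle 1?ltnW // -/N; apply: (@ksign_eq _ _ _ q); ring.
  by rewrite Sgt // ifN -?/N; [congr (Defs.ksign _); ring | lia].
rewrite scalerA -ksignD Sle // -/N; have -> : S Y i = Y by rewrite /S /splice eqxx.
rewrite /S splice_set -/(S _) {2}/Y /hel_d /= scalerA -!ksignD.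
(* The term in which the differential hits the value of [g] occurs once in each summand of the
   right-hand side, with opposite signs, and has no counterpart on the left. *)
have -> : ksign (p + (q + 1) * N) = ksign (q * N + (p + N)).
  by congr (Defs.ksign _); ring.
rewrite scalerBr addrA addNr add0r; congr (- _).
rewrite scaler_sumr; apply: eq_bigr => b _.
rewrite /raw_comp !scalerA -!ksignD splice_set_inner // psum_set ifN; last by lia.
rewrite addr0 -/N /inner_val shift_set_inner psum_set ltn_ord /=.
rewrite (hel_total _ (q := q + P + 1)); last by rewrite /P /sh /shift /=; ring.
by congr (_ *: _); rewrite psum_shift -/N -/sh; congr (Defs.ksign _); ring.
Qed.

End RawOperations.

(** * Unit, associativity and equivariance laws for multilinear operations *)

Section RawOperadAxioms.
Variables (k : comPzRingType) (X : complex k).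
Notation ksign := (@ksign k).
Implicit Types (a : nat -> helt X) (f g h : opfun X).

Lemma raw_comp1x n q f : is_op n q f -> raw_comp n q 0 (@raw_id k X) f = f.
Proof.
move=> fP; apply: piE => a; rewrite /raw_comp /psum big_ord0 mulr0 ksign0 scale1r.
rewrite /raw_id /splice eqxx /inner_val /=.
have -> : shift 0 a = a by apply: funext => j; rewrite /shift add0n.
by rewrite -single_tot // => r; exact: op_deg.
Qed.

Lemma raw_compx1 m p i f : is_op m p f -> raw_comp 1 0 i f (@raw_id k X) = f.
Proof.
move=> fP; apply: piE => a; rewrite /raw_comp mul0r ksign0 scale1r.
congr (f _); apply: funext => l; rewrite /splice; case: eqP => [->|li].
  rewrite /inner_val /raw_id (hel_total _ (q := tag (a i))).
    by rewrite /shift addn0 single_id hel_eta.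
  by rewrite psumS /psum big_ord0 !add0r /shift addn0.
by congr (a _); rewrite /outer_pos; case: (ltnP l i); lia.
Qed.

Lemma shift_shift i j a : shift j (shift i a) = shift (i + j) a.
Proof. by apply: funext => l; rewrite /shift addnA. Qed.

Lemma shift_splice i j n (u : helt X) a : shift i (splice (i + j) n u a) = splice j n u (shift i a).
Proof.
apply: funext => l; rewrite /shift /splice eqn_add2l; case: eqP => // lj.
by congr (a _); rewrite /outer_pos; case: (ltnP l j); case: (ltnP (i + l) (i + j)); lia.
Qed.

Lemma raw_comp_seq l m n b p q s i j (x y z : opfun X) :
  b.+1 = (m + n)%N -> (i < l)%N -> (j < m)%N ->
  is_op l p x -> is_op m q y -> is_op n s z ->
  raw_comp n s (i + j) (raw_comp m q i x y) z =
  raw_comp b (q + s) i x (raw_comp n s j y z).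
Proof.
move=> eb il jm xP yP zP; apply: piE => a; rewrite /raw_comp.
set Z := inner_val n s z (i + j) a; set B := splice (i + j) n Z a.
have eZ : inner_val n s z j (shift i a) = Z by rewrite /Z /inner_val shift_shift.
have eB : splice j n Z (shift i a) = shift i B by rewrite shift_splice.
rewrite {2}/inner_val eZ eB.
have tZ : tag Z = s + psum (shift j (shift i a)) n by rewrite -eZ.
rewrite (hel_total _ (q := q + psum (shift i B) m)); last first.
  by rewrite -eB (psum_splice (q := s) eb jm) //; ring.
have [g gE] := linear_pack (op_splice_lin b (q := q + psum (shift i B) m) a xP il).
have gE' t : x (splice i b (hel t) a) = g t := congr1 (@^~ t) gE.
rewrite piZE gE' [g _]linearZ /= -gE' !scalerA -!ksignD; congr (_ *: _).
  rewrite {1}/B psum_splice_le ?leq_addr // psum_shift.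
  by congr (Defs.ksign _); ring.
congr (x _); apply: funext => t; rewrite /splice; case: eqP => // ti.
rewrite {1}/B /splice; case: eqP => [e|ne].
  by move: e; rewrite /outer_pos; case: (ltnP t i); lia.
congr (a _); rewrite /outer_pos; case: (ltnP t i) => h.
  by rewrite ifT //; lia.
by rewrite ifN; lia.
Qed.

Lemma raw_comp_par l m n p q s i j j' (x y z : opfun X) :
  (i < j)%N -> (j < l)%N -> j'.+1 = (j + m)%N ->
  is_op l p x -> is_op m q y -> is_op n s z ->
  raw_comp n s j' (raw_comp m q i x y) z =
  ksign (q * s) *: raw_comp m q i (raw_comp n s j x z) y.
Proof.
move=> ij jl ej xP yP zP; apply: piE => a; rewrite piZE /raw_comp.
set Z := inner_val n s z j' a; set B := splice j' n Z a.
set Y := inner_val m q y i a; set C := splice i m Y a.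
have -> : inner_val m q y i B = Y.
  apply: (eq_inner_val _ yP) => b bm; rewrite /B /splice ifN; last by lia.
  by rewrite /outer_pos ifT //; lia.
have eC : shift j C = shift j' a.
  apply: funext => b; rewrite /shift /C /splice ifN; last by lia.
  by rewrite /outer_pos ifN; [congr (a _)|]; lia.
have -> : inner_val n s z j C = Z by rewrite /inner_val eC.
have -> : psum B i = psum a i by rewrite psum_splice_le //; lia.
(* The value of [y] stands before input [j], and its degree exceeds that of its arguments by [q];
   this excess is the origin of the sign [ksign (q * s)]. *)
have -> : psum C j = q + psum a j'.
  by rewrite (psum_splice_gt (q := q) ij) //; congr (_ + psum a _); lia.
rewrite !scalerA -!ksignD; congr (_ *: _).
  by apply: (@ksign_eq _ _ _ (- (q * s))); ring.
congr (x _); apply: funext => t; rewrite /splice.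
case: (t =P i) => [->|ti].
  by rewrite ifN; [rewrite /C /splice /outer_pos ij eqxx | lia].
case: (t =P j) => [->|tj].
  by rewrite /B /splice ifT // /outer_pos ifN; lia.
rewrite /B /C /splice ifN; last by rewrite /outer_pos; case: (ltnP t i); lia.
rewrite ifN; last by rewrite /outer_pos; case: (ltnP t j); lia.
congr (a _); rewrite /outer_pos; case: (ltnP t i) => h1; case: (ltnP t j) => h2.
- by rewrite !ifT //; lia.
- by lia.
- by rewrite ifT ?ifN //; lia.
- by rewrite !ifN //; lia.
Qed.

(** By [kz_graft] the sign of [u] is that of [w] times that of [s] with the block replaced by its
    total degree. The value of [g] has this degree plus [q], and [kz_add] trades the excess [q] for
    the change of the insertion sign in [raw_comp]. *)
Lemma raw_comp_sym m n r p q (i : 'I_m) (s : 'S_m) (w : 'S_n) (u : 'S_r) f g :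
  r.+1 = (m + n)%N -> graft_perm i s w u -> is_op m p f -> is_op n q g ->
  raw_comp n q (s i) (raw_sym s f) (raw_sym w g) = raw_sym u (raw_comp n q i f g).
Proof.
move=> er gu fP gP; apply: piE => a; rewrite /raw_comp {1}/raw_sym {2}/raw_sym.
pose au j := a (perm_nat u j).
pose y := inner_val n q g i au.
have esh : forall b, (b < n)%N -> shift (s i) a (perm_nat w b) = shift i au b.
  move=> b bn; rewrite /shift /au (graft_inner er gu (Ordinal bn)).
  by rewrite (perm_natE w (Ordinal bn)).
have ps : psum (shift i au) n = psum (shift (s i) a) n.
  by rewrite -[RHS](psum_perm w); apply: eq_psum => b bn; rewrite esh.
have -> : inner_val n q (raw_sym w g) (s i) a =
    hel (kz k w (fun j => tag (shift (s i) a j)) *: tagged y).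
  rewrite /inner_val /raw_sym piZE (op_ext gP esh).
  pose v := g (shift i au); pose c := kz k w (fun j => tag (shift (s i) a j)).
  by rewrite -/v -/c -(piZE c v) (hel_total (c *: v) (q := q + psum (shift i au) n)) // ps.
set K := kz k w _.
have -> : f (fun j => splice (s i) n (hel (K *: tagged y)) a (perm_nat s j)) =
          K *: f (splice i n y au).
  have [G GE] := linear_pack (op_splice_lin n (q := tag y) au fP (ltn_ord i)).
  have GE' t : f (splice i n (hel t) au) = G t := congr1 (@^~ t) GE.
  have -> : f (splice i n y au) = G (tagged y) by rewrite -GE' hel_eta.
  rewrite -[K *: G _]linearZ -GE'; apply: (op_ext fP) => j jm.
  rewrite (perm_natE s (Ordinal jm)) /splice.
  case: (j =P i :> nat) => [ji|ji].
    by rewrite (_ : Ordinal jm = i) ?eqxx //; exact: val_inj.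
  have oji : Ordinal jm != i by rewrite -val_eqE; exact/eqP.
  rewrite ifN; last by rewrite val_eqE (inj_eq perm_inj).
  by rewrite /au (graft_outer er gu oji).
rewrite /raw_sym -/au -/y !scalerA; congr (_ *: _).
pose b := splice (s i) n (hel (K *: tagged y)) a.
pose T l := if l == s i :> nat then \sum_(b < n) tag (a (s i + b)%N)
            else tag (a (outer_pos (s i) n l)).
have -> : kz k s (fun j => tag (b j)) = kz k s (fun l => T l + (if l == s i :> nat then q else 0)).
  apply: eq_kz => j; rewrite /b /T /splice; case: eqP => _; last by rewrite addr0.
  by rewrite /= ps /psum addrC.
have e1 : psum a (s i) = \sum_(l < s i) T l.
  apply: eq_bigr => l _; rewrite /T ifN ?ltn_eqF //.
  by rewrite /outer_pos ltn_ord.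
have e2 : psum au i = \sum_(j < i) T (perm_nat s j).
  apply: eq_bigr => j _.
  have jm : (j < m)%N by apply: ltn_trans (ltn_ord j) _.
  have oji : Ordinal jm != i by rewrite -val_eqE /= ltn_eqF.
  rewrite (perm_natE s (Ordinal jm)) /T ifN; last by rewrite val_eqE (inj_eq perm_inj).
  by rewrite -(graft_outer er gu oji) /= /outer_pos ltn_ord.
rewrite -[ksign _ * _ * _]mulrA mulrCA -/K e1.
rewrite (kz_graft k er gu) -/T -/K e2 -mulrA.
by rewrite mulrA kz_add mulrC.
Qed.

End RawOperadAxioms.

(** * Suboperads of operations compatible with an operad *)

Section RawLinearity.
Variables (k : comPzRingType) (X : complex k).
Implicit Types (f g : opfun X).

Lemma is_op0 n p : is_op n p (0 : opfun X).
Proof. by split=> // a i q _ c x y; rewrite !pi0E scaler0 addr0. Qed.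

Lemma is_op_lin n p (c : k) f g : is_op n p f -> is_op n p g -> is_op n p (c *: f + g).
Proof.
move=> fP gP; split.
- by move=> a b ab; rewrite !(piDE, piZE) (op_ext fP ab) (op_ext gP ab).
- move=> a i q ni e x y; rewrite !(piDE, piZE) (op_lin fP) // (op_lin gP) //.
  by rewrite !scalerDr !scalerA mulrC addrACA.
- by move=> a r ne; rewrite !(piDE, piZE) (op_deg fP) // (op_deg gP) // scaler0 addr0.
Qed.

Lemma raw_d_lin n p : linear (raw_d n p : opfun X -> opfun X).
Proof.
move=> c f g; apply: piE => a; rewrite /raw_d !(piDE, piZE) linearP /=.
rewrite scalerBr [RHS]addrACA; congr (_ + _); rewrite -opprD scaler_sumr -big_split.
congr (- _); apply: eq_bigr => i _ /=; rewrite !(piDE, piZE).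
by rewrite scalerDr !scalerA mulrC.
Qed.

Lemma raw_sym_lin n (s : 'S_n) : linear (raw_sym s : opfun X -> opfun X).
Proof.
move=> c f g; apply: piE => a; rewrite /raw_sym !(piDE, piZE).
by rewrite scalerDr !scalerA mulrC.
Qed.

Lemma raw_comp_linl n q i g : linear (fun f => raw_comp n q i f g).
Proof.
move=> c f f'; apply: piE => a; rewrite /raw_comp !(piDE, piZE).
by rewrite scalerDr !scalerA mulrC.
Qed.

Lemma raw_comp_linr m p n q i f : is_op m p f -> (i < m)%N ->
  linear (fun g => raw_comp n q i f g).
Proof.
move=> fP im c g g'; apply: piE => a; rewrite /raw_comp !(piDE, piZE).
rewrite /inner_val !(piDE, piZE) (op_splice_lin _ _ fP im).
by rewrite scalerDr !scalerA mulrC.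
Qed.

End RawLinearity.

Section PairOperad.
Variables (k : comPzRingType) (O : operad k) (X : complex k).

(* The data needed for the pairs [(x, f)] with [compat x f] to form a suboperad of the
   product of [O] and the endomorphism operad of [X]. *)
Record op_relation := OpRelation {
  compat : forall n p, O n p -> opfun X -> Prop;
  compat0 : forall n p, @compat n p 0 0;
  compat_lin : forall n p (c : k) (x y : O n p) f g,
    is_op n p f -> is_op n p g -> compat x f -> compat y g -> compat (c *: x + y) (c *: f + g);
  compat_d : forall n p (x : O n p) f, is_op n p f -> compat x f -> compat (cx_d p x) (raw_d n p f);
  compat_sym : forall n p (s : 'S_n) (x : O n p) f, is_op n p f -> compat x f ->
    compat (op_sym s x) (raw_sym s f);
  compat_id : compat op_id (@raw_id k X);
  compat_comp : forall m n r (p q t : int) (er : r.+1 = (m + n)%N) (et : p + q = t)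
    (i : 'I_m) (x : O m p) (y : O n q) f g, is_op m p f -> is_op n q g ->
    compat x f -> compat y g -> compat (op_comp er et i x y) (raw_comp n q i f g) }.

Variable R : op_relation.

Fact pair_closed n p :
  let P := fun z : O n p * opfun X => is_op n p z.2 /\ compat R z.1 z.2 in
  P 0 /\ forall (c : k) x y, P x -> P y -> P (c *: x + y).
Proof.
split; first by split; [exact: is_op0 | exact: compat0].
move=> c [x f] [y g] [/= fP xf] [/= gP yg]; split=> /=; first exact: is_op_lin.
exact: compat_lin.
Qed.

Definition pair_mod n p : lmodType k := smod (Submod (pair_closed n p)).

Definition mk_pair n p (x : O n p) f (fP : is_op n p f) (xf : compat R x f) : pair_mod n p :=
  to_smod (S := Submod (pair_closed n p)) (x := (x, f)) (conj fP xf).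

Definition pair_op n p (z : pair_mod n p) : O n p := (smod_val z).1.
Definition pair_fun n p (z : pair_mod n p) : opfun X := (smod_val z).2.

Lemma pair_is_op n p (z : pair_mod n p) : is_op n p (pair_fun z).
Proof. exact: (smodP z).1. Qed.

Lemma pair_rel n p (z : pair_mod n p) : compat R (pair_op z) (pair_fun z).
Proof. exact: (smodP z).2. Qed.

Lemma pair_op_mk n p (x : O n p) f fP xf : pair_op (@mk_pair n p x f fP xf) = x.
Proof. by []. Qed.

Lemma pair_fun_mk n p (x : O n p) f fP xf : pair_fun (@mk_pair n p x f fP xf) = f.
Proof. by []. Qed.

Lemma pair_eq n p (y z : pair_mod n p) :
  pair_op y = pair_op z -> pair_fun y = pair_fun z -> y = z.
Proof.
move=> e1 e2; apply: smod_inj; move: e1 e2; rewrite /pair_op /pair_fun.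
by case: (smod_val y) (smod_val z) => ? ? [? ?] /= -> ->.
Qed.

Lemma pair_op_lin n p : linear (@pair_op n p).
Proof. by move=> c x y; rewrite /pair_op smod_lin. Qed.

Lemma pair_fun_lin n p : linear (@pair_fun n p).
Proof. by move=> c x y; rewrite /pair_fun smod_lin. Qed.

Lemma pair_opDZ n p c (x y : pair_mod n p) :
  pair_op (x + c *: y) = pair_op x + c *: pair_op y.
Proof. by rewrite addrC pair_op_lin addrC. Qed.

Lemma pair_funDZ n p c (x y : pair_mod n p) :
  pair_fun (x + c *: y) = pair_fun x + c *: pair_fun y.
Proof. by rewrite addrC pair_fun_lin addrC. Qed.

Lemma pair_opZ n p c (x : pair_mod n p) : pair_op (c *: x) = c *: pair_op x.
Proof. by have [g ->] := linear_pack (@pair_op_lin n p); rewrite linearZ. Qed.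

Lemma pair_funZ n p c (x : pair_mod n p) : pair_fun (c *: x) = c *: pair_fun x.
Proof. by have [g ->] := linear_pack (@pair_fun_lin n p); rewrite linearZ. Qed.

Definition pair_d n p (z : pair_mod n p) : pair_mod n (p + 1) :=
  mk_pair (raw_d_op (pair_is_op z)) (compat_d (pair_is_op z) (pair_rel z)).

Fact pair_d_lin n p : linear (@pair_d n p).
Proof.
move=> c x y; apply: pair_eq; rewrite /pair_d ?pair_op_lin ?pair_fun_lin.
  by rewrite !pair_op_mk pair_op_lin linearP.
by rewrite !pair_fun_mk pair_fun_lin raw_d_lin.
Qed.
HB.instance Definition _ n p :=
  GRing.isLinear.Build k (pair_mod n p) (pair_mod n (p + 1)) _ (@pair_d n p) (@pair_d_lin n p).

Fact pair_dd n p (z : pair_mod n p) : pair_d (pair_d z) = 0.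
Proof.
apply: pair_eq; rewrite /pair_op /pair_fun /=; first exact: cx_dd.
exact: raw_dd (pair_is_op z).
Qed.

Definition pair_complex n : complex k :=
  @Complex k (pair_mod n) (fun p => @pair_d n p) (@pair_dd n).

Definition pair_sym n p (s : 'S_n) (z : pair_complex n p) : pair_complex n p :=
  mk_pair (raw_sym_op s (pair_is_op z)) (compat_sym s (pair_is_op z) (pair_rel z)).

Definition pair_id : pair_complex 1 0 := mk_pair (raw_id_op X) (compat_id R).

Fact pair_comp_op m n r (p q t : int) (er : r.+1 = (m + n)%N) (et : p + q = t)
  (i : 'I_m) (y : pair_mod m p) (z : pair_mod n q) :
  is_op r t (raw_comp n q i (pair_fun y) (pair_fun z)).
Proof. by case: t / et; apply: (raw_comp_op er) => //; apply: pair_is_op. Qed.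

Definition pair_comp m n r (p q t : int) (er : r.+1 = (m + n)%N) (et : p + q = t)
  (i : 'I_m) (y : pair_complex m p) (z : pair_complex n q) : pair_complex r t :=
  mk_pair (pair_comp_op er et i y z)
    (compat_comp er et i (pair_is_op y) (pair_is_op z) (pair_rel y) (pair_rel z)).

Definition pair_operad : operad k.
Proof.
apply: (@Operad k pair_complex pair_sym pair_id pair_comp).
- move=> n p s c x y; apply: pair_eq; rewrite /pair_sym ?pair_op_lin ?pair_fun_lin.
    by rewrite !pair_op_mk pair_op_lin op_sym_lin.
  by rewrite !pair_fun_mk pair_fun_lin raw_sym_lin.
- move=> n p s x; apply: pair_eq; first exact: op_sym_d.
  exact: raw_sym_d (pair_is_op x).
- move=> n p x; apply: pair_eq; first exact: op_sym1.
  exact: raw_sym1 (pair_is_op x).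
- move=> n p s w x; apply: pair_eq; first exact: op_symM.
  exact: raw_symM (pair_is_op x).
- apply: pair_eq; first exact: op_id_d.
  exact: raw_id_d.
- move=> m n r p q t er et i z c x y; apply: pair_eq; rewrite /pair_comp ?pair_op_lin ?pair_fun_lin.
    by rewrite !pair_op_mk pair_op_lin; exact: (op_comp_linl er et i _ c).
  by rewrite !pair_fun_mk pair_fun_lin; exact: (raw_comp_linl _ _ _ _ c).
- move=> m n r p q t er et i z c x y; apply: pair_eq; rewrite /pair_comp ?pair_op_lin ?pair_fun_lin.
    by rewrite !pair_op_mk pair_op_lin; exact: (op_comp_linr er et i _ c).
  by rewrite !pair_fun_mk pair_fun_lin; exact: (raw_comp_linr _ _ (pair_is_op z) _ c).
- move=> m n r p q t er et el e2 i x y.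
  apply: pair_eq.
    by rewrite [RHS]pair_opDZ; exact: op_comp_d.
  rewrite [RHS]pair_funDZ.
  case: t / et el e2 => el e2.
  exact: raw_comp_d (pair_is_op x) (pair_is_op y).
- move=> n q er et x; apply: pair_eq; first exact: op_comp1x.
  exact: raw_comp1x (pair_is_op x).
- move=> m p er et i x; apply: pair_eq; first exact: op_compx1.
  exact: raw_compx1 (pair_is_op x).
- move=> l m n a b r p q s t u v ea er eb er' et ev eu ev' i j ij x y z eij.
  apply: pair_eq; first exact: (op_comp_seq ea er eb er' et ev eu ev' _ _ _ eij).
  case: u / eu ev' => ev'; rewrite /pair_fun /= eij.
  by apply: (raw_comp_seq eb) (pair_is_op x) (pair_is_op y) (pair_is_op z).
- move=> l m n a b r p q s t u v ea er eb er' et ev eu ev' i j i' j' x y z ij ei ej.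
  apply: pair_eq; rewrite ?pair_opZ ?pair_funZ.
    exact: (op_comp_par ea er eb er' et ev eu ev' _ _ _ ij ei ej).
  rewrite /pair_fun /= ei.
  exact: raw_comp_par ej (pair_is_op x) (pair_is_op y) (pair_is_op z).
- move=> m n r p q t er et i s w u x y gu.
  apply: pair_eq; first exact: op_comp_sym gu.
  exact: raw_comp_sym gu (pair_is_op x) (pair_is_op y).
Defined.

End PairOperad.

Section ActLemmas.
Variables (k : comPzRingType) (O : operad k) (B : algebra O).

Lemma act_ext n p r (x : O n p) (a b : 'I_n -> helt B) e e' :
  (forall i, a i = b i) -> act (r := r) x (a := a) e = act x (a := b) e'.
Proof. by move/funext => ab; case: b / ab e' => e'; rewrite (Prop_irrelevance e e'). Qed.

Lemma act0x n p r (a : 'I_n -> helt B) (e : p + \sum_(i < n) tag (a i) = r) :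
  act (0 : O n p) e = 0.
Proof. by have [g /(congr1 (@^~ 0)) ->] := linear_pack (act_linl e); rewrite linear0. Qed.

Lemma act_lin n p q r (x : O n p) (a : nat -> helt B) (i : 'I_n)
  (e : p + \sum_(j < n) (if j == i :> nat then q else tag (a j)) = r)
  (E : forall u : B q, p + \sum_(j < n) tag (set_at a i (hel u) j) = r) :
  linear (fun u : B q => act x (a := fun j : 'I_n => set_at a i (hel u) j) (E u)).
Proof.
have su (u : B q) (j : 'I_n) : upd (fun j : 'I_n => a j) i (hel u) j = set_at a i (hel u) j by [].
have eu (u : B q) : p + \sum_(j < n) tag (upd (fun j : 'I_n => a j) i (hel u) j) = r.
  by rewrite -(E u).
move=> c u v.
have := act_linr x (eu (c *: u + v)) (eu u) (eu v).
by do ![rewrite (act_ext x _ (E _) (su _))].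
Qed.
End ActLemmas.

(** * Operations compatible with an algebra along a linear relation *)

Section Compatibility.
Variables (k : comPzRingType) (O : operad k) (X : complex k) (B : algebra O).
Variable G : forall p, X p -> B p -> Prop.
Hypothesis G0 : forall p, @G p 0 0.
Hypothesis G_lin : forall p (c : k) x y u v, @G p x u -> G y v -> G (c *: x + y) (c *: u + v).
Hypothesis G_d : forall p x u, @G p x u -> G (cx_d p x) (cx_d p u).

Definition hrel (x : helt X) (u : helt B) : Prop :=
  exists (e : tag x = tag u), G (cx_cast e (tagged x)) (tagged u).

Lemma hrel_hel p (x : X p) (u : B p) : G x u -> hrel (hel x) (hel u).
Proof. by exists erefl. Qed.

Lemma hrelP (x : helt X) (u : helt B) : hrel x u ->
  exists (p : int) (x0 : X p) (u0 : B p), [/\ x = hel x0, u = hel u0 & G x0 u0].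
Proof.
case: x u => [p x] [q u] [/= e]; case: q / e u => u /= xu.
by exists p, x, u.
Qed.

(** [G] is a subcomplex of the product of [X] and [B]. Working with a relation instead of a map
    treats at once the projection out of the cylinder and the inclusion into it, whose graphs are
    read in opposite directions. *)
Definition act_compat n p (x : O n p) (f : opfun X) : Prop :=
  forall (a : nat -> helt X) (b : nat -> helt B), (forall j, (j < n)%N -> hrel (a j) (b j)) ->
  forall r e, G (f a r) (act (r := r) x (a := fun i : 'I_n => b i) e).

Lemma hrel_tag x u : hrel x u -> tag x = tag u.
Proof. by case. Qed.

Lemma hrel_psum n a b : (forall j, (j < n)%N -> hrel (a j) (b j)) ->
  forall i, (i <= n)%N -> psum a i = psum b i.
Proof.
move=> ab i ni; apply: eq_bigr => j _; apply/hrel_tag/ab.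
exact: leq_trans (ltn_ord j) ni.
Qed.

Lemma G_sub p x y u v : @G p x u -> G y v -> G (x - y) (u - v).
Proof. by move=> xu yv; rewrite addrC [u - v]addrC -!scaleN1r; exact: G_lin. Qed.

Lemma G_scale p c x u : @G p x u -> G (c *: x) (c *: u).
Proof. by move=> xu; rewrite -[c *: x]addr0 -[c *: u]addr0; exact: G_lin. Qed.

Lemma G_sum p (I : Type) (s : seq I) (c : I -> k) (F : I -> X p) (H : I -> B p) :
  (forall i, G (F i) (H i)) -> G (\sum_(i <- s) c i *: F i) (\sum_(i <- s) c i *: H i).
Proof.
by move=> FH; elim: s => [|i s IH]; rewrite ?big_nil ?big_cons //; exact: G_lin.
Qed.

Lemma act_compat_d n p (x : O n p) f : act_compat x f -> act_compat (cx_d p x) (raw_d n p f).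
Proof.
move=> xf a b ab r.
have [q ->] : exists q, r = q + 1 by exists (r - 1); rewrite subrK.
move=> ex; have e : p + \sum_(i < n) tag (b i) = q.
  by apply: (addIr 1); rewrite -ex; ring.
have ts (i : 'I_n) (j : nat) : tag (set_at b i (hel_d (b i)) j) = tag (b j) + (if j == i then 1 else 0).
  by rewrite /set_at; case: eqP => [->|]; rewrite ?addr0.
have es (i : 'I_n) : p + \sum_(j < n) tag (set_at b i (hel_d (b i)) j) = q + 1.
  by rewrite -/(psum _ n) psum_set ltn_ord -e /hel_d /psum /=; ring.
have eu (i : 'I_n) : p + \sum_(j < n) tag (upd (fun j : 'I_n => b j) i (hel_d (b i)) j) = q + 1.
  by rewrite -(es i).
have := act_d x e ex eu; set S := \sum_(i < n) _ => dx.
have -> : act (cx_d p x) ex = cx_d q (act x e) - S by rewrite dx addrK.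
rewrite /raw_d piDE piNE total_dE pi_sumE; apply: G_sub; first by apply: G_d; exact: xf.
rewrite /S; under eq_bigr => i _ do rewrite piZE.
have -> : \sum_(i < n) ksign (p + \sum_(j < n | (j < i)%N) tag (b j)) *: act x (eu i) =
  \sum_(i < n) ksign (p + psum a i) *: act x (a := fun j : 'I_n => set_at b i (hel_d (b i)) j) (es i).
  apply: eq_bigr => i _; congr (ksign (p + _) *: _); last exact: act_ext.
  have ni : (i <= n)%N by exact: ltnW.
  by rewrite (hrel_psum ab ni); exact/esym/(big_ord_widen n (fun j => tag (b j))).
apply: G_sum => i; apply: xf => j jn; rewrite /set_at; case: (j == i) => //; last exact: ab.
case: (hrelP (ab i (ltn_ord i))) => t [x0 [u0 [-> -> xu]]].
exact/hrel_hel/G_d.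
Qed.

Lemma act_compat_sym n p (s : 'S_n) (x : O n p) f :
  act_compat x f -> act_compat (op_sym s x) (raw_sym s f).
Proof.
move=> xf a b ab r e; rewrite /raw_sym piZE.
have es : p + \sum_(i < n) tag (b (s i)) = r.
  by rewrite -e; congr (_ + _); rewrite [RHS](reindex_inj (@perm_inj _ s)).
rewrite (act_sym x e es).
rewrite koszulE (@eq_kz _ _ _ (fun j => tag (b j)) (fun j => tag (a j))); last first.
  by move=> i; rewrite (hrel_tag (ab _ _)).
apply: G_scale.
have es' : p + \sum_(i < n) tag (b (perm_nat s i)) = r.
  by rewrite -es; congr (_ + _); apply: eq_bigr => i _; rewrite perm_natE.
rewrite (act_ext x es es'); last by move=> i; rewrite perm_natE.
by apply: (xf _ (fun j => b (perm_nat s j))) => j jn; apply: ab; exact: perm_nat_lt.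
Qed.

Lemma act_compat_id : act_compat op_id (@raw_id k X).
Proof.
move=> a b ab r e.
case: (hrelP (ab 0%N isT)) => t [x0 [u0 [a0 b0 xu]]].
have rt : r = t by rewrite -e big_ord1 b0 add0r.
case: t / rt x0 u0 a0 b0 xu => x0 u0 a0 b0 xu.
have e' : 0 + \sum_(i < 1) tag (hel u0) = r by rewrite big_ord1 add0r.
rewrite (act_ext _ e e') ?act_id; last by move=> i; rewrite ord1 b0.
by rewrite /raw_id a0 single_id.
Qed.

Lemma act_compat_comp m n r (p q t : int) (er : r.+1 = (m + n)%N) (et : p + q = t)
    (i : 'I_m) (x : O m p) (y : O n q) f g :
    act_compat x f -> act_compat y g -> act_compat (op_comp er et i x y) (raw_comp n q i f g).
Proof.
move=> xf yg a b ab w ea.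
have ir : (i <= r)%N by have := ltn_ord i; lia.
have abi j : (j < n)%N -> hrel (shift i a j) (shift i b j).
  by move=> jn; apply: ab; have := ltn_ord i; lia.
have eb : q + \sum_(j < n) tag (shift i b j) = q + psum (shift i b) n by [].
pose Y : helt B := hel (act y (a := fun j : 'I_n => shift i b j) eb).
have ec : p + \sum_(j < m) tag (splice i n Y b j) = w.
  rewrite -/(psum _ m) (psum_splice (q := q) er (ltn_ord i)) // -ea -et /psum; ring.
rewrite (@act_comp k O B m n r p q t w _ er et i x y (fun i : 'I_r => b i)
  (fun j : 'I_n => shift i b j) (fun l : 'I_m => splice i n Y b l) ea eb ec).
- rewrite /raw_comp piZE (hrel_psum ab) //.
  have -> : \sum_(j < r | (j < i)%N) tag (b j) = psum b i.
    exact/esym/(big_ord_widen r (fun j => tag (b j))).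
  apply/G_scale/xf => l lm; rewrite /splice; case: eqP => li.
    rewrite /inner_val (hel_total _ (q := q + psum (shift i b) n)).
      exact/hrel_hel/yg.
    by rewrite (hrel_psum abi).
  by apply: ab; rewrite /outer_pos; case: (ltnP l i); have := ltn_ord i; lia.
- by move=> l j ej; rewrite /shift ej.
- by move=> l j li ej; rewrite /splice ifN // ej.
- by rewrite /splice eqxx.
Qed.

Definition compat_relation : op_relation O X.
Proof.
apply: (@OpRelation k O X act_compat).
- by move=> n p a b ab r e; rewrite act0x; exact: G0.
- move=> n p c x y f g fP gP xf yg a b ab r e; rewrite (act_linl e) !(piDE, piZE).
  by apply: G_lin; [exact: xf | exact: yg].
- by move=> n p x f _; exact: act_compat_d.
- by move=> n p s x f _; exact: act_compat_sym.
- exact: act_compat_id.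
- by move=> m n r p q t er et i x y f g _ _; exact: act_compat_comp.
Defined.

End Compatibility.

Section RelationConj.
Variables (k : comPzRingType) (O : operad k) (X : complex k) (R S : op_relation O X).

Definition relation_conj : op_relation O X.
Proof.
apply: (@OpRelation k O X (fun n p x f => compat R x f /\ compat S x f)).
- by move=> n p; split; exact: compat0.
- by move=> n p c x y f g fP gP [? ?] [? ?]; split; exact: compat_lin.
- by move=> n p x f fP [? ?]; split; exact: compat_d.
- by move=> n p s x f fP [? ?]; split; exact: compat_sym.
- by split; exact: compat_id.
- by move=> m n r p q t er et i x y f g fP gP [? ?] [? ?]; split; exact: compat_comp.
Defined.
End RelationConj.

(** * The cylinder of a morphism of algebras *)

Lemma triple_eq (T U V : Type) (x y : T * (U * V)) :
  x.1 = y.1 -> x.2.1 = y.2.1 -> x.2.2 = y.2.2 -> x = y.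
Proof. by case: x y => [? [? ?]] [? [? ?]] /= -> -> ->. Qed.

Section Cylinder.
Variables (k : comPzRingType) (O : operad k) (A S : algebra O) (f : alg_hom A S).

Lemma alg_hom_lin p : linear (@alg_hom_fun _ _ _ _ f p).
Proof. exact: (alg_homP f).1.1. Qed.
HB.instance Definition _ p :=
  GRing.isLinear.Build k (A p) (S p) _ (@alg_hom_fun _ _ _ _ f p) (@alg_hom_lin p).

Lemma alg_hom_d p (x : A p) : f (p + 1) (cx_d p x) = cx_d p (f p x).
Proof. exact: (alg_homP f).1.2. Qed.

(* The second summand has [d (u, v) = (0, u)] and is contractible by [(u, v) |-> (v, 0)];
   taking the product of all degrees of [S] in every degree makes these maps cast-free. *)
Definition cyl_mod (p : int) : lmodType k := (A p * (total S * total S))%type.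

Definition cyl_d p (x : cyl_mod p) : cyl_mod (p + 1) := (cx_d p x.1, (0, x.2.1)).

Fact cyl_d_lin p : linear (@cyl_d p).
Proof.
move=> c x y; apply: triple_eq; rewrite /= ?linearP //.
by rewrite scaler0 addr0.
Qed.
HB.instance Definition _ p :=
  GRing.isLinear.Build k (cyl_mod p) (cyl_mod (p + 1)) _ (@cyl_d p) (@cyl_d_lin p).

Fact cyl_dd p (x : cyl_mod p) : cyl_d (cyl_d x) = 0.
Proof. by rewrite /cyl_d /= cx_dd. Qed.

Definition cyl : complex k := @Complex k cyl_mod (fun p => @cyl_d p) cyl_dd.

Definition cyl_pr p (x : cyl p) : A p := x.1.
Definition cyl_in p (x : A p) : cyl p := (x, (0, 0)).
(** The last term is forced: [(u, v)] is [(u, 0)] plus the differential of [(v, 0)], so a chain map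
    that reads a component of the first entry must send the second entry to the differential of that
    component. *)
Definition cyl_proj p (x : cyl p) : S p := f p x.1 + (x.2.1 p + total_d x.2.2 p).
Definition cyl_sec p (y : S p) : cyl p := (0, (single y, 0)).
Definition cyl_retr p (x : cyl p) : cyl p := cyl_in (cyl_pr x).

Lemma cyl_pr_lin p : linear (@cyl_pr p). Proof. by []. Qed.

Lemma cyl_in_lin p : linear (@cyl_in p).
Proof. by move=> c x y; apply: triple_eq; rewrite //= scaler0 addr0. Qed.

Lemma cyl_retr_lin p : linear (@cyl_retr p).
Proof. by move=> c x y; rewrite /cyl_retr cyl_pr_lin cyl_in_lin. Qed.

Lemma cyl_proj_lin p : linear (@cyl_proj p).
Proof.
move=> c x y; rewrite /cyl_proj /= linearP linearP !(piDE, piZE) !scalerDr.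
by rewrite [RHS]addrACA; congr (_ + _); exact: addrACA.
Qed.

Lemma cyl_sec_lin p : linear (@cyl_sec p).
Proof. by move=> c x y; apply: triple_eq; rewrite /= ?linearP // scaler0 addr0. Qed.

Lemma cyl_in_d p (x : A p) : cyl_in (cx_d p x) = cx_d p (cyl_in x).
Proof. by []. Qed.

Lemma cyl_proj_d p (x : cyl p) : cyl_proj (cx_d p x) = cx_d p (cyl_proj x).
Proof.
rewrite /cyl_proj /= alg_hom_d pi0E add0r total_dE !linearD /=.
by rewrite -(total_dE (total_d x.2.2)) total_dd pi0E addr0.
Qed.

Lemma cyl_proj_in p (x : A p) : cyl_proj (cyl_in x) = f p x.
Proof. by rewrite /cyl_proj /= linear0 !pi0E !addr0. Qed.

Lemma cyl_proj_sec p (y : S p) : cyl_proj (cyl_sec y) = y.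
Proof. by rewrite /cyl_proj /= !linear0 !pi0E single_id addr0 add0r. Qed.

(** A cocycle [(x, (u, v))] has [u = 0], and then [(0, v)] is the differential of [(v, 0)]. *)
Lemma cyl_in_quasi_iso : quasi_iso cyl_in.
Proof.
move=> p; split=> [x dx [y /(congr1 fst) e]|[x [u v]] e]; first by exists y.1.
have dx : cx_d _ x = 0 := congr1 fst e; have u0 : u = 0 := congr1 (fun z => z.2.2) e.
exists x; split=> //; exists (0, (v, 0)).
by rewrite u0; apply: triple_eq; rewrite /= ?linear0 ?subrr ?addr0.
Qed.

Definition graph_proj p (x : cyl p) (y : S p) : Prop := cyl_proj x = y.
Definition graph_in p (x : cyl p) (a : A p) : Prop := x = cyl_in a.

Definition proj_relation : op_relation O cyl.
Proof.
apply: (@compat_relation k O cyl S graph_proj).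
- by move=> p; rewrite /graph_proj /cyl_proj !linear0 !pi0E !addr0.
- by move=> p c x y u v; rewrite /graph_proj => <- <-; rewrite cyl_proj_lin.
- by move=> p x u; rewrite /graph_proj => <-; rewrite cyl_proj_d.
Defined.

Definition in_relation : op_relation O cyl.
Proof.
apply: (@compat_relation k O cyl A graph_in).
- by [].
- by move=> p c x y u v -> ->; rewrite /graph_in cyl_in_lin.
- by move=> p x u ->; rewrite /graph_in cyl_in_d.
Defined.

Definition cyl_relation := relation_conj proj_relation in_relation.
Definition cyl_operad := pair_operad cyl_relation.

Lemma hrel_proj x y : hrel graph_proj x y -> y = hel_map cyl_proj x.
Proof. by case/hrelP => p [x0 [u0 [-> -> <-]]]. Qed.

Lemma hrel_in x y : hrel graph_in x y -> x = hel_map cyl_in y.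
Proof. by case/hrelP => p [x0 [u0 [-> -> ->]]]. Qed.

Lemma proj_hrel x : hrel graph_proj x (hel_map cyl_proj x).
Proof. by case: x => p x; exact: hrel_hel. Qed.

Lemma in_hrel x : hrel graph_in (hel_map cyl_in x) x.
Proof. by case: x => p x; exact: (@hrel_hel _ _ _ _ graph_in). Qed.

Section Extension.
Variables (n : nat) (p : int) (x : O n p).

Lemma act_map_lin (B : algebra O) (g : forall p, cyl p -> B p) (a : nat -> helt cyl) i q r
  (E : forall u : cyl q, p + \sum_(j < n) tag (hel_map g (set_at a i (hel u) j)) = r) :
  (i < n)%N -> (forall p, linear (g p)) ->
  linear (fun u : cyl q => act x (a := fun j : 'I_n => hel_map g (set_at a i (hel u) j)) (E u)).
Proof.
move=> ni gl.
have sg (u : cyl q) (j : nat) :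
    set_at (fun j => hel_map g (a j)) i (hel (g q u)) j = hel_map g (set_at a i (hel u) j).
  by rewrite /set_at; case: (j == i).
have E' (w : B q) : p + \sum_(j < n) tag (set_at (fun j => hel_map g (a j)) i (hel w) j) = r.
  by rewrite -(E 0); congr (_ + _); apply: eq_bigr => j _; rewrite /set_at; case: (_ == i).
have E0 : p + \sum_(j < n) (if j == i :> nat then q else tag (hel_map g (a j))) = r.
  by rewrite -(E' 0); congr (_ + _); apply: eq_bigr => j _; rewrite /set_at; case: (_ == i).
move=> c u v.
have := act_lin x (i := Ordinal ni) E0 E' c (g q u) (g q v); rewrite -gl.
by do ![rewrite (act_ext x _ (E _) (fun j : 'I_n => sg _ j))].
Qed.

(* An [f]-compatible extension of [x] to the cylinder: correct the value coming from [A] by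
   a linear section of [cyl_proj]. It need be neither equivariant nor closed. *)
Definition ext_val (a : nat -> helt cyl) r (e : p + psum a n = r) : cyl r :=
  cyl_in (act x (a := fun i : 'I_n => hel_map cyl_pr (a i)) e) +
  cyl_sec (act x (a := fun i : 'I_n => hel_map cyl_proj (a i)) e -
           act x (a := fun i : 'I_n => hel_map cyl_proj (hel_map cyl_retr (a i))) e).

Definition ext_fun : opfun cyl := fun a => single (ext_val (erefl (p + psum a n))).

Lemma ext_funE a r (e : p + psum a n = r) : ext_fun a r = ext_val e.
Proof. by case: r / e; exact: single_id. Qed.

Lemma ext_fun0 a r : r <> p + psum a n -> ext_fun a r = 0.
Proof. by move=> ne; rewrite /ext_fun single0 //; exact: nesym. Qed.

Lemma ext_fun_op : is_op n p ext_fun.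
Proof.
split; last exact: ext_fun0.
- move=> a b ab; apply: piE => r.
  have pab : psum a n = psum b n by apply: eq_psum => j jn; rewrite ab.
  case: (r =P p + psum a n) => [e|ne]; last first.
    by rewrite !ext_fun0 // -pab.
  have e' : p + psum b n = r by rewrite e pab.
  rewrite (ext_funE (esym e)) (ext_funE e') /ext_val.
  by congr (cyl_in _ + cyl_sec (_ - _)); apply: act_ext => i; rewrite ab.
- move=> a i q ni c u v; apply: piE => r.
  have ps (w : cyl q) : psum (set_at a i (hel w)) n = psum (set_at a i (hel (0 : cyl q))) n.
    by rewrite !psum_set.
  case: (r =P p + psum (set_at a i (hel (0 : cyl q))) n) => [e|ne]; last first.
    by rewrite !(piDE, piZE) !ext_fun0 ?ps // scaler0 addr0.
  have E (w : cyl q) : p + psum (set_at a i (hel w)) n = r by rewrite ps e.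
  rewrite !(piDE, piZE) !(ext_funE (E _)).
  have L1 := act_map_lin (g := cyl_pr) E ni cyl_pr_lin.
  have L2 := act_map_lin (g := cyl_proj) E ni cyl_proj_lin.
  have L3 := act_map_lin (g := fun p x => cyl_proj (cyl_retr x)) E ni
    (fun p => linear_comp (@cyl_retr_lin p) (@cyl_proj_lin p)).
  have L := linear_addr (linear_comp L1 (@cyl_in_lin r))
     (linear_comp (linear_subr L2 L3) (@cyl_sec_lin r)).
  exact: L.
Qed.

(** After projection to [S], the value coming from [A] becomes the action on the projected
    retractions, because [f] is a morphism; it cancels the subtracted term. On arguments from [A]
    the retraction is the identity, so the correction vanishes. *)
Lemma ext_fun_compat : compat cyl_relation x ext_fun.
Proof.
split=> /= a b ab r e.
  have tb : p + psum a n = r by rewrite (hrel_psum ab).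
  rewrite (ext_funE tb) /ext_val /graph_proj.
  rewrite -[cyl_in _]scale1r cyl_proj_lin scale1r cyl_proj_in cyl_proj_sec.
  rewrite ((alg_homP f).2 _ _ _ x (fun i : 'I_n => hel_map cyl_pr (a i)) tb tb).
  rewrite (act_ext x (a := fun i : 'I_n => hel_map cyl_proj (a i))
    (b := fun i : 'I_n => b i) tb e) => [|i]; last exact/esym/hrel_proj/ab.
  rewrite [X in X + (_ - _)](_ : _ =
    act x (a := fun i : 'I_n => hel_map cyl_proj (hel_map cyl_retr (a i))) tb).
    by rewrite addrC subrK.
  apply: act_ext => i; rewrite /hel_map /=; congr hel.
  by rewrite /cyl_retr cyl_proj_in.
have tb : p + psum a n = r by rewrite (hrel_psum ab).
rewrite (ext_funE tb) /ext_val /graph_in.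
have ai (i : 'I_n) : a i = hel_map cyl_in (b i) by exact: hrel_in (ab _ _).
have -> : cyl_in (act x e) = cyl_in (act x e) + cyl_sec 0.
  by rewrite -{1}[cyl_in _]addr0; congr (_ + _); apply: triple_eq; rewrite /= ?linear0.
congr (cyl_in _ + cyl_sec _).
  apply: act_ext => i; rewrite ai; by case: (b i).
rewrite -[RHS](subrr (act x (a := fun i : 'I_n => hel_map cyl_proj (a i)) tb)).
congr (_ - _); apply: act_ext => i; rewrite ai.
by case: (b i).
Qed.

End Extension.

Lemma cyl_operad_surj n p (x : O n p) : exists z : cyl_operad n p, pair_op z = x.
Proof. by exists (mk_pair (ext_fun_op x) (ext_fun_compat x)). Qed.

End Cylinder.

(** * Acyclicity of the kernel of the projection to [O] *)

Section CylinderKernel.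
Variables (k : comPzRingType) (O : operad k) (A S : algebra O) (f : alg_hom A S).
Local Notation cyl := (cyl A S).
Local Notation cyl_in := (@cyl_in k O A S).
Local Notation cyl_proj := (@cyl_proj k O A S f).
Local Notation cyl_retr := (@cyl_retr k O A S).

Definition retr_fun : opfun cyl := fun a => single (cyl_retr (tagged (a 0%N))).

Definition contract_fun : opfun cyl := fun a =>
  @single k cyl (tag (a 0%N) - 1) (0, ((tagged (a 0%N)).2.2, 0)).

Lemma unary_op q (g : forall p, cyl p -> cyl (p + q)) : (forall p, linear (g p)) ->
  is_op 1 q (fun a => single (g _ (tagged (a 0%N)))).
Proof.
move=> gl; split.
- by move=> a b ab; rewrite ab.
- move=> a i t; rewrite ltnS leqn0 => /eqP -> c x y.
  by rewrite /set_at eqxx /hel /= gl linearP.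
- move=> a r ne; rewrite single0 // => e; apply: ne.
  by rewrite -e psumS /psum big_ord0 add0r addrC.
Qed.

Lemma retr_fun_op : is_op 1 0 retr_fun.
Proof.
split.
- by move=> a b ab; rewrite /retr_fun ab.
- move=> a i t; rewrite ltnS leqn0 => /eqP -> c x y.
  by rewrite /retr_fun /set_at eqxx /hel /= cyl_retr_lin linearP.
- move=> a r ne; rewrite /retr_fun single0 // => e; apply: ne.
  by rewrite -e psumS /psum big_ord0 !add0r.
Qed.

Lemma contract_fun_op : is_op 1 (- 1) contract_fun.
Proof.
apply: (@unary_op (- 1) (fun p x => (0, (x.2.2, 0)) : cyl (p - 1))) => p c x y.
by apply: triple_eq; rewrite /= ?scaler0 ?addr0.
Qed.

Lemma retr_fun_d : raw_d 1 0 retr_fun = 0.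
Proof.
apply: piE => a; rewrite /raw_d big_ord1 /psum big_ord0 addr0 scale1r.
by rewrite /retr_fun total_d_single /set_at eqxx /hel_d /= subrr.
Qed.

Lemma contract_fun_d : raw_d 1 (- 1) contract_fun = @raw_id k cyl - retr_fun.
Proof.
apply: piE => a; rewrite /raw_d big_ord1 /psum big_ord0 addr0.
have -> : ksign (- 1) = -1 :> k by rewrite ksignN /ksign expr1.
rewrite scaleN1r opprK /contract_fun /set_at eqxx total_d_single piDE piNE.
rewrite /raw_id /retr_fun; case: (a 0%N) => t [x [u v]] /=.
(* The contractible summand is the same module in every degree, so degrees that agree only up to a
   proof are exchanged without a cast. *)
have h p q (w : total S * total S) (e : p = q) :
  @single k cyl p (0, w) = @single k cyl q (0, w) by case: q / e.
rewrite /cyl_d /= linear0 (h _ t) ?subrK // (h (t + 1 - 1) t) ?addrK //.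
have [G ->] := linear_pack (@single_lin k cyl t).
rewrite -[LHS]linearD -[RHS]linearB; congr (G _).
by apply: triple_eq; rewrite /= ?subrr ?addr0 ?add0r ?subr0.
Qed.

(** These are the second components of the kernel of [pair_op], as [compat_null] shows. *)
Definition cyl_null (n : nat) (p : int) (g : opfun cyl) : Prop :=
  [/\ is_op n p g, forall a r, cyl_proj (g a r) = 0
    & forall b : nat -> helt A, g (fun j => hel_map cyl_in (b j)) = 0].

Lemma compat_null n p (g : opfun cyl) : is_op n p g ->
  compat (cyl_relation f) (0 : O n p) g <-> cyl_null n p g.
Proof.
move=> gP; split=> [[/= c1 c2]|[_ c1 c2]].
  split=> // [a r|b].
    case: (r =P p + psum a n) => [e|ne]; last first.
      by rewrite (op_deg gP) //; have [h ->] := linear_pack (@cyl_proj_lin _ _ _ _ f r); rewrite linear0.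
    have e' : p + \sum_(i < n) tag (hel_map cyl_proj (a i)) = r by rewrite e.
    by rewrite (c1 a (fun j => hel_map cyl_proj (a j)) _ r e') ?act0x // => j _; exact: proj_hrel.
  apply: piE => r; set a := (X in g X).
  case: (r =P p + psum a n) => [e|ne]; last by rewrite (op_deg gP).
  have e' : p + \sum_(i < n) tag (b i) = r by rewrite e.
  by rewrite (c2 a b _ r e') ?act0x // => j _; exact: in_hrel.
split=> /= a b ab r e; rewrite act0x.
  exact: c1.
rewrite /graph_in (op_ext gP (b := fun j => hel_map cyl_in (b j))) ?c2 //.
by move=> j jn; exact: hrel_in (ab _ _).
Qed.

(** Precomposition with a unary [h] preserves the kernel as soon as [h], on elements of [A], is zero
    or the identity. The first case is that of [contract_fun], the second that of [retr_fun]. *)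
Lemma cyl_null_comp n p q (i : nat) g h : (i < n)%N -> is_op 1 q h ->
  (forall b : nat -> helt A, (h (fun j => hel_map cyl_in (b j)) = 0) \/
     inner_val 1 q h 0 (fun j => hel_map cyl_in (b j)) = hel_map cyl_in (b 0%N)) ->
  cyl_null n p g -> cyl_null n (p + q) (raw_comp 1 q i g h).
Proof.
move=> ni hP hin [gP g1 g2]; split.
- exact: raw_comp_op (esym (addn1 n)) ni gP hP.
- move=> a r; rewrite /raw_comp piZE.
  by have [G GE] := linear_pack (@cyl_proj_lin _ _ _ _ f r); rewrite GE linearZ -GE /= g1 scaler0.
- move=> b; pose a : nat -> helt cyl := fun j => hel_map cyl_in (b j).
  rewrite -/a /raw_comp.
  have ea : shift i a = (fun j => hel_map cyl_in (shift i b j)) by [].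
  case: (hin (shift i b)) => [h0|hb].
    rewrite /inner_val ea h0 pi0E -(splice_set 1 i (a i)).
    by rewrite (op_set0 _ _ gP) ?scaler0.
  have -> : inner_val 1 q h i a = a i.
    by rewrite -[a i]/(hel_map cyl_in (b i)) -[i in RHS]addn0 -[b _]/(shift i b 0%N) -hb.
  have -> : splice i 1 (a i) a = a.
    apply: funext => l; rewrite /splice; case: eqP => [->|li] //.
    by congr (a _); rewrite /outer_pos; case: (ltnP l i); lia.
  by rewrite g2 scaler0.
Qed.

(* Replacing the arguments of [g] one at a time by their retractions changes [g] by a
   boundary, since [retr_fun] differs from the identity by the boundary of [contract_fun];
   once all arguments are retracted, [g] vanishes. *)
Lemma cyl_null_acyclic n p g : cyl_null n (p + 1) g -> raw_d n (p + 1) g = 0 ->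
  exists2 w, cyl_null n p w & raw_d n p w = g.
Proof.
move=> gN dg.
suff H i : (i <= n)%N -> exists gi w, [/\ cyl_null n (p + 1) gi,
    raw_d n (p + 1) gi = 0, cyl_null n p w, g = gi + raw_d n p w
    & forall a, gi a = g (fun j => if (j < i)%N then hel_map cyl_retr (a j) else a j)].
  have [gi [w [[giP _ _] _ wN e gE]]] := H n (leqnn n).
  exists w => //; rewrite e [gi](_ : _ = 0) ?add0r //; apply: piE => a; rewrite gE.
  case: gN => gP _ g0; pose b j := hel_map (@cyl_pr k O A S) (a j).
  by rewrite (op_ext gP (b := fun j => hel_map cyl_in (b j))) ?g0 // => j ->.
elim: i => [|i IH] ni.
  exists g, 0; split=> //.
    split=> // [|a r]; first exact: is_op0.
    by have [h ->] := linear_pack (@cyl_proj_lin _ _ _ _ f r); rewrite linear0.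
  by have [h ->] := linear_pack (@raw_d_lin k cyl n p); rewrite linear0 addr0.
have [gi [w [giN dgi wN e gE]]] := IH (ltnW ni).
have [giP _ _] := giN.
have er : n.+1 = (n + 1)%N by rewrite addn1.
pose gi' := raw_comp 1 0 i gi retr_fun.
pose v := raw_comp 1 (- 1) i gi contract_fun.
have comp0 q h : raw_comp 1 q i (0 : opfun cyl) h = 0.
  by have [G /(congr1 (@^~ 0)) ->] := linear_pack (@raw_comp_linl k cyl 1 q i h); rewrite linear0.
have compr0 : raw_comp 1 (0 + 1) i gi (0 : opfun cyl) = 0.
  by have [G /(congr1 (@^~ 0)) ->] := linear_pack (raw_comp_linr 1 (0 + 1) giP ni); rewrite linear0.
have giN' : cyl_null n (p + 1) gi'.
  rewrite -[p + 1]addr0; apply: cyl_null_comp giN => //; first exact: retr_fun_op.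
  move=> b; right; rewrite /inner_val /retr_fun /shift /= (hel_total _ (q := tag (b 0%N))).
    by rewrite single_id.
  by rewrite psumS /psum big_ord0 !add0r.
have vN : cyl_null n p v.
  rewrite -[p](addrK 1); apply: cyl_null_comp giN => //; first exact: contract_fun_op.
  by move=> b; left; rewrite /contract_fun /= linear0.
(* By the Leibniz rule, with [gi] closed, only the differential of [contract_fun] remains, that is,
   the identity minus the retraction; the sign is that of passing [gi], of degree [p + 1]. *)
have dv : raw_d n p v = ksign (p + 1) *: (gi - gi').
  have := raw_comp_d er ni giP contract_fun_op; rewrite addrK dgi comp0 add0r => ->.
  rewrite addNr contract_fun_d; congr (_ *: _).
  have [G GE] := linear_pack (raw_comp_linr 1 0 giP ni).
  have GE' t : raw_comp 1 0 i gi t = G t := congr1 (@^~ t) GE.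
  by rewrite -[X in _ = X - _](raw_compx1 i giP) /gi' !GE' linearB.
exists gi', (w + ksign (p + 1) *: v); split=> //.
- have := raw_comp_d er ni giP retr_fun_op; rewrite addr0 dgi comp0 add0r => ->.
  by rewrite retr_fun_d compr0 scaler0.
- have [wP w1 w2] := wN; have [vP v1 v2] := vN; rewrite addrC; split.
  + exact: is_op_lin.
  + by move=> a r; rewrite !(piDE, piZE) cyl_proj_lin v1 w1 scaler0 addr0.
  + by move=> b; rewrite !(piDE, piZE) v2 w2 scaler0 addr0.
- rewrite [w + _]addrC raw_d_lin dv scalerA ksign_sqr scale1r e.
  by rewrite [RHS]addrA [gi' + _]addrC subrK.
- move=> a; rewrite /gi' /raw_comp mul0r ksign0 scale1r gE.
  have [gP _ _] := gN; apply: (op_ext gP) => j jn.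
  rewrite /splice [in RHS]ltnS; case: (ltngtP j i) => [ji|ji|->] /=.
  + by rewrite /outer_pos ji.
  + by rewrite /outer_pos ifN; [congr (a _)|]; lia.
  + rewrite /inner_val /retr_fun /shift /= (hel_total _ (q := tag (a i))) ?addn0.
      by rewrite single_id.
    by rewrite psumS /psum big_ord0 !add0r addn0.
Qed.

Lemma cyl_operad_acyclic n p (z : cyl_operad f n (p + 1)) :
  pair_op z = 0 -> cx_d _ z = 0 ->
  exists2 w : cyl_operad f n p, pair_op w = 0 & cx_d _ w = z.
Proof.
move=> z0 dz.
have zN : cyl_null n (p + 1) (pair_fun z).
  by apply/compat_null; [exact: pair_is_op | rewrite -z0; exact: pair_rel].
have dz' : raw_d n (p + 1) (pair_fun z) = 0 := congr1 (@pair_fun _ _ _ _ _ _) dz.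
have [w wN dw] := cyl_null_acyclic zN dz'.
have [wP _ _] := wN.
exists (mk_pair wP ((compat_null wP).2 wN)) => //.
apply: pair_eq => //; rewrite z0; exact: linear0.
Qed.

End CylinderKernel.

(** * Lifting along trivial fibrations of operads *)

Section OperadLifting.
Variable k : comPzRingType.

(** Surjective with acyclic kernel: this form is what the cylinder provides and what extending a
    lift over one generator consumes. *)
Definition operad_trivial_fibration (P Q : Op k) (f : hom P Q) : Prop :=
  (forall n p (y : (Q : operad k) n p), exists x, operad_hom_fun f x = y) /\
  (forall n p (z : (P : operad k) n (p + 1)), operad_hom_fun f z = 0 -> cx_d _ z = 0 ->
     exists2 w : (P : operad k) n p, operad_hom_fun f w = 0 & cx_d _ w = z).

Lemma operad_hom_lin (P Q : operad k) (f : operad_hom P Q) n p : linear (f n p).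
Proof. by have [fc _ _ _] := operad_homP f; exact: (fc n).1. Qed.

Lemma operad_hom_d (P Q : operad k) (f : operad_hom P Q) n p (x : P n p) :
  f n (p + 1) (cx_d p x) = cx_d p (f n p x).
Proof. by have [fc _ _ _] := operad_homP f; exact: (fc n).2. Qed.

(** For any preimage [x0] of [y], the element [z - cx_d _ x0] is a cocycle of the kernel; adding a
    primitive of it inside the kernel corrects [x0] without moving its image. *)
Lemma trivial_fibration_fill (P Q : Op k) (f : hom P Q) n p
  (z : (P : operad k) n (p + 1)) (y : (Q : operad k) n p) :
  operad_trivial_fibration f -> cx_d _ z = 0 -> operad_hom_fun f z = cx_d _ y ->
  exists x : (P : operad k) n p, cx_d _ x = z /\ operad_hom_fun f x = y.
Proof.
move=> [fs fa] dz fz; have [x0 x0y] := fs n p y.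
have [g1 g1E] := linear_pack (@operad_hom_lin _ _ f n (p + 1)).
have [g0 g0E] := linear_pack (@operad_hom_lin _ _ f n p).
have e1 : operad_hom_fun f (z - cx_d _ x0) = 0.
  by rewrite g1E linearB -g1E fz operad_hom_d x0y subrr.
have e2 : cx_d _ (z - cx_d _ x0) = 0 by rewrite linearB /= dz cx_dd subrr.
have [w fw dw] := fa _ _ _ e1 e2.
exists (x0 + w); split; first by rewrite linearD /= dw [LHS]addrC subrK.
by rewrite g0E linearD -g0E fw addr0.
Qed.

Lemma free_extension_lifting (P Q X Y : Op k) (i : hom P Q) (f : hom X Y) :
  is_free_extension i -> operad_trivial_fibration f -> has_lifting i f.
Proof.
move=> [I [ar [dg [z [g [dz dg' uni]]]]]] fT u v uv.
have fill j : exists x : (X : operad k) (ar j) (dg j),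
    cx_d _ x = operad_hom_fun u (z j) /\ operad_hom_fun f x = operad_hom_fun v (g j).
  apply: trivial_fibration_fill => //.
    rewrite -operad_hom_d dz.
    by have [h ->] := linear_pack (@operad_hom_lin _ _ u (ar j) (dg j + 1 + 1)); rewrite linear0.
  rewrite -operad_hom_d dg'.
  exact: (congr1 (fun h : operad_hom P Y => h _ _ (z j)) uv).
pose y j := sval (cid (fill j)); have yP j := svalP (cid (fill j)); rewrite -/(y _) in yP.
have [h [[hi hy] _]] := uni X u y (fun j => (yP j).1).
exists h; split=> //.
have fy j : cx_d _ (operad_hom_fun f (y j)) = operad_hom_fun (f \oc u) (z j).
  by rewrite -operad_hom_d (yP j).1.
(* Both [f \oc h] and [v] extend [f \oc u] with the same values on the generators, so the uniqueness
   in the free extension identifies them. *)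
have [h' [_ h'u]] := uni Y (f \oc u) (fun j => operad_hom_fun f (y j)) fy.
rewrite -(h'u (f \oc h)); last first.
  by split=> [|j]; [rewrite -compA hi | rewrite /= hy].
by apply: h'u; split=> // j; rewrite (yP j).2.
Qed.

(** The lifts over the stages are chosen recursively, each one extending the previous one on the
    nose, so that they form a cocone; uniqueness of maps out of the colimit then gives the lower
    triangle. *)
Lemma standard_cofibration_lifting (P Q X Y : Op k) (i : hom P Q) (f : hom X Y) :
  standard_cofibration i -> operad_trivial_fibration f -> has_lifting i f.
Proof.
move=> [S [s [c [e [[e' [e'e ee']] sF [cs cU] ic]]]]] fT u v uv.
pose T n := {t : hom (S n) X | f \oc t = v \oc c n}.
have t0P : f \oc (u \oc e') = v \oc c 0%N.
  by rewrite compA uv ic -!compA ee' compc1.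
have step n (t : T n) : {t' : T n.+1 | sval t' \oc s n = sval t}.
  apply: cid; case: t => t tP /=.
  have [t' [t's ft']] := free_extension_lifting (sF n) fT (u := t) (v := v \oc c n.+1)
    (etrans tP (etrans (congr1 (comp v) (esym (cs n))) (compA _ _ _))).
  by exists (exist _ t' ft').
pose t := fix t n : T n := if n is m.+1 then sval (step m (t m)) else exist _ _ t0P.
have [h [hc _]] := cU X (fun n => sval (t n)) (fun n => svalP (step n (t n))).
exists h; split; first by rewrite ic compA hc -compA e'e compc1.
have [h' [_ h'u]] := cU Y (fun n => v \oc c n)
  (fun n => etrans (esym (compA _ _ _)) (congr1 (comp v) (cs n))).
rewrite -(h'u (f \oc h)) ?(h'u v) // => n.
by rewrite -compA hc; exact: svalP (t n).
Qed.

(** The map from the initial operad is only a retract of a standard cofibration [g]. The lifting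
    square is therefore set up for [g] itself, its top edge passing through the initial operad,
    which makes it commute; the lift is then restricted along the retract. *)
Lemma cofibrant_section (P Q : Op k) (f : hom P Q) :
  cofibrant_operad Q -> operad_trivial_fibration f ->
  exists s : hom Q P, f \oc s = idc Q.
Proof.
move=> [I [i [init [J [J' [g [gS [a [r [b [t [ra tb gafb irtg]]]]]]]]]]]] fT.
have [u0 [_ _]] := init P.
have [q [_ qu]] := init Q.
have uv : f \oc (u0 \oc r) = t \oc g.
  by rewrite compA -(qu (f \oc u0)) // (qu i) // irtg.
have [h [_ fh]] := standard_cofibration_lifting gS fT uv.
by exists (h \oc b); rewrite compA fh tb.
Qed.

End OperadLifting.

(** * The algebra structure on the cylinder *)

Section CylinderAlgebra.
Variables (k : comPzRingType) (O : operad k) (A S : algebra O) (f : alg_hom A S).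
Local Notation cyl := (cyl A S).

Fact cyl_operad_proj_proof :
  is_operad_hom (fun n p (z : cyl_operad f n p) => pair_op z).
Proof. by split=> // n; split=> // p; exact: pair_op_lin. Qed.

Definition cyl_operad_proj : hom (cyl_operad f : Op k) (O : Op k) :=
  OperadHom cyl_operad_proj_proof.

Lemma cyl_operad_trivial_fibration : operad_trivial_fibration cyl_operad_proj.
Proof.
split=> n p; first exact: cyl_operad_surj.
exact: cyl_operad_acyclic.
Qed.

Variable s : operad_hom O (cyl_operad f).
Hypothesis sK : forall n p (x : O n p), pair_op (s n p x) = x.

(** The default value beyond position [n] is arbitrary: an operation of arity [n] reads only the
    first [n] entries. *)
Definition tuple_nat (X : complex k) n (a : 'I_n -> helt X) (j : nat) : helt X :=
  if insub j is Some i then a i else hel (0 : X 0).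

Lemma tuple_natE (X : complex k) n (a : 'I_n -> helt X) (i : 'I_n) : tuple_nat a i = a i.
Proof. by rewrite /tuple_nat valK. Qed.

Lemma tuple_nat_val (X : complex k) n (a : 'I_n -> helt X) (i : 'I_n) j :
  j = i :> nat -> tuple_nat a j = a i.
Proof. by move=> ->; exact: tuple_natE. Qed.

Lemma tuple_nat_upd (X : complex k) n (a : 'I_n -> helt X) i u :
  tuple_nat (upd a i u) = set_at (tuple_nat a) i u.
Proof.
apply: funext => j; rewrite /tuple_nat /set_at; case: insubP => [i' _ <-|nj].
  by rewrite /upd -val_eqE.
by rewrite ifN //; apply: contraNneq nj => ->.
Qed.

Lemma psum_tuple (X : complex k) n (a : 'I_n -> helt X) :
  psum (tuple_nat a) n = \sum_(i < n) tag (a i).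
Proof. by apply: eq_bigr => i _; rewrite tuple_natE. Qed.

Let phi n p (x : O n p) : opfun cyl := pair_fun (s n p x).

Let phiP n p (x : O n p) : is_op n p (phi x).
Proof. exact: pair_is_op. Qed.

Let phi_compat n p (x : O n p) : compat (cyl_relation f) x (phi x).
Proof. by rewrite -{1}[x]sK; exact: pair_rel. Qed.

Definition cyl_act n (p r : int) (x : O n p) (a : 'I_n -> helt cyl)
  (_ : p + \sum_(i < n) tag (a i) = r) : cyl r := phi x (tuple_nat a) r.

Let sH := operad_homP s.

(** An algebra structure is a morphism from [O] to the endomorphism operad; here it is the second
    component of the section [s]. Each axiom restates that [s] is a morphism or that the operation
    is multilinear. *)
Definition cyl_algebra : algebra O.
Proof.
refine (@Algebra k O cyl cyl_act _ _ _ _ _ _).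
- move=> n p r a e c x y.
  by rewrite /cyl_act /phi operad_hom_lin pair_fun_lin !(piDE, piZE).
- move=> n p q r x a i c u v e eu ev; rewrite /cyl_act !tuple_nat_upd.
  by rewrite (op_lin (phiP x)) // !(piDE, piZE).
- move=> n p r x a e ex ea; rewrite /cyl_act.
  have -> : phi (cx_d p x) = raw_d n p (phi x) by rewrite /phi operad_hom_d.
  rewrite /raw_d piDE piNE total_dE pi_sumE.
  set T := \sum_(i < n) _; set T' := \sum_(i < n) _; suff -> : T = T' by rewrite subrK.
  apply: eq_bigr => i _; rewrite piZE tuple_nat_upd tuple_natE; congr (ksign (p + _) *: _).
  rewrite /psum (big_ord_widen n (fun j => tag (tuple_nat a j))); last exact: ltnW.
  by apply: eq_bigr => j _; rewrite tuple_natE.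
- move=> n p r t x a e es; rewrite /cyl_act.
  have -> : phi (op_sym t x) = raw_sym t (phi x) by case: sH => _ ss _ _; rewrite /phi ss.
  rewrite /raw_sym piZE -koszulE.
  have -> : (fun i : 'I_n => tuple_nat a i) = a by apply: funext => i; rewrite tuple_natE.
  apply: (congr1 (fun v : total cyl => koszul t a *: v r)); apply: (op_ext (phiP x)) => j jn.
  have ej : j = Ordinal jn by [].
  by rewrite (perm_nat_val _ ej) tuple_natE (tuple_nat_val _ ej).
- move=> q u e; rewrite /cyl_act.
  have -> : phi op_id = @raw_id k cyl by case: sH => _ _ si _; rewrite /phi si.
  by rewrite /raw_id (tuple_natE _ (ord0 : 'I_1)) single_id.
- move=> m n r p q t w v er et i x y a b c ea eb ec hb hc hci; rewrite /cyl_act.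
  have -> : phi (op_comp er et i x y) = raw_comp n q i (phi x) (phi y).
    by case: sH => _ _ _ sc; rewrite /phi sc.
  have ir : (i <= r)%N by have := ltn_ord i; lia.
  rewrite /raw_comp piZE; congr (ksign (q * _) *: _).
    rewrite /psum (big_ord_widen r (fun j => tag (tuple_nat a j))) //.
    by apply: eq_bigr => j _; rewrite tuple_natE.
  apply: (congr1 (@^~ w)); apply: (op_ext (phiP x)) => l lm.
  rewrite /splice; case: eqP => [->|li].
    rewrite tuple_natE hci /inner_val.
    have eb' j : (j < n)%N -> shift i (tuple_nat a) j = tuple_nat b j.
      move=> jn; have jr : (i + j < r)%N by have := ltn_ord i; lia.
      rewrite /shift (tuple_nat_val a (i := Ordinal jr)) // (tuple_nat_val b (i := Ordinal jn)) //.
      by rewrite (hb (Ordinal jn) (Ordinal jr)).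
    rewrite (op_ext (phiP y) eb'); apply: hel_total.
    by rewrite -eb -psum_tuple; congr (_ + _); apply: eq_psum => j jn; rewrite eb'.
  have lr : (outer_pos i n l < r)%N.
    by rewrite /outer_pos; case: (ltnP l i); have := ltn_ord i; lia.
  rewrite (tuple_nat_val c (i := Ordinal lm)) // (tuple_nat_val a (i := Ordinal lr)) //.
  by rewrite (hc (Ordinal lm) (Ordinal lr)) // -val_eqE; exact/eqP.
Defined.

Fact cyl_in_hom : is_alg_hom (A := A) (B := cyl_algebra) (@cyl_in k O A S).
Proof.
split; first by split=> // p; exact: cyl_in_lin.
move=> n p r x a e e'.
have [_ c2] := phi_compat x.
apply/esym; rewrite /= /cyl_act.
have er : p + \sum_(i < n) tag (tuple_nat a i) = r by rewrite -/(psum _ n) psum_tuple.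
rewrite (op_ext (phiP x) (b := fun j => hel_map (@cyl_in k O A S) (tuple_nat a j))).
  rewrite (c2 (fun j => hel_map (@cyl_in k O A S) (tuple_nat a j)) (tuple_nat a)
    (fun j _ => in_hrel _ _) r er); congr cyl_in.
  by apply: act_ext => i; rewrite tuple_natE.
by move=> j jn; rewrite !(tuple_nat_val _ (i := Ordinal jn)).
Qed.

Fact cyl_proj_hom : is_alg_hom (A := cyl_algebra) (B := S) (@cyl_proj k O A S f).
Proof.
split.
  by split=> [p|p x]; [exact: cyl_proj_lin | exact: cyl_proj_d].
move=> n p r x a e e'.
have [c1 _] := phi_compat x.
have er : p + \sum_(i < n) tag (hel_map (@cyl_proj k O A S f) (tuple_nat a i)) = r.
  by rewrite -e'; congr (_ + _); apply: eq_bigr => i _; rewrite tuple_natE.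
rewrite /= /cyl_act (c1 (tuple_nat a) (fun j => hel_map (@cyl_proj k O A S f) (tuple_nat a j))
  (fun j _ => proj_hrel _ _) r er).
by apply: act_ext => i; rewrite tuple_natE.
Qed.

End CylinderAlgebra.

Lemma factor_weak_surjective (k : comPzRingType) (O : operad k) :
  cofibrant_operad (O : Op k) -> forall (A S : Alg O) (f : hom A S),
  exists (M : Alg O) (c : hom A M) (q : hom M S),
    [/\ q \oc c = f, alg_quasi_iso c & alg_surjective q].
Proof.
move=> cof A S f.
have [s /(congr1 (@operad_hom_fun _ _ _)) sE] := cofibrant_section cof (cyl_operad_trivial_fibration f).
have sK n p (x : O n p) : pair_op (operad_hom_fun s x) = x.
  exact: (congr1 (fun h => h n p x) sE).
exists (cyl_algebra s), (AlgHom (cyl_in_hom sK)), (AlgHom (cyl_proj_hom sK)); split.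
- apply: alg_hom_eq; apply: functional_extensionality_dep => p; apply: funext => x.
  exact: cyl_proj_in.
- exact: cyl_in_quasi_iso.
- by move=> p y; exists (cyl_sec A y); exact: cyl_proj_sec.
Qed.

(** * Presented algebras *)

Section JointlyInjective.
Variables (k : comPzRingType) (O : operad k) (Z : complex k).
Variable zact : forall n (p r : int) (x : O n p) (a : 'I_n -> helt Z),
  p + \sum_(i < n) tag (a i) = r -> Z r.
Variable F : forall C : algebra O, (forall p, Z p -> C p) -> Prop.
Implicit Types C : algebra O.
Hypothesis F_chain : forall C h, @F C h -> is_chain_map h.
Hypothesis F_act : forall C h, @F C h -> forall n (p r : int) (x : O n p) (a : 'I_n -> helt Z)
  (e : p + \sum_(i < n) tag (a i) = r),
  h r (zact x e) = act x (a := fun i => hel_map h (a i)) e.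
Hypothesis F_inj : forall p (y z : Z p), (forall C h, @F C h -> h p y = h p z) -> y = z.

(* The algebra axioms are equations, so they can be checked after applying the maps of a
   jointly injective family. *)
Definition joint_algebra : algebra O.
Proof.
refine (@Algebra k O Z zact _ _ _ _ _ _).
- move=> n p r a e b x y; apply: F_inj => C h Fh.
  by rewrite (F_chain Fh).1 !(F_act Fh) act_linl.
- move=> n p q r x a i b u v e eu ev; apply: F_inj => C h Fh.
  rewrite (F_chain Fh).1 !(F_act Fh).
  pose a' j := hel_map h (a j).
  have ua (w : Z q) (j : 'I_n) : hel_map h (upd a i (hel w) j) = upd a' i (hel (h q w)) j.
    by rewrite /upd; case: (j == i).
  have E (w : Z q) (ew : p + \sum_(j < n) tag (upd a i (hel w) j) = r) :
      p + \sum_(j < n) tag (upd a' i (hel (h q w)) j) = r.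
    by rewrite -ew; congr (_ + _); apply: eq_bigr => j _; rewrite -ua.
  rewrite (act_ext x _ (E _ e) (ua _)) (act_ext x _ (E _ eu) (ua _)) (act_ext x _ (E _ ev) (ua _)).
  have eb : h q (b *: u + v) = b *: h q u + h q v by exact: (F_chain Fh).1.
  by move: (E _ e); rewrite eb => e'; rewrite (act_linr x e' (E _ eu) (E _ ev)).
- move=> n p r x a e ex ea; apply: F_inj => C h Fh.
  have [g hE] := linear_pack ((F_chain Fh).1 (r + 1)).
  rewrite (F_chain Fh).2 (F_act Fh) hE linearD linear_sum -hE (F_act Fh).
  pose a' j := hel_map h (a j).
  have ua (i j : 'I_n) : hel_map h (upd a i (hel_d (a i)) j) = upd a' i (hel_d (a' i)) j.
    rewrite /upd; case: (j == i) => //.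
    by rewrite /a' /hel_d /hel_map /hel /= (F_chain Fh).2.
  have ea' (i : 'I_n) : p + \sum_(j < n) tag (upd a' i (hel_d (a' i)) j) = r + 1.
    by rewrite -(ea i); congr (_ + _); apply: eq_bigr => j _; rewrite -ua.
  rewrite (act_d x (a := a') e ex ea'); congr (_ + _); apply: eq_bigr => i _.
  by rewrite hE linearZ -hE /= (F_act Fh) (act_ext x _ (ea' i) (ua i)).
- move=> n p r s x a e es; apply: F_inj => C h Fh.
  have [g hE] := linear_pack ((F_chain Fh).1 r).
  rewrite hE linearZ -hE !(F_act Fh).
  by rewrite (act_sym x (a := fun i => hel_map h (a i)) e es).
- move=> q u e; apply: F_inj => C h Fh.
  by rewrite (F_act Fh) (act_id (u := h q u) e).
- move=> m n r p q t w v er et i x y a b c ea eb ec hb hc hci; apply: F_inj => C h Fh.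
  have [g hE] := linear_pack ((F_chain Fh).1 w).
  rewrite [in RHS]hE linearZ -hE !(F_act Fh).
  apply: (@act_comp k O C m n r p q t w v er et i x y (fun i => hel_map h (a i))
    (fun i => hel_map h (b i)) (fun i => hel_map h (c i)) ea eb ec).
  + by move=> l j lj; rewrite (hb l j lj).
  + by move=> l j li lj; rewrite (hc l j li lj).
  + by rewrite hci /hel_map /hel /= (F_act Fh).
Defined.

End JointlyInjective.

Section PresentedAlgebra.
Variables (k : comPzRingType) (O : operad k) (Gen Cell : int -> Type).

(** A [TCell] depends on a term already built, so infinitely many rounds of attaching cells, each
    over elements created by earlier ones, fit into one inductive type. *)
Inductive term : int -> Type :=
| TGen p of Gen p : term p
| TCell p of term (p + 1) & Cell p : term p
| TZero p : term p
| TAdd p of term p & term p : term p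
| TScale p of k & term p : term p
| TDiff p of term p : term (p + 1)
| TAct n (p r : int) (x : O n p) (q : 'I_n -> int) (a : forall i, term (q i)) of
    p + \sum_(i < n) q i = r : term r.

Definition gens (C : complex k) := forall p, Gen p -> C p.
Definition cells (C : complex k) := forall p, C (p + 1) -> Cell p -> C p.

Fixpoint eval (C : algebra O) (g : gens C) (c : cells C) p (t : term p) : C p :=
  match t in term p return C p with
  | TGen p x => g p x
  | TCell p t y => c p (eval g c t) y
  | TZero p => 0
  | TAdd p t u => eval g c t + eval g c u
  | TScale p b t => b *: eval g c t
  | TDiff p t => cx_d p (eval g c t)
  | TAct n p r x q a e => act x (a := fun i => hel (eval g c (a i))) e
  end.

Variable model : forall C : algebra O, gens C -> cells C -> Prop.

Implicit Types C : algebra O.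

(* Terms are identified when they agree in all models. The class of models may be cut out by
   implications between equations, not just equations. *)
Definition term_eq p (t u : term p) : Prop :=
  forall C (g : gens C) (c : cells C), model g c -> eval g c t = eval g c u.

(** The quotient is the type of equivalence classes, each class being a predicate on terms. As
    [term_eq] is a proposition, its quantification over all algebras raises no size problem. *)
Definition pres p : Type := {P : term p -> Prop | exists t, P = term_eq t}.
HB.instance Definition _ p := gen_eqMixin (pres p).
HB.instance Definition _ p := gen_choiceMixin (pres p).

Definition cls p (t : term p) : pres p := exist _ (term_eq t) (ex_intro _ t erefl).
Definition repr p (z : pres p) : term p := sval (cid (svalP z)).

Lemma cls_eq p (t u : term p) : term_eq t u -> cls t = cls u.
Proof.
move=> tu; apply: eq_exist; apply: funext => w; apply/propext.
by split=> h C g c m; rewrite -?h // ?tu // -tu // h.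
Qed.

Lemma reprK p (z : pres p) : cls (repr z) = z.
Proof.
case: z => P PP; rewrite /repr /=; case: cid => t /= e.
by apply: eq_exist.
Qed.

Lemma eval_repr p (t : term p) C (g : gens C) (c : cells C) : model g c ->
  eval g c (repr (cls t)) = eval g c t.
Proof.
move=> m; have := congr1 (fun P => sval P t) (reprK (cls t)) => /= e.
have : term_eq (repr (cls t)) t by rewrite e.
by apply.
Qed.

Definition peval C (g : gens C) (c : cells C) p (z : pres p) : C p := eval g c (repr z).

Lemma pevalE C (g : gens C) (c : cells C) p (t : term p) :
  model g c -> peval g c (cls t) = eval g c t.
Proof. exact: eval_repr. Qed.

Lemma pres_eq p (y z : pres p) :
  (forall C (g : gens C) (c : cells C), model g c -> peval g c y = peval g c z) -> y = z.
Proof. by move=> e; rewrite -(reprK y) -(reprK z); apply: cls_eq. Qed.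

Definition pres_add p (y z : pres p) := cls (TAdd (repr y) (repr z)).
Definition pres_opp p (y : pres p) := cls (TScale (- 1) (repr y)).
Definition pres_scale p (b : k) (y : pres p) := cls (TScale b (repr y)).

Ltac by_models :=
  move=> *; apply: pres_eq => C g c m;
  rewrite /pres_scale /pres_opp /pres_add !pevalE //= -?/(peval _ _ _) ?pevalE //=
    -?/(peval _ _ _).

Fact pres_addA p : associative (@pres_add p). Proof. by by_models; rewrite addrA. Qed.
Fact pres_addC p : commutative (@pres_add p). Proof. by by_models; rewrite addrC. Qed.
Fact pres_add0 p : left_id (cls (TZero p)) (@pres_add p).
Proof. by by_models; rewrite add0r. Qed.
Fact pres_addN p : left_inverse (cls (TZero p)) (@pres_opp p) (@pres_add p).
Proof. by by_models; rewrite scaleN1r addNr. Qed.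
HB.instance Definition _ p := GRing.isZmodule.Build (pres p)
  (@pres_addA p) (@pres_addC p) (@pres_add0 p) (@pres_addN p).

Fact pres_scaleA p a b (x : pres p) : pres_scale a (pres_scale b x) = pres_scale (a * b) x.
Proof. by by_models; rewrite scalerA. Qed.
Fact pres_scale1 p : left_id 1 (@pres_scale p).
Proof. by by_models; rewrite scale1r. Qed.
Fact pres_scaleDr p : right_distributive (@pres_scale p) +%R.
Proof. by move=> *; rewrite /GRing.add /=; by_models; rewrite scalerDr. Qed.
Fact pres_scaleDl p (x : pres p) : {morph (@pres_scale p)^~ x : a b / a + b}.
Proof. by move=> *; rewrite [in RHS]/GRing.add /=; by_models; rewrite scalerDl. Qed.
HB.instance Definition _ p := GRing.Zmodule_isLmodule.Build k (pres p)
  (@pres_scaleA p) (@pres_scale1 p) (@pres_scaleDr p) (@pres_scaleDl p).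

Lemma peval_lin C (g : gens C) (c : cells C) p : model g c -> linear (@peval C g c p).
Proof.
move=> m b x y; change (peval g c (pres_add (pres_scale b x) y) = b *: peval g c x + peval g c y).
by rewrite pevalE //= -/(peval _ _ _) pevalE.
Qed.

Definition pres_d p (z : pres p) : pres (p + 1) := cls (TDiff (repr z)).

Lemma peval_d C (g : gens C) (c : cells C) p (z : pres p) : model g c ->
  peval g c (pres_d z) = cx_d p (peval g c z).
Proof. by move=> m; rewrite pevalE. Qed.

Fact pres_d_lin p : linear (@pres_d p).
Proof.
move=> b x y; apply: pres_eq => C g c m.
by rewrite peval_d // !(peval_lin m) !peval_d // linearP.
Qed.
HB.instance Definition _ p :=
  GRing.isLinear.Build k (pres p) (pres (p + 1)) _ (@pres_d p) (@pres_d_lin p).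

Lemma peval0 C (g : gens C) (c : cells C) p : model g c -> peval g c (0 : pres p) = 0.
Proof. by move=> m; have [h ->] := linear_pack (@peval_lin _ _ _ p m); rewrite linear0. Qed.

Fact pres_dd p (z : pres p) : pres_d (pres_d z) = 0.
Proof. by apply: pres_eq => C g c m; rewrite !peval_d // cx_dd peval0. Qed.

Definition pres_cx : complex k := @Complex k pres (fun p => @pres_d p) pres_dd.

Definition pres_act n (p r : int) (x : O n p) (a : 'I_n -> helt pres_cx)
  (e : p + \sum_(i < n) tag (a i) = r) : pres_cx r :=
  cls (TAct x (fun i => repr (tagged (a i))) e).

Lemma peval_act C (g : gens C) (c : cells C) n (p r : int) (x : O n p)
  (a : 'I_n -> helt pres_cx) (e : p + \sum_(i < n) tag (a i) = r) : model g c ->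
  peval g c (pres_act x e) = act x (a := fun i => @hel_map k pres_cx _ (peval g c) (a i)) e.
Proof. by move=> m; rewrite pevalE. Qed.

Definition pres_eval C (h : forall p, pres_cx p -> C p) : Prop :=
  exists (g : gens C) (c : cells C), model g c /\ h = peval g c.

Definition pres_alg : algebra O.
Proof.
apply: (@joint_algebra k O pres_cx pres_act pres_eval).
- by move=> C h [g [c [m ->]]]; split=> [p|p z]; [exact: peval_lin | exact: peval_d].
- by move=> C h [g [c [m ->]]] n p r x a e; exact: peval_act.
- by move=> p y z e; apply: pres_eq => C g c m; apply: e; exists g, c.
Defined.

Definition pres_gens : gens pres_alg := fun p x => cls (TGen x).
Definition pres_cells : cells pres_alg := fun p z y => cls (TCell (repr z) y).

Definition compatible (C : algebra O) (g : gens C) (c : cells C)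
  (C' : algebra O) (g' : gens C') (c' : cells C') (h : alg_hom C C') : Prop :=
  (forall p x, h p (g p x) = g' p x) /\ (forall p z y, h p (c p z y) = c' p (h _ z) y).

Lemma peval_hom C (g : gens C) (c : cells C) : model g c ->
  is_alg_hom (A := pres_alg) (B := C) (peval g c).
Proof.
move=> m; split.
  by split=> [p|p x]; [exact: peval_lin | exact: peval_d].
by move=> n p r x a e e'; rewrite /= peval_act // (Prop_irrelevance e e').
Qed.

Lemma pres_hom C (g : gens C) (c : cells C) : model g c ->
  exists h : alg_hom pres_alg C, compatible pres_gens pres_cells g c h.
Proof.
move=> m; exists (AlgHom (peval_hom m)); split=> [p x|p z y] /=.
  by rewrite /pres_gens pevalE.
by rewrite /pres_cells pevalE.
Qed.

(** Every element is the class of a term, and compatibility determines the value by induction on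
    that term. The lemma applies to arbitrary target data, in particular to data transported along
    another morphism. *)
Lemma pres_hom_uniq C (g : gens C) (c : cells C) (h h' : alg_hom pres_alg C) :
  compatible pres_gens pres_cells g c h -> compatible pres_gens pres_cells g c h' -> h = h'.
Proof.
move=> [hg hc] [hg' hc']; apply: alg_hom_eq.
apply: functional_extensionality_dep => p; apply: funext => z.
rewrite -(reprK z); elim: {z}(repr z) => {p}.
- by move=> p x; have := hg p x; have := hg' p x; rewrite /pres_gens => -> ->.
- move=> p t IH y.
  have -> : cls (TCell t y) = pres_cells (cls t : pres_alg _) y.
    by apply: pres_eq => D gD cD m; rewrite /pres_cells !pevalE //= eval_repr.
  by rewrite hc hc' IH.
- move=> p; have -> : cls (TZero p) = (0 : pres_alg p) by [].
  have [? ->] := linear_pack (alg_hom_lin h (p := p)).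
  by have [? ->] := linear_pack (alg_hom_lin h' (p := p)); rewrite !linear0.
- move=> p t IH u IHu.
  have -> : cls (TAdd t u) = (1 *: cls t + cls u : pres_alg p).
    by rewrite scale1r; apply: pres_eq => D gD cD m; rewrite -[cls t]scale1r (peval_lin m) !pevalE // scale1r.
  by rewrite (alg_hom_lin h) (alg_hom_lin h') IH IHu.
- move=> p b t IH.
  have -> : cls (TScale b t) = (b *: cls t : pres_alg p).
    apply: pres_eq => D gD cD m; have [g1 g1E] := linear_pack (@peval_lin _ _ _ p m).
    by rewrite pevalE // g1E linearZ -g1E pevalE.
  have [[g1 g1E] [g2 g2E]] :=
    (linear_pack (alg_hom_lin h (p := p)), linear_pack (alg_hom_lin h' (p := p))).
  by rewrite g1E g2E !linearZ -g1E -g2E IH.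
- move=> p t IH.
  have -> : cls (TDiff t) = cx_d p (cls t : pres_alg p).
    by apply: pres_eq => D gD cD m; rewrite peval_d // !pevalE.
  by rewrite !alg_hom_d IH.
- move=> n p r x q a IH e.
  have -> : cls (TAct x a e) = act (a := fun i => hel (cls (a i) : pres_alg (q i))) x e.
    apply: pres_eq => D gD cD m; rewrite peval_act // pevalE //=.
    by apply: act_ext => i; rewrite /hel_map /hel /= pevalE.
  rewrite ((alg_homP h).2 _ _ _ x (fun i => hel (cls (a i) : pres_alg (q i))) e e).
  rewrite ((alg_homP h').2 _ _ _ x (fun i => hel (cls (a i) : pres_alg (q i))) e e).
  by apply: act_ext => i; rewrite /hel_map /hel /= IH.
Qed.

(** Equations that hold in all models are transferred to [pres_alg] in this way; for conditions
    given by implications, the premise is first pushed along [h]. *)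
Lemma pres_alg_eq p (y z : pres_alg p) :
  (forall C (g : gens C) (c : cells C) (h : alg_hom pres_alg C), model g c ->
     compatible pres_gens pres_cells g c h -> h p y = h p z) -> y = z.
Proof.
move=> e; apply: pres_eq => C g c m; apply: (e C g c (AlgHom (peval_hom m))) => //.
by split=> [q x|q t u] /=; rewrite ?/pres_gens ?/pres_cells pevalE.
Qed.

End PresentedAlgebra.

(** * Limits and colimits of algebras *)

Section Subproduct.
Variables (k : comPzRingType) (O : operad k) (I : Type) (A : I -> algebra O).

(** A subalgebra of a product, given by a predicate on families. Finite limits and pullbacks are
    both obtained from it. *)
Record closed_family := ClosedFamily {
  family : forall p, (forall i, A i p) -> Prop;
  family_lin : forall p,
    family (fun i => 0 : A i p) /\
    forall (c : k) (x y : forall i, A i p), family x -> family y ->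
      family (fun i => c *: x i + y i);
  family_d : forall p (x : forall i, A i p), family x -> family (fun i => cx_d p (x i));
  family_act : forall n (p r : int) (x : O n p) (q : 'I_n -> int)
    (a : forall j i, A i (q j)) (e : p + \sum_(j < n) q j = r),
    (forall j, family (a j)) ->
    family (fun i => act x (a := fun j => hel (a j i)) e) }.

Variable S : closed_family.

Definition subprod_sub (p : int) : submod (pi_mod (fun i => A i p)) :=
  @Submod k (pi_mod (fun i => A i p)) (@family S p) (family_lin S p).
Definition subprod_mod (p : int) : lmodType k := smod (subprod_sub p).

Definition subprod_proj i p (x : subprod_mod p) : A i p := smod_val x i.

Definition mk_subprod p (x : forall i, A i p) (Sx : family S x) : subprod_mod p :=
  to_smod (S := subprod_sub p) (x := x) Sx.

Lemma subprodP p (x : subprod_mod p) : family S (fun i => subprod_proj i x).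
Proof. exact: smodP x. Qed.

Lemma subprod_eq p (x y : subprod_mod p) :
  (forall i, subprod_proj i x = subprod_proj i y) -> x = y.
Proof. by move=> e; apply: smod_inj; exact: piE. Qed.

Lemma subprod_proj_lin i p : linear (@subprod_proj i p).
Proof. by move=> c x y; rewrite /subprod_proj smod_lin. Qed.

Definition subprod_d p (x : subprod_mod p) : subprod_mod (p + 1) :=
  mk_subprod (family_d (subprodP x)).

Fact subprod_d_lin p : linear (@subprod_d p).
Proof.
move=> c x y; apply: subprod_eq => i; rewrite subprod_proj_lin.
change (cx_d p (subprod_proj i (c *: x + y)) =
  c *: cx_d p (subprod_proj i x) + cx_d p (subprod_proj i y)).
by rewrite subprod_proj_lin linearP.
Qed.
HB.instance Definition _ p := GRing.isLinear.Build k (subprod_mod p) (subprod_mod (p + 1)) _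
  (@subprod_d p) (@subprod_d_lin p).

Fact subprod_dd p (x : subprod_mod p) : subprod_d (subprod_d x) = 0.
Proof.
apply: subprod_eq => i.
change (cx_d (p + 1) (cx_d p (subprod_proj i x)) = subprod_proj i 0); rewrite cx_dd.
by have [g ->] := linear_pack (@subprod_proj_lin i (p + 1 + 1)); rewrite linear0.
Qed.

Definition subprod_cx : complex k := @Complex k subprod_mod (fun p => @subprod_d p) subprod_dd.

Definition subprod_act n (p r : int) (x : O n p) (a : 'I_n -> helt subprod_cx)
  (e : p + \sum_(i < n) tag (a i) = r) : subprod_cx r :=
  mk_subprod (family_act x e (fun j => subprodP (tagged (a j)))).

Inductive is_subprod_proj : forall C : algebra O, (forall p, subprod_cx p -> C p) -> Prop :=
  IsSubprodProj i : is_subprod_proj (subprod_proj i).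

Definition subprod : algebra O.
Proof.
apply: (@joint_algebra k O subprod_cx subprod_act is_subprod_proj).
- by move=> _ _ [i]; split=> // p; exact: subprod_proj_lin.
- by move=> _ _ [i].
- by move=> p y z e; apply: subprod_eq => i; exact: (e _ _ (IsSubprodProj i)).
Defined.

Fact subprod_hom_proof i : is_alg_hom (A := subprod) (B := A i) (subprod_proj i).
Proof.
split; first by split=> // p; exact: subprod_proj_lin.
by move=> n p r x a e e'; exact: act_ext.
Qed.

Definition subprod_hom i : alg_hom subprod (A i) := AlgHom (subprod_hom_proof i).

Lemma subprod_universal (T : algebra O) (t : forall i, alg_hom T (A i)) :
  (forall p (x : T p), family S (fun i => t i p x)) ->
  exists! h : alg_hom T subprod, forall i, alg_hom_comp (subprod_hom i) h = t i.
Proof.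
move=> St; pose h p (x : T p) : subprod p := mk_subprod (St p x).
have hH : is_alg_hom h.
  split; first split=> [p c x y|p x].
  - apply: subprod_eq => i; rewrite subprod_proj_lin; exact: alg_hom_lin.
  - apply: subprod_eq => i; exact: alg_hom_d.
  - move=> n p r x a e e'; apply: subprod_eq => i; exact: ((alg_homP (t i)).2 n p r x a e e').
exists (AlgHom hH); split=> [i|h' h'E]; first exact: alg_hom_eq.
apply: alg_hom_eq; apply: functional_extensionality_dep => p; apply: funext => x.
apply: subprod_eq => i.
by rewrite -[RHS]/(alg_hom_comp (subprod_hom i) h' p x) h'E.
Qed.

End Subproduct.

Section PresentedMaps.
Variables (k : comPzRingType) (O : operad k) (Gen Cell : int -> Type).
Variable model : forall C : algebra O, gens Gen C -> cells Cell C -> Prop.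
Notation Z := (pres_alg model).

Lemma pres_gens_chain (X : complex k) (i : forall p, X p -> Gen p) :
  (forall (C : algebra O) (g : gens Gen C) (c : cells Cell C), model g c ->
     is_chain_map (fun p x => g p (i p x))) ->
  is_chain_map (Y := Z) (fun p x => @pres_gens _ _ _ _ model p (i p x)).
Proof.
move=> H; split=> [p b x y|p x]; apply: pres_alg_eq => C g c h m [hg _].
  by rewrite (alg_hom_lin h) !hg (H _ _ _ m).1.
by rewrite alg_hom_d !hg (H _ _ _ m).2.
Qed.

Lemma pres_gens_hom (A : algebra O) (i : forall p, A p -> Gen p) :
  (forall (C : algebra O) (g : gens Gen C) (c : cells Cell C), model g c ->
     is_alg_hom (B := C) (fun p x => g p (i p x))) ->
  is_alg_hom (B := Z) (fun p x => @pres_gens _ _ _ _ model p (i p x)).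
Proof.
move=> H; split.
  by apply: pres_gens_chain => C g c m; exact: (H _ _ _ m).1.
move=> n p r x a e e'; apply: pres_alg_eq => C g c h m [hg _].
rewrite hg ((H _ _ _ m).2 n p r x a e e').
rewrite ((alg_homP h).2 n p r x
  (fun j => hel_map (fun p x => @pres_gens _ _ _ _ model p (i p x)) (a j)) e' e').
by apply: act_ext => j; rewrite /hel_map /hel /= hg.
Qed.
End PresentedMaps.

Section Colimits.
Variables (k : comPzRingType) (O : operad k).

Lemma hom_app (A B : Alg O) (f g : hom A B) p (x : (A : algebra O) p) :
  f = g -> alg_hom_fun f x = alg_hom_fun g x.
Proof. by move=> ->. Qed.

Lemma hom_ext (A B : Alg O) (f g : hom A B) :
  (forall p (x : (A : algebra O) p), alg_hom_fun f x = alg_hom_fun g x) -> f = g.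
Proof.
move=> e; apply: alg_hom_eq; apply: functional_extensionality_dep => p.
by apply: funext => x; exact: e.
Qed.

Definition no_cell (p : int) : Type := void.
Definition no_cells (C : complex k) : cells no_cell C := fun p z (y : void) => match y with end.

Section Diagram.
Variables (I : Type) (A : I -> algebra O) (E : forall i j, alg_hom (A i) (A j) -> Prop).

Definition cocone_gen (p : int) : Type := {i : I & A i p}.

Definition cocone_model (C : algebra O) (g : gens cocone_gen C) (_ : cells no_cell C) : Prop :=
  (forall i, is_alg_hom (A := A i) (B := C) (fun p x => g p (existT _ i x))) /\
  (forall i j (h : alg_hom (A i) (A j)), E h -> forall p (x : A i p),
     g p (existT _ j (h p x)) = g p (existT _ i x)).

Definition diagram_colim : algebra O := pres_alg cocone_model.

Fact diagram_in_proof i : is_alg_hom (A := A i) (B := diagram_colim)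
  (fun p x => @pres_gens _ _ _ _ cocone_model p (existT _ i x)).
Proof. by apply: (@pres_gens_hom k O _ _ cocone_model) => C g c [m _]; exact: m. Qed.

Definition diagram_in i : alg_hom (A i) diagram_colim := AlgHom (diagram_in_proof i).

Lemma diagram_in_cocone i j (h : alg_hom (A i) (A j)) : E h ->
  alg_hom_comp (diagram_in j) h = diagram_in i.
Proof.
move=> Eh; apply: hom_ext => p x; apply: pres_alg_eq => C g c u [_ m] [ug _].
by rewrite /= !ug (m _ _ _ Eh).
Qed.

Lemma diagram_colim_universal (T : algebra O) (t : forall i, alg_hom (A i) T) :
  (forall i j (h : alg_hom (A i) (A j)), E h -> alg_hom_comp (t j) h = t i) ->
  exists! h : alg_hom diagram_colim T, forall i, alg_hom_comp h (diagram_in i) = t i.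
Proof.
move=> tE; pose g : gens cocone_gen T := fun p x => t (tag x) p (tagged x).
have m : cocone_model g (@no_cells T).
  split=> [i|i j h Eh p x]; first exact: (alg_homP (t i)).
  exact: (hom_app x (tE i j h Eh)).
have [h hc] := pres_hom m; have [hg _] := hc.
exists h; split=> [i|h' h't].
  by apply: hom_ext => p x; rewrite /= hg.
apply: pres_hom_uniq hc _; split=> [p [i x]|p z []].
exact: (hom_app x (h't i)).
Qed.

End Diagram.

Lemma coproduct_exists (A B : Alg O) : exists (S : Alg O) (i : hom A S) (j : hom B S),
  is_coproduct i j.
Proof.
pose D (b : bool) : algebra O := if b then A else B.
pose E i j (h : alg_hom (D i) (D j)) := False.
exists (diagram_colim E : Alg O), (diagram_in E true), (diagram_in E false) => T f g.
pose t b : alg_hom (D b) T := if b as b return alg_hom (D b) T then f else g.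
have [h [ht hu]] := diagram_colim_universal (t := t) (fun i j h (Eh : E i j h) => match Eh with end).
exists h; split; first by split; [exact: (ht true) | exact: (ht false)].
by move=> h' [e1 e2]; apply: hu => -[].
Qed.

Lemma free_algebra_exists (X : complex k) :
  exists (F : Alg O) (eta : forall p, X p -> (F : algebra O) p), is_free_algebra eta.
Proof.
pose model (C : algebra O) (g : gens (fun p => X p) C) (_ : cells no_cell C) :=
  is_chain_map g.
exists (pres_alg model : Alg O), (@pres_gens _ _ _ _ model); split.
  by apply: (@pres_gens_chain k O _ _ model X (fun p x => x)).
move=> B g gc; have [h hc] := @pres_hom k O _ _ model B g (@no_cells B) gc.
exists h; split; first exact: hc.1.
by move=> h' h'g; apply: pres_hom_uniq hc _; split=> // p z [].
Qed.

(** The diagram is indexed by the enumeration [f] of the objects, which may repeat. Two indices of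
    the same object are linked by its identity arrow, so the chosen index [sel a] gives the same leg
    as any other. *)
Lemma finite_colimits (J : category) (F : functor J (Alg O)) :
  finite_category J -> has_colimit F.
Proof.
move=> [[n [f fs]] _].
pose A i : algebra O := F (f i).
pose E i j (h : alg_hom (A i) (A j)) := exists a : hom (f i) (f j), h = fmap F a.
pose L := diagram_colim E; pose l := diagram_in E.
pose cast i a (e : f i = a) : alg_hom (F a : Alg O) L :=
  match e in _ = a return alg_hom (F a : Alg O) L with erefl => l i end.
have castE i j a (e : f j = a) (u : hom (f i) a) : alg_hom_comp (cast j a e) (fmap F u) = l i.
  by case: a / e u => u; apply: diagram_in_cocone; exists u.
pose sel a := sval (cid (fs a)); have selP a : f (sel a) = a := svalP (cid (fs a)).
pose la a := cast (sel a) a (selP a).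
have laE i : la (f i) = l i.
  have := castE i _ _ (selP (f i)) (idc (f i)); rewrite fmap1.
  by rewrite (_ : alg_hom_comp _ _ = la (f i)) //; exact: (@compc1 (Alg O)).
exists (L : Alg O), la; split.
  move=> a b u; have [i ei] := fs a; case: a / ei u => u.
  by rewrite laE; exact: castE.
move=> T t tc.
have [|h [ht hu]] := @diagram_colim_universal _ A E T (fun i => t (f i)).
  by move=> i j u [v ->]; exact: tc.
exists h; split=> [a|h' h't].
  have [i <-] := fs a; rewrite laE; exact: ht.
by apply: hu => i; have := h't (f i); rewrite laE.
Qed.

Lemma finite_limits (J : category) (F : functor J (Alg O)) :
  finite_category J -> has_limit F.
Proof.
move=> [[n [f fs]] _].
pose A i : algebra O := F (f i).
pose P p (x : forall i, A i p) :=
  forall i j (u : hom (f i) (f j)), alg_hom_fun (fmap F u) (x i) = x j.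
have Plin p : P p (fun i => 0) /\ forall (c : k) (x y : forall i, A i p), P p x -> P p y ->
    P p (fun i => c *: x i + y i).
  split=> [i j u|c x y Px Py i j u].
    by have [g ->] := linear_pack (alg_hom_lin (fmap F u) (p := p)); rewrite linear0.
  by rewrite (alg_hom_lin (fmap F u)) Px Py.
have Pd p (x : forall i, A i p) : P p x -> P (p + 1) (fun i => cx_d p (x i)).
  by move=> Px i j u; rewrite alg_hom_d Px.
have Pact m p r (x : O m p) q (a : forall j i, A i (q j)) (e : p + \sum_(j < m) q j = r) :
    (forall j, P (q j) (a j)) -> P r (fun i => act x (a := fun j => hel (a j i)) e).
  move=> Pa i j u.
  rewrite ((alg_homP (fmap F u)).2 m p r x (fun l => hel (a l i)) e e).
  by apply: act_ext => l; rewrite /hel_map /hel /= Pa.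
pose S := ClosedFamily Plin Pd Pact.
pose L := subprod S; pose l := subprod_hom S.
pose cast i a (e : f i = a) : alg_hom L (F a : Alg O) :=
  match e in _ = a return alg_hom L (F a : Alg O) with erefl => l i end.
have castE i j a (e : f j = a) (u : hom a (f i)) : alg_hom_comp (fmap F u) (cast j a e) = l i.
  case: a / e u => u; apply: hom_ext => p x /=; exact: (subprodP x).
pose sel a := sval (cid (fs a)); have selP a : f (sel a) = a := svalP (cid (fs a)).
pose la a := cast (sel a) a (selP a).
have laE i : la (f i) = l i.
  have := castE i _ _ (selP (f i)) (idc (f i)); rewrite fmap1.
  by rewrite (_ : alg_hom_comp _ _ = la (f i)) //; exact: (@comp1c (Alg O)).
exists (L : Alg O), la; split.
  move=> a b u; have [i ei] := fs b; case: b / ei u => u.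
  by rewrite laE; exact: castE.
move=> T t tc.
have [|h [ht hu]] := @subprod_universal _ _ _ A S T (fun i => t (f i)).
  by move=> p x i j u; exact: (hom_app x (tc _ _ u)).
exists h; split=> [a|h' h't].
  have [i <-] := fs a; rewrite laE; exact: ht.
by apply: hu => i; have := h't (f i); rewrite laE.
Qed.

End Colimits.

(** * Lifting properties and factorizations *)

Section QuasiIso.
Variable k : comPzRingType.
Implicit Types X Y Z : complex k.

Lemma chain_mapB X Y (f : forall p, X p -> Y p) p (x y : X p) :
  is_chain_map f -> f p (x - y) = f p x - f p y.
Proof. by move=> [fl _]; have [g ->] := linear_pack (fl p); rewrite linearB. Qed.

Lemma chain_mapD X Y (f : forall p, X p -> Y p) p (x y : X p) :
  is_chain_map f -> f p (x + y) = f p x + f p y.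
Proof. by move=> [fl _]; have [g ->] := linear_pack (fl p); rewrite linearD. Qed.

Lemma chain_map0 X Y (f : forall p, X p -> Y p) p : is_chain_map f -> f p 0 = 0.
Proof. by move=> [fl _]; have [g ->] := linear_pack (fl p); rewrite linear0. Qed.

Lemma quasi_iso_two_of_three X Y Z (f : forall p, X p -> Y p) (g : forall p, Y p -> Z p) :
  is_chain_map f -> is_chain_map g ->
  let gf p x := g p (f p x) in
  [/\ quasi_iso f -> quasi_iso g -> quasi_iso gf,
      quasi_iso f -> quasi_iso gf -> quasi_iso g
    & quasi_iso g -> quasi_iso gf -> quasi_iso f].
Proof.
move=> fc gc gf; split=> [fq gq|fq gfq|gq gfq] p.
- have [[fi fs] [gi gs]] := (fq p, gq p); split=> [x dx gfx|z dz].
    by apply: fi => //; apply: gi gfx; rewrite -fc.2 dx (chain_map0 _ fc).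
  have [y [dy [w yw]]] := gs z dz; have [x [dx [v xv]]] := fs y dy.
  exists x; split=> //; exists (w + g p v); rewrite linearD /= -yw -gc.2 -xv (chain_mapB _ _ gc).
  by rewrite addrA subrK.
- have [[fi fs] [gfi gfs]] := (fq p, gfq p); split=> [y dy [z gyz]|z dz].
    have [x [dx [w xw]]] := fs y dy.
    have [v xv] : exists v, x = cx_d p v.
      apply: gfi => //; exists (z - g p w).
      by rewrite linearB /= -gyz -gc.2 -xw (chain_mapB _ _ gc) opprB [RHS]addrC subrK.
    exists (w + f p v); rewrite linearD /= -xw -fc.2 -xv.
    by rewrite subrK.
  have [x [dx [w xw]]] := gfs z dz.
  by exists (f _ x); split; [rewrite -fc.2 dx (chain_map0 _ fc) | exists w].
- have [[gi gs] [gfi gfs]] := (gq p, gfq p); split=> [x dx [y fxy]|y dy].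
    by apply: gfi => //; exists (g p y); rewrite /gf fxy gc.2.
  have [|x [dx [w xw]]] := gfs (g _ y); first by rewrite -gc.2 dy (chain_map0 _ gc).
  exists x; split=> //; apply: gi; first by rewrite linearB /= dy -fc.2 dx (chain_map0 _ fc) subr0.
  by exists w; rewrite (chain_mapB _ _ gc).
Qed.

(* [quasi_iso] speaks of degrees of the form [p + 1], hence the substitution of [p]. *)
Lemma trivial_fibration_fill_complex X Y (f : forall p, X p -> Y p) :
  is_chain_map f -> quasi_iso f -> (forall p (y : Y p), exists x, f p x = y) ->
  forall p (t : X (p + 1)) (y : Y p), cx_d _ t = 0 -> f _ t = cx_d p y ->
  exists x : X p, cx_d p x = t /\ f p x = y.
Proof.
move=> fc fq fs p; have [q ->] : exists q, p = q + 1 by exists (p - 1); rewrite subrK.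
move=> t y dt ft; have [x0 fx0] := fs _ y.
have [w wE] : exists w, t - cx_d _ x0 = cx_d _ w.
  apply: (fq _).1; first by rewrite linearB /= dt cx_dd subrr.
  by exists 0; rewrite linear0 (chain_mapB _ _ fc) fc.2 fx0 ft subrr.
(* Now [x0 + w] has the right differential, but its image is off by the cocycle [f _ w]. A cocycle
   [v] and a coboundary [cx_d _ a] together have this image, and subtracting them leaves the
   differential unchanged. *)
have dfw : cx_d _ (f _ w) = 0.
  by rewrite -fc.2 -wE (chain_mapB _ _ fc) fc.2 fx0 ft subrr.
have [v [dv [b vb]]] := (fq q).2 _ dfw; have [a fa] := fs _ b.
exists (x0 + (w - v - cx_d _ a)); split.
  by rewrite linearD linearB linearB /= dv cx_dd !subr0 -wE [LHS]addrC subrK.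
rewrite (chain_mapD _ _ fc) !(chain_mapB _ _ fc) fx0 fc.2 fa vb.
by rewrite subrr addr0.
Qed.

End QuasiIso.

Section AlgebraMaps.
Variables (k : comPzRingType) (O : operad k).
Implicit Types A B C D X Y Z : Alg O.

Lemma alg_chain A B (f : hom A B) : is_chain_map (alg_hom_fun f).
Proof. exact: (alg_homP f).1. Qed.

Lemma quasi_iso_retract : retract_closed (@alg_quasi_iso k O).
Proof.
move=> A B X Y f g [i [r [j [s [ri sj gi fr]]]]] gq p; have [gi' gs] := gq p.
have riE q (x : (A : algebra O) q) : alg_hom_fun r (alg_hom_fun i x) = x := hom_app x ri.
have sjE q (y : (B : algebra O) q) : alg_hom_fun s (alg_hom_fun j y) = y := hom_app y sj.
have giE q (x : (A : algebra O) q) :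
  alg_hom_fun g (alg_hom_fun i x) = alg_hom_fun j (alg_hom_fun f x) := hom_app x gi.
have frE q (x : (X : algebra O) q) :
  alg_hom_fun f (alg_hom_fun r x) = alg_hom_fun s (alg_hom_fun g x) := hom_app x fr.
split=> [x dx [y fxy]|y dy].
  have [||w xw] := gi' (alg_hom_fun i x).
  - by rewrite -(alg_chain i).2 dx (chain_map0 _ (alg_chain i)).
  - by exists (alg_hom_fun j y); rewrite giE fxy (alg_chain j).2.
  by exists (alg_hom_fun r w); rewrite -(riE _ x) xw (alg_chain r).2.
have [|x [dx [w xw]]] := gs (alg_hom_fun j y).
  by rewrite -(alg_chain j).2 dy (chain_map0 _ (alg_chain j)).
exists (alg_hom_fun r x); split.
  by rewrite -(alg_chain r).2 dx (chain_map0 _ (alg_chain r)).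
exists (alg_hom_fun s w).
by rewrite frE -{1}(sjE _ y) -(chain_mapB _ _ (alg_chain s)) xw (alg_chain s).2.
Qed.

Lemma surjective_retract : retract_closed (@alg_surjective k O).
Proof.
move=> A B X Y f g [i [r [j [s [ri sj gi fr]]]]] gs p y.
have [x gx] := gs p (alg_hom_fun j y); exists (alg_hom_fun r x).
have -> : alg_hom_fun f (alg_hom_fun r x) = alg_hom_fun s (alg_hom_fun g x) := hom_app x fr.
by rewrite gx; exact: (hom_app y sj).
Qed.

Definition trivial_fibration A B (f : hom A B) : Prop := alg_surjective f /\ alg_quasi_iso f.

Lemma trivial_fibration_alg_fill A B (f : hom A B) p (t : (A : algebra O) (p + 1))
  (y : (B : algebra O) p) : trivial_fibration f ->
  cx_d _ t = 0 -> alg_hom_fun f t = cx_d p y ->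
  exists x : (A : algebra O) p, cx_d p x = t /\ alg_hom_fun f x = y.
Proof.
move=> [fs fq]; exact: (trivial_fibration_fill_complex (alg_chain f) fq fs).
Qed.

Definition trivial_cell A B (i : hom A B) : Prop :=
  forall X Y (q : hom X Y), alg_surjective q -> has_lifting i q.

(** With the lifting property as definition, stability under retracts and lifting against trivial
    fibrations are immediate; the other half of the lifting axiom and the factorizations carry the
    content. *)
Definition cofibration A B (i : hom A B) : Prop :=
  forall X Y (q : hom X Y), trivial_fibration q -> has_lifting i q.

Lemma cofibration_retract : retract_closed cofibration.
Proof.
move=> A B X Y f g [i [r [j [s [ri sj gi fr]]]]] gC C D q qT u v uv.
have [|h [hg qh]] := gC C D q qT (u \oc r) (v \oc s).
  by rewrite compA uv -!compA fr.
exists (h \oc j); split.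
  by rewrite -compA -gi compA hg -compA ri compc1.
by rewrite compA qh -compA sj compc1.
Qed.

(* If [i = q c] with [c] a weak equivalence and [q] surjective, lifting the identity of
   the target along [q] makes [i] a retract of [c]. *)
Lemma trivial_cell_quasi_iso A B (i : hom A B) : cofibrant_operad (O : Op k) ->
  trivial_cell i -> alg_quasi_iso i.
Proof.
move=> cof iL; have [M [c [q [qc cW qS]]]] := factor_weak_surjective cof i.
have [|h [hi qh]] := iL M B q qS c (idc B); first by rewrite qc comp1c.
apply: quasi_iso_retract cW; exists (idc A), (idc A), h, q; split=> //.
- exact: comp1c.
- by rewrite hi compc1.
- by rewrite compc1 qc.
Qed.

Section FreeGenerators.
Variables (X Y : Alg O) (f : hom X Y).

(** The left summand will be the image of [X]. A generator [inr y], when nothing is imposed on its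
    differential, spans with it a copy of [W_p]; there is one for each element [y], so the resulting
    algebra maps onto [Y]. *)
Definition free_gen (p : int) : Type := ((X : algebra O) p + (Y : algebra O) p)%type.

Definition free_model (C : algebra O) (g : gens free_gen C) (_ : cells no_cell C) : Prop :=
  is_alg_hom (A := X) (B := C) (fun p x => g p (inl x)).

Lemma factor_trivial_cell : exists (Z : Alg O) (i : hom X Z) (q : hom Z Y),
  [/\ f = q \oc i, trivial_cell i & alg_surjective q].
Proof.
pose Z : algebra O := pres_alg free_model.
pose gZ p (x : free_gen p) : Z p := @pres_gens _ _ _ _ free_model p x.
have iH : is_alg_hom (A := X) (B := Z) (fun p x => gZ p (inl x)).
  exact: (@pres_gens_hom k O _ _ free_model X (fun p x => inl x)).
pose i : hom X (Z : Alg O) := AlgHom iH.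
pose gY : gens free_gen (Y : algebra O) := fun p x =>
  match x with inl x => alg_hom_fun f x | inr y => y end.
have mY : free_model gY (@no_cells k Y) by exact: (alg_homP f).
have [q qc] := pres_hom mY.
exists (Z : Alg O), i, q; split.
- by apply: hom_ext => p x; rewrite /= qc.1.
- move=> C D w wS u v uv.
  have liftP p (y : (Y : algebra O) p) :
    exists c, alg_hom_fun w c = alg_hom_fun v (gZ p (inr y)) by exact: wS.
  pose gC : gens free_gen (C : algebra O) := fun p x =>
    match x with inl x => alg_hom_fun u x | inr y => sval (cid (liftP p y)) end.
  have mC : free_model gC (@no_cells k C) by exact: (alg_homP u).
  have [h hc] := pres_hom mC; have [hg _] := hc.
  exists h; split; first by apply: hom_ext => p x; rewrite /= hg.
  (* The lower triangle holds because [w] after [h] and [v] agree on generators, by [uv] on those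
     from [X] and by the choice of preimages on the others. *)
  apply: (@pres_hom_uniq k O _ _ free_model D (fun p x => alg_hom_fun v (gZ p x)) (@no_cells k D)).
    split=> [p [x|y]|p z []]; rewrite /= hg; first exact: (hom_app x uv).
    exact: (svalP (cid (liftP p y))).
  by split=> [//|p z []].
- by move=> p y; exists (gZ p (inr y)); rewrite qc.1.
Qed.

End FreeGenerators.

Section Pullback.
Variables (C Z D : algebra O) (q : alg_hom C D) (v : alg_hom Z D).

(** A lift of [v] along [q] amounts to a section of the projection to [Z]. When [Z] is an initial
    model, such a section exists once the pullback is made a model. *)
Lemma pullback_exists : exists (P : algebra O) (a : alg_hom P C) (b : alg_hom P Z),
  [/\ forall p x y, q p x = v p y -> exists e, a p e = x /\ b p e = y,
      forall p e, q p (a p e) = v p (b p e),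
      forall p e e', a p e = a p e' -> b p e = b p e' -> e = e'
    & forall (T : algebra O) (s : alg_hom T C) (t : alg_hom T Z),
        (forall p x, q p (s p x) = v p (t p x)) ->
        exists h : alg_hom T P, forall p x, a p (h p x) = s p x /\ b p (h p x) = t p x].
Proof.
pose F (b : bool) : algebra O := if b then C else Z.
pose S p (x : forall b, F b p) := q p (x true) = v p (x false).
have Slin p : S p (fun i => 0) /\ forall (c : k) (x y : forall b, F b p), S p x -> S p y ->
    S p (fun i => c *: x i + y i).
  split=> [|c x y Sx Sy]; first by rewrite /S (chain_map0 _ (alg_homP q).1) (chain_map0 _ (alg_homP v).1).
  by rewrite /S (alg_hom_lin q) (alg_hom_lin v) Sx Sy.
have Sd p (x : forall b, F b p) : S p x -> S (p + 1) (fun i => cx_d p (x i)).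
  by rewrite /S !alg_hom_d => ->.
have Sact m p r (x : O m p) t (a : forall j i, F i (t j)) (e : p + \sum_(j < m) t j = r) :
    (forall j, S (t j) (a j)) -> S r (fun i => act x (a := fun j => hel (a j i)) e).
  move=> Sa; rewrite /S ((alg_homP q).2 m p r x (fun l => hel (a l true)) e e).
  rewrite ((alg_homP v).2 m p r x (fun l => hel (a l false)) e e).
  by apply: act_ext => l; rewrite /hel_map /hel /= Sa.
pose T := ClosedFamily Slin Sd Sact.
exists (subprod T), (subprod_hom T true), (subprod_hom T false); split.
- move=> p x y xy.
  pose z b : F b p := if b as b return F b p then x else y.
  by exists (mk_subprod (S := T) (x := z) xy).
- by move=> p e; exact: (subprodP e).
- by move=> p e e' ae be; apply: subprod_eq => -[].
- move=> U s t st.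
  pose z b : alg_hom U (F b) := if b as b return alg_hom U (F b) then s else t.
  have [h [hz _]] := @subprod_universal _ _ _ F T U z st.
  exists h => p x; split; [exact: (hom_app x (hz true)) | exact: (hom_app x (hz false))].
Qed.

End Pullback.

Section KillCocycles.
Variables (X Y : Alg O) (f : hom X Y).

(* Generators [cell w y] are adjoined for all [w] and [y]; the condition
   [d (cell w y) = w] is only imposed where it makes sense. *)
Definition kill_model (C : algebra O) (g : gens (free_gen X Y) C)
  (c : cells (fun p => (Y : algebra O) p) C) : Prop :=
  is_alg_hom (A := X) (B := C) (fun p x => g p (inl x)) /\
  exists fC : alg_hom C Y,
    [/\ forall p x, fC p (g p (inl x)) = alg_hom_fun f x,
        forall p y, fC p (g p (inr y)) = y,
        forall p w y, fC p (c p w y) = y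
      & forall p w y, cx_d _ w = 0 -> fC _ w = cx_d p y -> cx_d p (c p w y) = w].

Lemma factor_cofibration : exists (Z : Alg O) (i : hom X Z) (q : hom Z Y),
  [/\ f = q \oc i, cofibration i & trivial_fibration q].
Proof.
pose Z : algebra O := pres_alg kill_model.
pose gZ p (x : free_gen X Y p) : Z p := @pres_gens _ _ _ _ kill_model p x.
pose cZ p (z : Z (p + 1)) (y : (Y : algebra O) p) : Z p := @pres_cells _ _ _ _ kill_model p z y.
have iH : is_alg_hom (A := X) (B := Z) (fun p x => gZ p (inl x)).
  by apply: (@pres_gens_hom k O _ _ kill_model X (fun p x => inl x)) => C g c [].
pose i : hom X (Z : Alg O) := AlgHom iH.
pose gY : gens (free_gen X Y) (Y : algebra O) := fun p x =>
  match x with inl x => alg_hom_fun f x | inr y => y end.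
(* [Y] over itself is a model in which the cell over [y] is [y]; the required [d y = w] is then the
   premise itself. *)
pose cY : cells (fun p => (Y : algebra O) p) (Y : algebra O) := fun p w y => y.
have mY : kill_model gY cY.
  by split; [exact: (alg_homP f) | exists (alg_hom_id Y); split].
have [q qc] := pres_hom mY; have [qg qcell] := qc.
(* The defining implication of a model is inherited by [Z]: in a model [C] its premise on images
   follows from the premise in [Z], since [fC] after [h] is [q] by uniqueness. *)
have cZd p (w : Z (p + 1)) y : cx_d _ w = 0 -> q _ w = cx_d p y -> cx_d p (cZ p w y) = w.
  move=> dw qw; apply: pres_alg_eq => C g c h m hc; have [hg hcell] := hc.
  have [_ [fC [f1 f2 f3 f4]]] := m.
  rewrite alg_hom_d hcell; apply: f4; first by rewrite -alg_hom_d dw (chain_map0 _ (alg_homP h).1).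
  rewrite -qw; apply: (hom_app w (f := (fC : hom (C : Alg O) Y) \oc h)).
  apply: (pres_hom_uniq _ qc); split=> [r [x|x]|r z x] /=.
  - by rewrite hg f1.
  - by rewrite hg f2.
  - by rewrite hcell f3.
exists (Z : Alg O), i, q; split.
- by apply: hom_ext => p x; rewrite /= qg.
- move=> C D w wT u v uv.
  (* The lift is sought as a section of [b : P -> Z], obtained from a model structure on the
     pullback [P]; the projection [b] has to respect generators and cells. *)
  have [P [a [b [Pex Peq Pinj Puni]]]] := pullback_exists w v.
  have [e0 e0P] := Puni X u i (fun p x => hom_app x uv).
  have gP p (y : (Y : algebra O) p) : exists e, b p e = gZ p (inr y).
    have [c wc] := wT.1 p (alg_hom_fun v (gZ p (inr y))).
    by have [e [_ be]] := Pex p c _ wc; exists e.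
  have cP p (t : P (p + 1)) (y : (Y : algebra O) p) : exists e, b p e = cZ p (b _ t) y /\
      (cx_d _ t = 0 -> q _ (b _ t) = cx_d p y -> cx_d p e = t).
    (* If [t] is a cocycle over [d y], the cell must have differential [t], and [w] being a trivial
       fibration allows this; otherwise any element over the cell of [Z] will do, and surjectivity
       suffices. *)
    have [[dt qt]|nt] := pselect (cx_d _ t = 0 /\ q _ (b _ t) = cx_d p y).
      have dZ : cx_d p (cZ p (b _ t) y) = b _ t.
        by apply: cZd => //; rewrite -alg_hom_d dt (chain_map0 _ (alg_homP b).1).
      have [||c [dc wc]] := @trivial_fibration_alg_fill _ _ w p (a _ t) (alg_hom_fun v (cZ p (b _ t) y)) wT.
      + by rewrite -alg_hom_d dt (chain_map0 _ (alg_homP a).1).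
      + by rewrite Peq -alg_hom_d dZ.
      have [e [ae be]] := Pex p _ _ wc; exists e; split=> // _ _.
      by apply: Pinj; rewrite alg_hom_d ?ae ?be.
    have [c wc] := wT.1 p (alg_hom_fun v (cZ p (b _ t) y)).
    by have [e [_ be]] := Pex p c _ wc; exists e; split=> // d1 d2; case: nt.
  pose g : gens (free_gen X Y) P := fun p x =>
    match x with inl x => e0 p x | inr y => sval (cid (gP p y)) end.
  pose c : cells (fun p => (Y : algebra O) p) P := fun p t y => sval (cid (cP p t y)).
  have m : kill_model g c.
    split; first exact: (alg_homP e0).
    exists (alg_hom_comp q b); split=> [p x|p y|p t y|p t y] /=.
    + by rewrite (e0P p x).2 /= qg.
    + by rewrite (svalP (cid (gP p y))) qg.
    + by rewrite (svalP (cid (cP p t y))).1 qcell.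
    + exact: (svalP (cid (cP p t y))).2.
  have [s [sg scell]] := pres_hom m.
  have bs : alg_hom_comp b s = alg_hom_id Z.
    apply: (@pres_hom_uniq k O _ _ kill_model Z gZ cZ); last by split.
    split=> [p [x|y]|p z y] /=.
    + by rewrite sg (e0P p x).2.
    + by rewrite sg (svalP (cid (gP p y))).
    + by rewrite scell (svalP (cid (cP p _ y))).1.
  exists (alg_hom_comp a s); split; apply: hom_ext => p x /=.
    by rewrite sg (e0P p x).1.
  by rewrite Peq; congr (alg_hom_fun v _); exact: (hom_app x bs).
- split; first by move=> p y; exists (gZ p (inr y)); rewrite qg.
  move=> p; split=> [x dx [y xy]|y dy]; first by exists (cZ p x y); rewrite cZd.
  have d0 := chain_map0 _ (alg_homP q).1.
  (* The generator over the cocycle [y] need not be closed. Its differential lies over [0], so the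
     cell with label [0] is a primitive of it inside the kernel of [q]; the difference is a cocycle
     over [y]. *)
  pose w := cZ _ (cx_d _ (gZ (p + 1) (inr y))) 0.
  have dw : cx_d _ w = cx_d _ (gZ (p + 1) (inr y)).
    by apply: cZd; [exact: cx_dd | rewrite alg_hom_d qg /= dy linear0].
  exists (gZ (p + 1) (inr y) - w); split; first by rewrite linearB /= dw subrr.
  exists 0; rewrite linear0 (chain_mapB _ _ (alg_homP q).1) qg qcell /=.
  by rewrite /cY subr0 subrr.
Qed.

End KillCocycles.

End AlgebraMaps.

(** * The contractible cells *)

Section Disks.
Variables (k : comPzRingType) (d : int).
Local Notation disk := (disk k d).

(** The modules of [W_d] are row vectors whose length, at most one, depends on the degree. The sum
    reads off the coordinate uniformly and is zero in length zero. *)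
Definition row_sum n (w : 'rV[k]_n) : k := \sum_j w 0 j.

Lemma row_sum_lin n (a : k) (w z : 'rV[k]_n) : row_sum (a *: w + z) = a * row_sum w + row_sum z.
Proof. by rewrite /row_sum mulr_sumr -big_split; apply: eq_bigr => j _; rewrite !mxE. Qed.

Lemma row_sum_eq n (w z : 'rV[k]_n) : (n <= 1)%N -> row_sum w = row_sum z -> w = z.
Proof.
case: n w z => [|[|//]] w z _; first by move=> _; apply/rowP => -[].
by rewrite /row_sum !big_ord1 => e; apply/rowP => j; rewrite ord1.
Qed.

Lemma disk_rank p : ((p == d) + (p == d + 1)%R <= 1)%N.
Proof.
case: (p =P d) => [->|_]; last by case: (_ == _).
by case: eqP => // /eqP; rewrite -subr_eq0 opprD addNKr.
Qed.

Definition disk_gen : disk d := const_mx 1.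

Lemma row_sum_gen : row_sum (disk_gen : 'rV[k]__) = 1.
Proof.
have := disk_rank d; rewrite /row_sum /disk_gen eqxx.
under eq_bigr => j _ do rewrite mxE.
by rewrite sumr_const card_ord; case: (d == d + 1).
Qed.

Lemma row_sum_disk_d p (w : disk p) :
  row_sum (cx_d p w : 'rV[k]__) = if p == d then row_sum (w : 'rV[k]__) else 0.
Proof.
have de (j : 'I_((p + 1 == d) + (p + 1 == d + 1)%R)) :
    (cx_d p w : 'rV[k]__) 0 j = row_sum (w : 'rV[k]__) * (p == d)%:R.
  by rewrite mxE mulr_suml; apply: eq_bigr => l _; rewrite mxE.
rewrite {1}/row_sum (eq_bigr _ (fun j _ => de j)) sumr_const card_ord.
move: (row_sum _) => s; have := disk_rank (p + 1); rewrite (inj_eq (addIr 1)).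
case: (p == d); last by rewrite mulr0 mul0rn.
by rewrite mulr1; case: (p + 1 == d).
Qed.

(** [W_d] represents elements of degree [d]: the generator goes to [c] and its differential to that
    of [c]. Writing the targets with [single] avoids casts and gives zero in all other degrees. *)
Lemma disk_map_exists (C : complex k) (c : C d) :
  exists g : forall p, disk p -> C p, is_chain_map g /\ g d disk_gen = c.
Proof.
pose g p (w : disk p) : C p := row_sum (w : 'rV[k]__) *:
  (if p == d then single c p else single (cx_d d c) p).
exists g; split; last by rewrite /g row_sum_gen eqxx single_id scale1r.
split=> [p a w z|p w]; first by rewrite /g row_sum_lin scalerDl scalerA.
rewrite /g row_sum_disk_d linearZ /=; move: (row_sum _) => {w} s.
case: (p =P d) => [->|pd].
  rewrite ifN ?single_id //.
  by apply/eqP => /eqP; rewrite -subr_eq0 addrAC subrr add0r => /eqP.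
rewrite scale0r; case: (p =P d + 1) => [->|pd1].
  by rewrite single_id cx_dd scaler0.
by rewrite single0 ?linear0 ?scaler0 //; exact: nesym.
Qed.

Lemma disk_map_uniq (C : complex k) (g h : forall p, disk p -> C p) :
  is_chain_map g -> is_chain_map h -> g d disk_gen = h d disk_gen ->
  forall p (w : disk p), g p w = h p w.
Proof.
move=> gc hc e p w.
have sc (q : int) (u z : disk q) : row_sum (u : 'rV[k]__) = row_sum (z : 'rV[k]__) -> u = z.
  by apply: row_sum_eq; exact: disk_rank.
have scZ (f : forall p, disk p -> C p) q a (z : disk q) : is_chain_map f -> f q (a *: z) = a *: f q z.
  by move=> [fl _]; have [l ->] := linear_pack (fl q); rewrite linearZ.
have sumZ q a (z : disk q) : row_sum (a *: z : 'rV[k]__) = a * row_sum (z : 'rV[k]__).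
  by rewrite /row_sum mulr_sumr; apply: eq_bigr => j _; rewrite mxE.
case: (p =P d) => [pd|pd].
  case: _ / (esym pd) w => w.
  have -> : w = row_sum (w : 'rV[k]__) *: disk_gen.
    by apply: sc; rewrite sumZ row_sum_gen mulr1.
  by rewrite (scZ g) // (scZ h) // e.
case: (p =P d + 1) => [pd1|pd1].
  case: _ / (esym pd1) w => w.
  have -> : w = row_sum (w : 'rV[k]__) *: cx_d d disk_gen.
    by apply: sc; rewrite sumZ row_sum_disk_d [if _ then _ else _]ifT ?row_sum_gen ?mulr1.
  by rewrite (scZ g) // (scZ h) // gc.2 hc.2 e.
have -> : w = 0.
  have rs0 n (z : 'rV[k]_n) : n = 0%N -> row_sum z = 0.
    by move=> n0; case: _ / (esym n0) z => z; exact: big_ord0.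
  have p0 : ((p == d) + (p == d + 1)%R = 0)%N.
    by move/eqP/negPf: pd => ->; move/eqP/negPf: pd1 => ->.
  by apply: sc; rewrite !(rs0 _ _ p0).
by rewrite (chain_map0 _ gc) (chain_map0 _ hc).
Qed.

End Disks.

(** * The [H_1] property and the model structure *)

Section Main.
Variables (k : comPzRingType) (O : operad k).

(** A morphism out of [S] is a morphism out of [A] together with one element of degree [d], free of
    any condition. A lift therefore only requires a preimage under [q] of the image of the
    generator. *)
Lemma coproduct_disk_trivial_cell (d : int) (A F S : Alg O)
  (eta : forall p, disk k d p -> (F : algebra O) p) (i : hom A S) (j : hom F S) :
  is_free_algebra eta -> is_coproduct i j -> trivial_cell i.
Proof.
move=> [etac etaU] cop X Y q qS u v uv.
have [c qc] := qS d (alg_hom_fun v (alg_hom_fun j (eta d (disk_gen k d)))).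
have [g [gc gg]] := disk_map_exists c.
have [h0 [h0g _]] := etaU X g gc.
have [h [[hi hj] _]] := cop X u h0.
exists h; split=> //.
have [h' [_ h'u]] := cop Y (v \oc i) (v \oc j).
rewrite -(h'u (q \oc h)) ?(h'u v) //; split; first by rewrite -compA hi.
rewrite -compA hj.
have qgc : is_chain_map (fun p x => alg_hom_fun q (g p x)).
  split=> [p a x y|p x]; first by rewrite gc.1 (alg_hom_lin q).
  by rewrite gc.2 alg_hom_d.
have vjc : is_chain_map (fun p x => alg_hom_fun v (alg_hom_fun j (eta p x))).
  split=> [p a x y|p x]; first by rewrite etac.1 (alg_hom_lin j) (alg_hom_lin v).
  by rewrite etac.2 !alg_hom_d.
have [l [_ lu]] := etaU Y _ qgc.
rewrite -(lu (q \oc h0)); last by move=> p x /=; rewrite h0g.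
apply: lu => p x; apply: (disk_map_uniq vjc qgc).
by rewrite gg qc.
Qed.

Lemma cofibrant_H1 : cofibrant_operad (O : Op k) -> H1_operad O.
Proof.
move=> cof A d; split=> [|F eta S i j etaF cop].
  have [F [eta etaF]] := free_algebra_exists O (disk k d).
  have [S [i [j cop]]] := coproduct_exists A F.
  by exists F, eta, S, i, j.
exact: trivial_cell_quasi_iso cof (coproduct_disk_trivial_cell etaF cop).
Qed.

Lemma trivial_cell_cofibration (A B : Alg O) (i : hom A B) : trivial_cell i -> cofibration i.
Proof. by move=> iL X Y q [qS _]; exact: iL. Qed.

Lemma cofibrant_model_structure : cofibrant_operad (O : Op k) ->
  closed_model_structure (@alg_quasi_iso k O) (@alg_surjective k O) (@cofibration k O).
Proof.
move=> cof.
have W3 (X Y Z : Alg O) (f : hom X Y) (g : hom Y Z) := quasi_iso_two_of_three (alg_chain f) (alg_chain g).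
split.
- exact: finite_limits.
- exact: finite_colimits.
- exact: W3.
- by split; [exact: quasi_iso_retract | exact: surjective_retract | exact: cofibration_retract].
- move=> A B X Y i p iC pF [iW|pW]; last exact: iC.
  (* Here [q] is a weak equivalence by two out of three, so the cofibration [i] lifts against it and
     becomes a retract of [c]; it thus inherits the lifting property of [c] against all
     surjections. *)
  move=> u v uv; have [Z [c [q [icq cL qS]]]] := factor_trivial_cell i.
  have [_ Wq _] := W3 _ _ _ c q.
  have qW : alg_quasi_iso q.
    by apply: Wq; [exact: trivial_cell_quasi_iso | move: iW; rewrite icq].
  have [|h [hi qh]] := iC _ _ q (conj qS qW) c (idc B); first by rewrite comp1c -icq.
  have [|l [lc pl]] := cL _ _ p pF u (v \oc q); first by rewrite -compA -icq.
  exists (l \oc h); split; first by rewrite -compA hi.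
  by rewrite compA pl -compA qh compc1.
- move=> X Y f; have [Z [i [q [fE iC [qS qW]]]]] := factor_cofibration f.
  by exists Z, i, q.
- move=> X Y f; have [Z [i [q [fE iL qS]]]] := factor_trivial_cell f.
  exists Z, i, q; split=> //; first exact: trivial_cell_cofibration.
  exact: trivial_cell_quasi_iso.
Qed.

End Main.

Theorem theorem3p1 (k : comPzRingType) (O : operad k) :
  cofibrant_operad (O : Op k) ->
  H1_operad O /\
  exists Cof : hom_class (Alg O),
    closed_model_structure (@alg_quasi_iso k O) (@alg_surjective k O) Cof.
Proof.
move=> cof; split; first exact: cofibrant_H1.
by exists (@cofibration k O); exact: cofibrant_model_structure.
Qed.
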